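(* Let $X$ be an infinite minimal subshift with $\limsup_{q\to\infty} p(q)/q<1.5$. Then the dimension group $K^0(X,\sigma)$ and the reduced dimension group $\widehat{K^0}(X,\sigma)$ are both equal to (i.e. isomorphic, as unital ordered groups, to) $(E_X,\ E_X\cap\mathbb{R}^+,\ 1)$, where $E_X$ is the additive continuous eigenvalue group of $(X,\sigma)$.
   Context: A subshift is a closed subset $X\subset\mathcal{A}^{\mathbb{Z}}$ ($\mathcal{A}$ finite) invariant under the left shift $\sigma$; $p(q)$ is the number of words of length $q$ appearing in points of $X$. $E_X$ is the group of reals $\gamma$ for which there is a nonzero $f\in C(X)$ with $f(\sigma x)=e^{2\pi i\gamma}f(x)$ for all $x\in X$. $\mathbb{R}^+$ is the set of nonnegative reals. The dimension group $K^0(X,\sigma)$ of a minimal Cantor system is the unital ordered group $C(X,\mathbb{Z})/\{g-g\circ\sigma:g\in C(X,\mathbb{Z})\}$, with positive cone the set of classes of nonnegative functions and order unit the class of the constant function $1$. Its infinitesimal subgroup $\mathrm{Inf}(K^0(X,\sigma))$ consists of the classes $[f]$ with $\int f\,d\mu=0$ for every $\sigma$-invariant Borel probability measure $\mu$. The reduced dimension group is $\widehat{K^0}(X,\sigma)=K^0(X,\sigma)/\mathrm{Inf}(K^0(X,\sigma))$ with the induced order and unit. *)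

(* Defs.v *)
From HB Require Import structures.
From mathcomp Require Import all_boot all_order all_algebra.
From mathcomp Require Import generic_quotient ring_quotient.
From mathcomp Require Import complex.
From mathcomp Require Import all_classical all_reals all_analysis.
From mathcomp Require Import measurable_realfun.

Set Implicit Arguments.
Unset Strict Implicit.
Unset Printing Implicit Defensive.

Import Order.TTheory GRing.Theory Num.Theory.
Import numFieldNormedType.Exports.

Local Open Scope classical_set_scope.
Local Open Scope ring_scope.

Definition full_shift (A : finType) : Type :=
  {ptws int -> discrete_topology A}.

HB.instance Definition _ (A : finType) := Topological.on (full_shift A).

Definition shift (A : finType) (x : full_shift A) : full_shift A :=
  fun n => x (n + 1).

Definition unshift (A : finType) (x : full_shift A) : full_shift A :=
  fun n => x (n - 1).

Definition is_subshift (A : finType) (X : set (full_shift A)) : Prop :=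
  closed X /\ @shift A @` X = X.

(* Minimal: [points] is nonempty and contains no other nonempty subshift. *)
Record minimal_subshift (A : finType) := MinimalSubshift {
  points :> set (full_shift A);
  points_subshift : is_subshift points;
  points_neq0 : points !=set0;
  points_minimal : forall Y : set (full_shift A),
    Y `<=` points -> is_subshift Y -> Y !=set0 -> Y = points }.

Definition occurs (A : finType) (q : nat) (w : q.-tuple A) (x : full_shift A) :
  Prop := exists k : int, forall i : 'I_q, tnth w i = x (k + (i : nat)%:Z).

Definition complexity (A : finType) (X : set (full_shift A)) (q : nat) : nat :=
  #|[pred w : q.-tuple A | `[< exists2 x, X x & occurs w x >]]|.

Lemma reindex_continuous (K : topologicalType) (I J : eqType) (h : J -> I) :
 continuous ((fun f n => f (h n)) : {ptws I -> K} -> {ptws J -> K}).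
Proof.
move=> x; apply/cvg_sup; first exact/fmap_filter/nbhs_filter.
move=> i U [_ [[W oW <-] Wx] sU].
have pc := @proj_continuous _ (fun=> K) (h i) x.
have /pc := open_nbhs_nbhs (conj oW Wx).
by apply: (@filterS _ (nbhs x) _ (proj (h i) @^-1` W)) => // y Wy; exact: sU.
Qed.
Lemma shift_continuous (A : finType) : continuous (@shift A).
Proof.
exact: (@reindex_continuous (discrete_topology A) int int (fun n => n+1)).
Qed.

Lemma unshift_continuous (A : finType) : continuous (@unshift A).
Proof.
exact: (@reindex_continuous (discrete_topology A) int int (fun n => n-1)).
Qed.

Section Space.
Context (A : finType) (X : minimal_subshift A).

(* The points of [X] as a topological space, with the induced topology. *)
Definition space : Type := set_type (points X).

HB.instance Definition _ := Topological.on space.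

Lemma space_inhabited : exists x : space, True.
Proof. by have [x Xx] := points_neq0 X; exists (SigSub (mem_set Xx)). Qed.

(* Measurable types are required to be pointed. *)
HB.instance Definition _ := isPointed.Build space (sval (cid space_inhabited)).

Lemma space_shift (x : space) : points X (shift (\val x)).
Proof.
by have := imageP (@shift A) (set_valP x); rewrite (points_subshift X).2.
Qed.

Definition sigma (x : space) : space := SigSub (mem_set (space_shift x)).

Lemma sigma_continuous : continuous sigma.
Proof.
suff: continuous (\val \o sigma : space -> full_shift A).
  exact: (@continuous_comp_initial _ _ _ (\val : points X -> full_shift A)).
move=> x; apply: (@continuous_comp _ _ _ _ (@shift A)).
  exact: (@initial_continuous _ (full_shift A) (\val : points X -> full_shift A)).
exact: shift_continuous.
Qed.

Lemma sigma_surj (y : space) : exists x, sigma x = y.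
Proof.
have := set_valP y; rewrite -{1}(points_subshift X).2 => -[x Xx xy].
by exists (SigSub (mem_set Xx)); apply: val_inj.
Qed.

Lemma space_unshift (x : space) : points X (unshift (\val x)).
Proof.
have [y <-] := sigma_surj x; rewrite [X in points _ X](_ : _ = \val y).
  exact: set_valP.
by apply/funext => n; rewrite /= /unshift /shift subrK.
Qed.

Definition tau (x : space) : space := SigSub (mem_set (space_unshift x)).

Lemma sigmaK : cancel sigma tau.
Proof.
by move=> x; apply/val_inj/funext => n; rewrite /= /unshift /shift subrK.
Qed.

Lemma tauK : cancel tau sigma.
Proof.
by move=> x; apply/val_inj/funext => n; rewrite /= /unshift /shift addrK.
Qed.

Lemma tau_continuous : continuous tau.
Proof.
suff: continuous (\val \o tau : space -> full_shift A).
  exact: (@continuous_comp_initial _ _ _ (\val : points X -> full_shift A)).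
move=> x; apply: (@continuous_comp _ _ _ _ (@unshift A)).
  exact: (@initial_continuous _ (full_shift A) (\val : points X -> full_shift A)).
exact: unshift_continuous.
Qed.

Lemma full_shift_compact : compact [set: full_shift A].
Proof.
have -> : [set: full_shift A] = [set f : full_shift A | forall i, setT (f i)].
  by rewrite eqEsubset; split.
apply: (@tychonoff _ (fun _ : int => discrete_topology A) (fun=> setT)) => _.
exact/finite_compact/(@finite_finset A setT).
Qed.

Lemma space_compact : compact [set: space].
Proof.
have cX : compact (points X).
  apply: (subclosed_compact (points_subshift X).1 full_shift_compact).
  exact: subsetT.
move=> F PF _; pose G := (\val : space -> full_shift A) @ F.
have GX : G (points X).
  by apply: (@filterS _ F _ setT) => [x _|]; [exact: set_valP|exact: filterT].
have [p [Xp clp]] := cX G _ GX.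
exists (SigSub (mem_set Xp)); split => // B C FB [W [[V oV <-] Vp] VC].
have GB : G (\val @` B) by apply: (@filterS _ F _ B) => // x Bx; exists x.
have [_ [[x Bx <-] Vx]] := clp _ _ GB (open_nbhs_nbhs (conj oV Vp)).
by exists x; split => //; apply: VC.
Qed.

Lemma continuous_discreteP (T : choiceType)
    (f : space -> discrete_topology T) :
  continuous f <-> forall x, \forall y \near x, f y = f x.
Proof.
split=> cf x.
  exact: (cf x _ (@discrete_set1 (discrete_topology T) (f x))).
move=> U /nbhs_singleton Ufx.
by move: (cf x); apply: filterS => y /= ->.
Qed.

Lemma CZ_bounded (f : space -> int) :
  continuous (f : space -> discrete_topology int) ->
  exists n : nat, forall x, `|f x| <= n%:Z.
Proof.
move=> /continuous_discreteP cf.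
have := space_compact; rewrite compact_cover.
move=> /(_ nat setT (fun n => [set x | `|f x| <= n%:Z])) [n _|x _|D _ sD].
- rewrite openE => x /= fx; near=> y; rewrite /=.
  by have -> : f y = f x by near: y; exact: cf.
- by exists `|f x|%N => //=; rewrite abszE.
exists (\max_(n <- finmap.enum_fset D) n)%N => x; have [n /= nD /le_trans] := sD x I; apply.
by rewrite lez_nat (big_rem n nD) leq_maxl.
Unshelve. all: by end_near. Qed.

Lemma space_minimal (Z : set space) :
  closed Z -> sigma @` Z = Z -> Z !=set0 -> Z = setT.
Proof.
move=> cZ sZ [z Zz]; pose Y : set (full_shift A) := \val @` Z.
have YX : Y `<=` points X by move=> _ [x _ <-]; exact: set_valP.
suff YE : Y = points X.
  rewrite eqEsubset; split=> // x _.
  have : Y (\val x) by rewrite YE; exact: set_valP.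
  by move=> [y Zy /val_inj <-].
apply: points_minimal => //; last by exists (\val z), z.
split.
  have : open (~` Z) by exact: closed_openC.
  move=> [V oV VE]; suff -> : Y = points X `&` ~` V.
    by apply: closedI; [exact: (points_subshift X).1|exact: open_closedC].
  rewrite eqEsubset; split=> [_ [x Zx <-]|x [Xx nVx]].
    split; first exact: set_valP.
    by move=> Vx; have : (\val @^-1` V) x by []; rewrite VE; apply.
  exists (SigSub (mem_set Xx)) => //; apply: contrapT => nZ.
  by apply: nVx; have : (~` Z) (SigSub (mem_set Xx)) by []; rewrite -VE.
rewrite eqEsubset; split=> [_ [_ [x Zx <-] <-]|_ [x Zx <-]].
  by exists (sigma x) => //; rewrite -sZ; exists x.
by move: Zx; rewrite -sZ => -[y Zy <-]; exists (\val y) => //; exists y.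
Qed.

Lemma iter_tau_continuous n : continuous (iter n tau).
Proof.
elim: n => [x|n IHn x]; first exact: cvg_id.
by apply: (@continuous_comp _ _ _ (iter n tau) tau); [exact: IHn|exact: tau_continuous].
Qed.

Lemma space_minimal_forward (Z : set space) :
  closed Z -> (forall x, Z x -> Z (sigma x)) -> Z !=set0 -> Z = setT.
Proof.
move=> cZ fZ [z Zz]; pose W : set space := [set y | forall n, Z (iter n tau y)].
suff WE : W = setT.
  by rewrite eqEsubset; split=> // x _; have : W x by [rewrite WE]; move=> /(_ 0%N).
apply: space_minimal.
- have -> : W = \bigcap_n (iter n tau @^-1` Z).
    by rewrite eqEsubset; split=> [x Wx n _|x Wx n]; exact: Wx.
  apply: closed_bigI => n _; apply: closed_comp => // x _.
  exact: iter_tau_continuous.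
- rewrite eqEsubset; split=> [_ [x Wx <-] [|n]|y Wy].
  + by apply: fZ; exact: (Wx 0%N).
  + by rewrite iterSr sigmaK.
  + by exists (tau y); [move=> n; rewrite -iterSr|exact: tauK].
- pose u n := iter n sigma z.
  have [p [_ clp]] : [set: space] `&` cluster (u @ \oo) !=set0.
    by apply: space_compact; exact: filterT.
  exists p => n; suff : closure (iter n tau @^-1` Z) p.
    suff cl : closed (iter n tau @^-1` Z) by move=> /cl.
    by apply: closed_comp => // x _; exact: iter_tau_continuous.
  move=> B nB; apply: clp => //; exists n => // m /= nm.
  have Zu k : Z (u k) by elim: k => //= k; exact: fZ.
  suff -> : iter n tau (u m) = u (m - n)%N by [].
  rewrite /u -{1}(subnKC nm) iterD; move: (iter (m - n) _ _) => w.
  by elim: n {nm} => // n IHn; rewrite iterSr /= sigmaK.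
Qed.

End Space.

(* [uog_pos] is the positive cone: [a <= b] means [uog_pos (b - a)].  The last
   two fields say that [uog_unit] is an order unit. *)
Record unital_ordered_group := UnitalOrderedGroup {
  uog_group :> zmodType;
  uog_pos : set uog_group;
  uog_unit : uog_group;
  uog_pos0 : uog_pos 0;
  uog_posD : forall a b, uog_pos a -> uog_pos b -> uog_pos (a + b);
  uog_pos_anti : forall a, uog_pos a -> uog_pos (- a) -> a = 0;
  uog_pos_gen : forall a, exists b c, [/\ uog_pos b, uog_pos c & a = b - c];
  uog_unit_pos : uog_pos uog_unit;
  uog_unit_bound : forall a, exists n : nat, uog_pos (uog_unit *+ n - a) }.

Definition uog_isomorphic (G H : unital_ordered_group) : Prop :=
  exists phi : {additive G -> H},
    [/\ bijective phi, phi @` (@uog_pos G) = @uog_pos H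
      & phi (uog_unit G) = uog_unit H].

Section DimensionGroup.
Context (A : finType) (X : minimal_subshift A).
Local Notation space := (space X).
Local Notation sigma := (@sigma A X).

(* [CZ] is the group C(X, Z); [coboundary] is {g - g \o sigma : g in C(X, Z)}. *)
Definition CZ_pred : {pred space -> int} :=
  fun f => `[< continuous (f : space -> discrete_topology int) >].

Lemma CZ_predP (f : space -> int) :
  f \in CZ_pred <-> forall x, \forall y \near x, f y = f x.
Proof.
split=> [/asboolP /continuous_discreteP //|cf].
exact/asboolP/continuous_discreteP.
Qed.

Lemma CZ_pred_zmod : zmod_closed CZ_pred.
Proof.
split=> [|f g /CZ_predP cf /CZ_predP cg]; apply/CZ_predP => x.
  by apply: filterE => y.
by move: (cf x) (cg x); apply: filterS2 => y /= fy gy; rewrite !fctE fy gy.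
Qed.

HB.instance Definition _ := GRing.isZmodClosed.Build _ CZ_pred CZ_pred_zmod.

Record CZ := MkCZ { CZ_fun :> space -> int; CZ_in : CZ_fun \in CZ_pred }.

HB.instance Definition _ := [isSub for CZ_fun].
HB.instance Definition _ := [Choice of CZ by <:].
HB.instance Definition _ := [SubChoice_isSubZmodule of CZ by <:].

Lemma CZP (f g : CZ) : (forall x, f x = g x) -> f = g.
Proof. by move=> fg; apply/val_inj/funext. Qed.

Lemma CZ0 x : (0 : CZ) x = 0. Proof. by []. Qed.
Lemma CZD (f g : CZ) x : (f + g) x = f x + g x. Proof. by []. Qed.
Lemma CZN (f : CZ) x : (- f) x = - f x. Proof. by []. Qed.
Lemma CZB (f g : CZ) x : (f - g) x = f x - g x. Proof. by []. Qed.
Lemma CZMn (f : CZ) n x : (f *+ n) x = f x *+ n.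
Proof. by elim: n => // n IHn; rewrite !mulrS CZD IHn. Qed.

Lemma CZ_cst_in (n : int) : (cst n : space -> int) \in CZ_pred.
Proof. by apply/CZ_predP => x; apply: filterE => y. Qed.

Definition CZ_cst (n : int) : CZ := MkCZ (CZ_cst_in n).

Lemma CZ_sigma_in (f : CZ) : (f : space -> int) \o sigma \in CZ_pred.
Proof.
by apply/CZ_predP => x; apply: (sigma_continuous ((CZ_predP f).1 (CZ_in f) _)).
Qed.

Definition CZ_sigma (f : CZ) : CZ := MkCZ (CZ_sigma_in f).

Definition coboundary : {pred CZ} :=
  fun f => `[< exists g : CZ, f = g - CZ_sigma g >].

Lemma coboundary_zmod : zmod_closed coboundary.
Proof.
split=> [|_ _ /asboolP[f ->] /asboolP[g ->]]; apply/asboolP.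
  by exists 0; apply: CZP => x.
exists (f - g); have -> : CZ_sigma (f - g) = CZ_sigma f - CZ_sigma g.
  exact: CZP.
by rewrite !opprD !opprK addrACA.
Qed.

HB.instance Definition _ := GRing.isZmodClosed.Build _ coboundary coboundary_zmod.

Definition K0 : zmodType := @Quotient.quot CZ coboundary.

Definition K0_class (f : CZ) : K0 := (\pi_(@Quotient.quot CZ coboundary) f)%qT.

Lemma K0_classB : {morph K0_class : f g / f - g}.
Proof. exact: raddfB. Qed.

Lemma K0_classN : {morph K0_class : f / - f}.
Proof. exact: raddfN. Qed.

Lemma K0_classD : {morph K0_class : f g / f + g}.
Proof. exact: raddfD. Qed.

Lemma K0_class_eq (f g : CZ) : K0_class f = K0_class g <-> f - g \in coboundary.
Proof.
by rewrite Quotient.idealrBE; split=> [/eqP|/eqP].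
Qed.

Lemma K0_classP (k : K0) : exists f, k = K0_class f.
Proof. by exists (repr k); rewrite /K0_class reprK. Qed.

Definition K0_pos : set K0 :=
  [set k | exists2 f : CZ, (forall x, 0 <= f x) & k = K0_class f].

Lemma CZ_min (f : CZ) : exists x0, forall x, f x0 <= f x.
Proof.
have [N fN] := CZ_bounded (asboolP _ (CZ_in f)).
have ge0 x : 0 <= f x + N%:Z.
  by rewrite -lerBlDr sub0r; move: (fN x); rewrite ler_norml => /andP[].
have exP : exists n : nat, `[< exists x, f x + N%:Z = n%:Z >].
  exists (absz (f point + N%:Z)); apply/asboolP; exists point.
  by rewrite gez0_abs.
case: (ex_minnP exP) => m /asboolP[x0 fx0] min; exists x0 => x.
rewrite -(lerD2r N%:Z) fx0 -[leRHS]gez0_abs// lez_nat; apply: min.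
by apply/asboolP; exists x; rewrite gez0_abs.
Qed.

Lemma coboundary_ge0 (f : CZ) :
  f \in coboundary -> (forall x, 0 <= f x) -> f = 0.
Proof.
move=> /asboolP[g fE] f0.
have gsigma x : g (sigma x) <= g x by move: (f0 x); rewrite fE subr_ge0.
have [x0 gmin] := CZ_min g.
have ZT : [set x | g x = g x0] = setT.
  apply: space_minimal_forward; last by exists x0.
    apply: (@closed_comp _ (discrete_topology int) g [set g x0]).
      by move=> x _; exact: (asboolP _ (CZ_in g)).
    exact: discrete_closed.
  by move=> x /= gx; apply/le_anti; rewrite gmin -gx gsigma.
have gc x : g x = g x0 by have : [set x | g x = g x0] x by rewrite ZT.
by apply: CZP => x; rewrite fE CZB /= !gc subrr.
Qed.

Lemma K0_pos0 : K0_pos 0.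
Proof. by exists 0; rewrite // /K0_class raddf0. Qed.

Lemma K0_posD a b : K0_pos a -> K0_pos b -> K0_pos (a + b).
Proof.
move=> [f f0 ->] [g g0 ->]; exists (f + g); last by rewrite K0_classD.
by move=> x; rewrite CZD addr_ge0.
Qed.

Lemma K0_pos_anti a : K0_pos a -> K0_pos (- a) -> a = 0.
Proof.
move=> [f f0 ->] [g g0 fg].
have fg0 : f + g = 0.
  apply: coboundary_ge0; last by move=> x; rewrite CZD addr_ge0.
  by rewrite -[g]opprK; apply/K0_class_eq; rewrite K0_classN -fg opprK.
suff -> : f = 0 by rewrite /K0_class raddf0.
apply: CZP => x; apply/le_anti; rewrite f0 andbT.
by have := g0 x; rewrite -(addr0_eq fg0) CZN oppr_ge0.
Qed.

Definition K0_unit : K0 := K0_class (CZ_cst 1).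

Lemma K0_unit_pos : K0_pos K0_unit.
Proof. by exists (CZ_cst 1). Qed.

Lemma K0_unit_bound a : exists n : nat, K0_pos (K0_unit *+ n - a).
Proof.
have [f ->] := K0_classP a.
have [n fn] := CZ_bounded (asboolP _ (CZ_in f)); exists n.
exists (CZ_cst 1 *+ n - f); last by rewrite K0_classB /K0_class raddfMn.
move=> x; rewrite CZB CZMn subr_ge0 /= (le_trans (ler_norm _))//.
by rewrite (le_trans (fn x))// natz.
Qed.

Lemma pos_gen_of_bound (G : zmodType) (P : set G) (u : G) :
    P 0 -> (forall a b, P a -> P b -> P (a + b)) -> P u ->
    (forall a, exists n : nat, P (u *+ n - a)) ->
  forall a, exists b c, [/\ P b, P c & a = b - c].
Proof.
move=> P0 PD Pu Pb a; have [n Pn] := Pb a.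
exists (u *+ n), (u *+ n - a); split=> //; last by rewrite opprB addrC subrK.
by elim: n {Pn} => // n IHn; rewrite mulrS; exact: PD.
Qed.

Definition dimension_group : unital_ordered_group :=
  UnitalOrderedGroup K0_pos0 K0_posD K0_pos_anti
    (pos_gen_of_bound K0_pos0 K0_posD K0_unit_pos K0_unit_bound)
    K0_unit_pos K0_unit_bound.

End DimensionGroup.

Section ReducedDimensionGroup.
Context (R : realType) (A : finType) (X : minimal_subshift A).
Local Notation space := (space X).
Local Notation sigma := (@sigma A X).
Local Notation CZ := (CZ X).
Local Notation K0 := (K0 X).

Definition borel : Type := g_sigma_algebraType (@open space).

HB.instance Definition _ := Measurable.on borel.

Definition invariant (mu : probability borel R) : Prop :=
  forall B : set borel, measurable B -> mu (sigma @^-1` B) = mu B.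

Definition integralCZ (mu : probability borel R) (f : CZ) : \bar R :=
  (\int[mu]_x ((f x)%:~R)%:E)%E.

Lemma borel_measurable_preimage (f : CZ) (U : set int) :
  measurable ((f : borel -> int) @^-1` U).
Proof.
apply: sub_sigma_algebra; apply: (@open_comp _ (discrete_topology int) f U).
  by move=> x _; exact: (asboolP _ (CZ_in f)).
exact: discrete_open.
Qed.

Lemma CZ_measurable (f : CZ) :
  measurable_fun setT (fun x : borel => (f x)%:~R : R).
Proof.
move=> _ B _; rewrite setTI.
exact: (borel_measurable_preimage f [set n | B n%:~R]).
Qed.

Lemma CZ_integrable (mu : probability borel R) (f : CZ) :
  mu.-integrable setT (EFin \o (fun x : borel => (f x)%:~R : R)).
Proof.
have [N fN] := CZ_bounded (asboolP _ (CZ_in f)).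
apply: measurable_bounded_integrable => //.
- by have := ltry (1 : R); rewrite -(@probability_setT _ _ _ mu); exact.
- exact: CZ_measurable.
- exists N%:R; split=> [|M NM x _]; first exact: num_real.
  by rewrite /= -intr_norm (le_trans _ (ltW NM))// pmulrn ler_int fN.
Qed.

Lemma integralCZB mu f g : integralCZ mu (f - g) =
  (integralCZ mu f - integralCZ mu g)%E.
Proof.
rewrite /integralCZ -integralB_EFin//; [|exact: CZ_integrable..].
by apply: eq_integral => x _; rewrite -EFinB -intrB.
Qed.

Lemma integralCZ_sigma mu f : invariant mu ->
  integralCZ mu (CZ_sigma f) = integralCZ mu f.
Proof.
move=> imu; have msigma : measurable_fun setT (sigma : borel -> borel).
  apply: (@measurability _ _ borel borel setT sigma (@open space)) => //.
  move=> _ [U oU <-]; rewrite setTI; apply: sub_sigma_algebra.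
  by apply: open_comp => // x _; exact: sigma_continuous.
have fs : mu.-integrable ((sigma : borel -> borel) @^-1` setT)
    ((EFin \o (fun x : borel => (f x)%:~R : R)) \o sigma).
  by rewrite preimage_setT; exact: (CZ_integrable mu (CZ_sigma f)).
have /measurable_EFinP mf := CZ_measurable f.
have E := integral_pushforward msigma mf fs measurableT.
rewrite preimage_setT in E; apply: (etrans (esym E)).
by apply: eq_measure_integral => B mB _; exact: imu.
Qed.

Lemma integralCZ_ge0 mu (f : CZ) : (forall x, 0 <= f x) -> (0 <= integralCZ mu f)%E.
Proof. by move=> f0; apply: integral_ge0 => x _; rewrite lee_fin ler0z. Qed.

Lemma integralCZ_fin_num mu f : integralCZ mu f \is a fin_num.
Proof. by apply: integrable_fin_num => //; exact: CZ_integrable. Qed.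

(* The class of [f] determines its integrals: see [infinitesimalP] below. *)
Definition infinitesimal : {pred K0} := fun k =>
  `[< exists2 f : CZ, k = K0_class f &
        forall mu, invariant mu -> integralCZ mu f = 0%E >].

Lemma infinitesimal_zmod : zmod_closed infinitesimal.
Proof.
split=> [|_ _ /asboolP[f -> f0] /asboolP[g -> g0]]; apply/asboolP.
  exists 0; first by rewrite /K0_class raddf0.
  by move=> mu _; rewrite /integralCZ integral0_eq.
exists (f - g) => [|mu imu]; first by rewrite K0_classB.
by rewrite integralCZB f0// g0// sube0.
Qed.

HB.instance Definition _ :=
  GRing.isZmodClosed.Build _ infinitesimal infinitesimal_zmod.

Lemma infinitesimalP (f : CZ) : K0_class f \in infinitesimal <->
  forall mu, invariant mu -> integralCZ mu f = 0%E.
Proof.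
split=> [/asboolP[g /K0_class_eq /asboolP[h fgh] g0] mu imu|f0]; last first.
  by apply/asboolP; exists f.
have -> : f = h - CZ_sigma h + g by rewrite -fgh subrK.
rewrite -[g]opprK !integralCZB -[- g]sub0r integralCZB integralCZ_sigma//.
rewrite g0// subee ?integralCZ_fin_num// add0e.
by rewrite /integralCZ integral0_eq ?sube0 ?oppe0.
Qed.

Definition rK0 : zmodType := @Quotient.quot K0 infinitesimal.

Definition rK0_class (k : K0) : rK0 :=
  (\pi_(@Quotient.quot K0 infinitesimal) k)%qT.

Definition rK0_pos : set rK0 :=
  [set l | exists2 k : K0, K0_pos k & l = rK0_class k].

Definition rK0_unit : rK0 := rK0_class (K0_unit X).

Lemma rK0_class_eq0 (k : K0) : rK0_class k = 0 <-> k \in infinitesimal.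
Proof.
have -> : 0 = rK0_class 0 by rewrite /rK0_class raddf0.
by rewrite -{2}[k]subr0 Quotient.idealrBE; split=> /eqP.
Qed.

Lemma rK0_pos0 : rK0_pos 0.
Proof. by exists 0; [exact: K0_pos0|rewrite /rK0_class raddf0]. Qed.

Lemma rK0_posD a b : rK0_pos a -> rK0_pos b -> rK0_pos (a + b).
Proof.
move=> [k k0 ->] [l l0 ->]; exists (k + l); first exact: K0_posD.
by rewrite /rK0_class raddfD.
Qed.

Lemma rK0_pos_anti a : rK0_pos a -> rK0_pos (- a) -> a = 0.
Proof.
move=> [_ [f f0 ->] ->] [_ [g g0 ->] fg].
have : rK0_class (K0_class (f + g)) = 0.
  by rewrite K0_classD /rK0_class raddfD /= -/(rK0_class _) -/(rK0_class _) -fg subrr.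
move=> /rK0_class_eq0/infinitesimalP fg0.
apply/rK0_class_eq0/infinitesimalP => mu imu; apply/le_anti.
rewrite integralCZ_ge0// andbT -(fg0 _ imu).
apply: ge0_le_integral => //.
- by move=> x _; rewrite lee_fin ler0z.
- by apply/measurable_EFinP; exact: CZ_measurable.
- by apply/measurable_EFinP; exact: CZ_measurable.
- by move=> x _; rewrite lee_fin ler_int CZD lerDl.
Qed.

Lemma rK0_unit_pos : rK0_pos rK0_unit.
Proof. by exists (K0_unit X) => //; exact: K0_unit_pos. Qed.

Lemma rK0_unit_bound a : exists n : nat, rK0_pos (rK0_unit *+ n - a).
Proof.
have [n nk] := K0_unit_bound (repr a); exists n; exists (K0_unit X *+ n - repr a) => //.
by rewrite /rK0_class raddfB raddfMn /= reprK.
Qed.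

Definition reduced_dimension_group : unital_ordered_group :=
  UnitalOrderedGroup rK0_pos0 rK0_posD rK0_pos_anti
    (pos_gen_of_bound rK0_pos0 rK0_posD rK0_unit_pos rK0_unit_bound)
    rK0_unit_pos rK0_unit_bound.

End ReducedDimensionGroup.

Section Eigenvalues.
Context (R : realType) (A : finType) (X : minimal_subshift A).
Local Notation space := (space X).
Local Notation sigma := (@sigma A X).

(* e^(i t) *)
Definition expi (t : R) : R[i] := (cos t +i* sin t)%C.

Lemma expi0 : expi 0 = 1.
Proof. by rewrite /expi cos0 sin0. Qed.

Lemma expiD s t : expi (s + t) = expi s * expi t.
Proof.
by rewrite /expi cosD sinD; apply/eqP; rewrite eq_complex /= eqxx/= addrC eqxx.
Qed.

Lemma expi_neq0 t : expi t != 0.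
Proof.
apply/eqP => t0; have := oner_neq0 R[i].
by rewrite -expi0 -(subrr t) expiD t0 mul0r eqxx.
Qed.

Lemma expi2pi : expi (2 * pi) = 1.
Proof. by rewrite /expi mulr_natl cos2pi sin2pi. Qed.

(* [R[i]^o] is the complex field with the topology given by its modulus. *)
Definition eigenvalue : {pred R} := fun gamma =>
  `[< exists f : space -> R[i]^o,
      [/\ continuous f, f <> cst 0
        & forall x, f (sigma x) = expi (2 * pi * gamma) * f x] >].

Lemma eigenfunction_neq0 (f : space -> R[i]^o) gamma :
  continuous f -> f <> cst 0 ->
  (forall x, f (sigma x) = expi (2 * pi * gamma) * f x) ->
  forall x, f x != 0.
Proof.
move=> cf f0 fs x; apply/eqP => fx; apply: f0.
have ZT : [set x | f x = 0] = setT.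
  apply: space_minimal_forward; last by exists x.
    apply: (@closed_comp _ _ f [set 0]) => [y _|]; first exact: cf.
    apply: accessible_closed_set1; apply: hausdorff_accessible.
    exact: (@norm_hausdorff _ R[i]^o).
  by move=> y /= fy; rewrite fs fy mulr0.
by apply/funext => y; have : [set x | f x = 0] y by rewrite ZT.
Qed.

Lemma eigenvalue_zmod : zmod_closed eigenvalue.
Proof.
split=> [|a b /asboolP[f [cf f0 fs]] /asboolP[g [cg g0 gs]]]; apply/asboolP.
  exists (cst 1); split.
  - exact: cst_continuous.
  - move=> /(congr1 (fun h => h point)) /= /eqP; exact/negP/oner_neq0.
  - by move=> x; rewrite mulr0 expi0 mul1r.
have gn0 := eigenfunction_neq0 cg g0 gs.
have fn0 := eigenfunction_neq0 cf f0 fs.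
exists (fun x => f x / g x); split.
- by move=> x; apply: (cvgM (cf x)); apply: cvgV; [exact: gn0|exact: cg].
- move=> /(congr1 (fun h => h point)) /= /eqP.
  by rewrite mulf_eq0 invr_eq0 (negPf (fn0 _)) (negPf (gn0 _)).
- move=> x; rewrite fs gs mulrBr expiD invfM mulrACA; congr (_ * _ * _).
  apply: (mulIf (expi_neq0 (2 * pi * b))).
  by rewrite mulVf ?expi_neq0// -expiD addNr expi0.
Qed.

HB.instance Definition _ := GRing.isZmodClosed.Build _ eigenvalue eigenvalue_zmod.

Record EX := MkEX { EX_val :> R; EX_in : EX_val \in eigenvalue }.

HB.instance Definition _ := [isSub for EX_val].
HB.instance Definition _ := [Choice of EX by <:].
HB.instance Definition _ := [SubChoice_isSubZmodule of EX by <:].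

Definition EX_pos : set EX := [set a | 0 <= (a : R)].

Lemma EX_unit_in : 1 \in eigenvalue.
Proof.
apply/asboolP; exists (cst 1); split.
- exact: cst_continuous.
- move=> /(congr1 (fun h => h point)) /= /eqP; exact/negP/oner_neq0.
- by move=> x; rewrite mulr1 expi2pi mul1r.
Qed.

Definition EX_unit : EX := MkEX EX_unit_in.

Lemma EX_pos0 : EX_pos 0. Proof. exact: lexx. Qed.

Lemma EX_posD a b : EX_pos a -> EX_pos b -> EX_pos (a + b).
Proof. exact: addr_ge0. Qed.

Lemma EX_pos_anti a : EX_pos a -> EX_pos (- a) -> a = 0.
Proof.
move=> a0 na0; apply/val_inj/le_anti.
by move: na0; rewrite /EX_pos /= oppr_ge0 => ->.
Qed.

Lemma EX_unit_pos : EX_pos EX_unit. Proof. exact: ler01. Qed.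

Lemma EX_unit_bound a : exists n : nat, EX_pos (EX_unit *+ n - a).
Proof.
exists (Num.bound `|EX_val a|); rewrite /EX_pos /= subr_ge0.
have -> : EX_val (EX_unit *+ Num.bound `|EX_val a|) = (Num.bound `|EX_val a|)%:R.
  exact: (raddfMn (\val : EX -> R)).
by rewrite (le_trans (ler_norm _))// ltW// archi_boundP.
Qed.

Definition eigenvalue_group : unital_ordered_group :=
  UnitalOrderedGroup EX_pos0 EX_posD EX_pos_anti
    (pos_gen_of_bound EX_pos0 EX_posD EX_unit_pos EX_unit_bound)
    EX_unit_pos EX_unit_bound.

End Eigenvalues.

(* Main.v *)
Require Import Defs.
From HB Require Import structures.
From mathcomp Require Import all_boot all_order all_algebra.
From mathcomp Require Import generic_quotient ring_quotient complex.
From mathcomp Require Import all_classical all_reals all_analysis.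
From mathcomp Require Import zify ring lra.

Set Implicit Arguments.
Unset Strict Implicit.
Unset Printing Implicit Defensive.

Import Order.TTheory GRing.Theory Num.Theory.
Import numFieldNormedType.Exports.

(** Every continuous integer-valued function on X turns out to have Birkhoff
    sums that stay within a bounded distance of n times a number, its mean.
    By Gottschalk-Hedlund the function is then its mean plus a real continuous
    coboundary: exponentiating the transfer function exhibits the mean as an
    eigenvalue, rounding it shows that mean 0 forces an integral coboundary and
    that positive mean gives a nonnegative representative.  Conversely a branch
    of the argument of an eigenfunction produces an integer-valued function
    whose mean is the eigenvalue.  Hence the mean is an isomorphism from the
    dimension group onto the eigenvalue group, and since the means of
    indicators of clopen sets extend to an invariant probability measure there
    are no infinitesimals.

    Boundedness comes from coding X by two return words u, v to a
    right-special word w.  If the excess p(j) - j (at least E for large j) is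
    below j / 2, then of the two letters u, v of the coding one occurs only in
    runs of a single length n, and (u, v) may be replaced by (v, u^n v); when
    n > 1 the excess grows by (n - 1)|u|, and the complexity bound forces
    |v| >= 3 E + (n - 2 + n delta)|u|.  The determinant
    D = |f(u) |v| - f(v) |u|| is multiplied by n, but
    max (D / |u|, D / |v|, D / E), up to a constant weight, decreases
    geometrically at the steps with n > 1, so that the discrepancies of the
    successive words have a bounded sum. *)

(** * Words of a coded system *)

(** One letter of the coding must have runs of constant length: otherwise there are two long
    right-special words whose suffixes differ in the letter just before [w], and the complexity
    grows by 2 at each of more than [|w|] consecutive lengths beyond [|w|], which pushes its ratio
    to length above 3/2. Both letters cannot have constant runs, since the coding would then be
    periodic.

    The obstacle is to add up discrepancies although D need not decrease. At steps with n = 1, D is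
    unchanged and the cost D / |v| is covered by the drop of [psi], a combination of D / |u| and D /
    |v|. Steps with n > 1 enlarge D and reset [psi]; their cost is covered by the drop of the
    weighted maximum [W]. A [budget] adds both reserves to the discrepancy, so that one bound M
    survives all steps.

    The mean is not built as a limit of slopes. For a time N one continues to words longer than N,
    takes the slope of that last pair and rereads all steps with it; M depends neither on N nor on
    the slope. With p(j) / j <= 3/2 - 1/K, delta is 2 / K. *)

Definition pow_word (A : Type) (u : seq A) (n : nat) : seq A := iter n (cat u) [::].

Section Powers.
Context (A : eqType).
Implicit Types (s t u v w : seq A) (m n : nat).

Lemma pow_wordS u n : pow_word u n.+1 = u ++ pow_word u n. Proof. by []. Qed.

Lemma pow_word1 u : pow_word u 1 = u. Proof. exact: cats0. Qed.

Lemma pow_wordD u m n : pow_word u (m + n) = pow_word u m ++ pow_word u n.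
Proof. by elim: m => // m IHm; rewrite addSn !pow_wordS IHm catA. Qed.

Lemma pow_wordSr u n : pow_word u n.+1 = pow_word u n ++ u.
Proof. by rewrite -addn1 pow_wordD pow_word1. Qed.

Lemma size_pow_word u n : size (pow_word u n) = n * size u.
Proof. by elim: n => // n IHn; rewrite pow_wordS size_cat IHn mulSn. Qed.

Lemma suffix_cancel s1 s2 t :
  suffix s1 t -> suffix s2 t -> size s1 = size s2 -> s1 = s2.
Proof.
move=> /suffixP[p1 ->] /suffixP[p2 e] ss; have := congr1 size e.
rewrite !size_cat ss => /addIn pp; move/eqP: e.
by rewrite eqseq_cat// => /andP[_ /eqP].
Qed.

End Powers.

(* A bijective dynamical system whose points are read through the letter at
   the origin; [ds_prev] is the inverse of [ds_next]. *)
Record coded_system (A : finType) := CodedSystem {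
  ds_point :> Type;
  ds_next : ds_point -> ds_point;
  ds_prev : ds_point -> ds_point;
  ds_letter : ds_point -> A;
  ds_nextK : cancel ds_next ds_prev;
  ds_prevK : cancel ds_prev ds_next }.

Section Words.
Context (A : finType) (X : coded_system A).
Local Notation S := (@ds_next A X).
Local Notation U := (@ds_prev A X).
Local Notation a0 := (@ds_letter A X).
Implicit Types (s t u v : seq A) (x : X) (m n j : nat).

Lemma iterSK n : cancel (iter n S) (iter n U).
Proof. by elim: n => // n IHn x; rewrite iterSr /= ds_nextK IHn. Qed.

Lemma iterUK n : cancel (iter n U) (iter n S).
Proof. by elim: n => // n IHn x; rewrite iterSr /= ds_prevK IHn. Qed.

Lemma iterUS_ge m n x : m <= n -> iter m U (iter n S x) = iter (n - m) S x.
Proof. by move=> mn; rewrite -{1}(subnKC mn) iterD iterSK. Qed.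

Lemma iterSU m n x : n <= m -> iter n S (iter m U x) = iter (m - n) U x.
Proof. by move=> nm; rewrite -{1}(subnKC nm) iterD iterUK. Qed.

Fixpoint past n x : seq A :=
  if n is n'.+1 then rcons (past n' (U x)) (a0 (U x)) else [::].

Lemma size_past n x : size (past n x) = n.
Proof. by elim: n x => // n IHn x; rewrite /= size_rcons IHn. Qed.

Lemma pastD m n x : past (m + n) x = past m (iter n U x) ++ past n x.
Proof.
elim: n x => [|n IHn] x; first by rewrite addn0 cats0.
by rewrite addnS [in LHS]/= IHn -iterSr rcons_cat.
Qed.

Definition ends s x := past (size s) x == s.

Lemma ends_past n x : ends (past n x) x.
Proof. by rewrite /ends size_past. Qed.

Lemma ends_cat s t x : ends (s ++ t) x = ends s (iter (size t) U x) && ends t x.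
Proof. by rewrite /ends size_cat pastD eqseq_cat ?size_past. Qed.

Lemma ends_catS s t x :
  ends s x -> ends t (iter (size t) S x) -> ends (s ++ t) (iter (size t) S x).
Proof. by move=> sx tx; rewrite ends_cat iterSK sx. Qed.

Lemma ends_suffix s t x : suffix s t -> ends t x -> ends s x.
Proof. by move=> /suffixP[p ->]; rewrite ends_cat => /andP[]. Qed.

Lemma ends_catr s t x : ends (s ++ t) x -> ends t x.
Proof. by rewrite ends_cat => /andP[]. Qed.

Lemma ends_catl s t x : ends (s ++ t) x -> ends s (iter (size t) U x).
Proof. by rewrite ends_cat => /andP[]. Qed.

Lemma ends_sub s t x : ends s x -> ends t x -> size s <= size t -> suffix s t.
Proof.
move=> /eqP sx /eqP tx /subnK st; apply/suffixP.
by exists (past (size t - size s) (iter (size s) U x)); rewrite -[LHS]tx -[in LHS]st pastD sx.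
Qed.

Lemma past_drop m n x : m <= n -> past m x = drop (n - m) (past n x).
Proof. by move=> /subnK {2}<-; rewrite pastD drop_size_cat ?size_past. Qed.

Lemma past_take m n x : m <= n -> past m (iter (n - m) U x) = take m (past n x).
Proof. by move=> /subnKC {2}<-; rewrite pastD take_size_cat ?size_past. Qed.

Definition language s : Prop := exists x, ends s x.

Lemma language_suffix s t : suffix s t -> language t -> language s.
Proof. by move=> st [x tx]; exists x; exact: ends_suffix tx. Qed.

Lemma language_catr s t : language (s ++ t) -> language t.
Proof. by move=> [x /ends_catr]; exists x. Qed.

Lemma language_catl s t : language (s ++ t) -> language s.
Proof. by move=> [x /ends_catl]; exists (iter (size t) U x). Qed.

Lemma language_extend s : language s -> exists c, language (rcons s c).
Proof.
move=> [x sx]; exists (a0 x), (S x).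
by rewrite -cats1 ends_cat /= ds_nextK sx /ends /= ds_nextK.
Qed.

Lemma language_past n x : language (past n x). Proof. by exists x; exact: ends_past. Qed.

Definition right_special s : Prop :=
  exists c d, [/\ c != d, language (rcons s c) & language (rcons s d)].

Lemma right_special_suffix s t : suffix s t -> right_special t -> right_special s.
Proof.
move=> /suffixP[p ->] [c [d [cd]]]; rewrite !rcons_cat => /language_catr ? /language_catr ?.
by exists c, d.
Qed.

Lemma right_special_inL s : right_special s -> language s.
Proof. by move=> [c [d [_ ]]]; rewrite -cats1 => /language_catl. Qed.

Lemma right_special_cat s u v c d u' v' : u = c :: u' -> v = d :: v' -> c != d ->
  language (s ++ u) -> language (s ++ v) -> right_special s.
Proof.
move=> -> -> cd; rewrite -!cat_rcons => /language_catl ? /language_catl ?.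
by exists c, d.
Qed.

Definition cplx j := #|[pred w : j.-tuple A | `[< language w >]]|.

Lemma card_word_seq j (Q : seq (seq A)) : uniq Q ->
  (forall y, y \in Q -> size y = j) -> #|[pred w : j.-tuple A | tval w \in Q]| = size Q.
Proof.
move=> uQ QL.
rewrite -(eq_card (A := mem (pmap (insub : _ -> option (j.-tuple A)) Q))); last first.
  by move=> w; rewrite mem_pmap_sub inE.
rewrite (card_uniqP _) ?pmap_sub_uniq// size_pmap_sub; apply/eqP.
by rewrite -all_count; apply/allP => y /QL/eqP.
Qed.

Lemma size_le_cplx j (Q : seq (seq A)) : uniq Q ->
  (forall y, y \in Q -> size y = j /\ language y) -> size Q <= cplx j.
Proof.
move=> uQ QL; rewrite -(@card_word_seq j) // => [|y /QL[]//].
apply/subset_leq_card/fintype.subsetP => w.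
by rewrite !inE => /QL[].
Qed.

(** Truncation to length [j] stays onto after [Q] is removed: a word whose chosen extension lies in
    [Q] is also the truncation of that extension's sibling. *)
Lemma cplx_ge_gen j (Q : seq (seq A)) : uniq Q ->
  (forall y, y \in Q -> size y = j.+1 /\ language y) ->
  (forall y, y \in Q ->
    exists y', [/\ y' \notin Q, size y' = j.+1, language y' & take j y' = take j y]) ->
  cplx j + size Q <= cplx j.+1.
Proof.
move=> uQ QL Qsib; rewrite /cplx.
pose L1 := [pred w : j.+1.-tuple A | `[< language w >]].
pose N := [pred w : j.+1.-tuple A | L1 w && (tval w \notin Q)].
have -> : #|L1| = (#|N| + #|[pred w : j.+1.-tuple A | tval w \in Q]|)%N.
  rewrite -(cardID [pred w : j.+1.-tuple A | tval w \in Q] L1) addnC.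
  congr (_ + _)%N; apply: eq_card => w; rewrite !inE.
    by rewrite andbC.
  by case: (boolP (tval w \in Q)) => [/QL[_ ?]|]; rewrite ?andbF// andbT; apply/asboolP.
have -> : #|[pred w : j.+1.-tuple A | tval w \in Q]| = size Q.
  by apply: card_word_seq => // y /QL[].
rewrite leq_add2r.
pose h (w : j.+1.-tuple A) : j.-tuple A := [tuple of belast (thead w) (behead w)].
have hE (w : j.+1.-tuple A) : tval (h w) = take j w.
  case/tupleP: w => c w; rewrite /h /= theadE.
  by rewrite [in RHS]lastI -cats1 take_size_cat// size_belast size_tuple.
apply: leq_trans (leq_image_card h N); apply/subset_leq_card.
apply/fintype.subsetP => w; rewrite inE => Lw.
have [c Lwc] := language_extend Lw.
have [y' [y'Q /eqP sy' Ly' ty']] : exists y, [/\ y \notin Q, size y = j.+1, language y & take j y = w].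
  have [/Qsib[y' [y'Q sy' Ly' ty']]|wcQ] := boolP (rcons w c \in Q).
    by exists y'; split=> //; rewrite ty' -cats1 take_size_cat// size_tuple.
  exists (rcons w c); split; rewrite ?size_rcons ?size_tuple//.
  by rewrite -cats1 take_size_cat ?size_tuple.
apply/fintype.imageP; exists (Tuple sy'); last first.
  by apply: val_inj; rewrite [RHS]hE ty'.
by rewrite inE /= y'Q andbT; apply/asboolP.
Qed.

Lemma cplx_ge j (Q : seq (seq A)) : uniq Q ->
  (forall y, y \in Q -> size y = j /\ right_special y) -> cplx j + size Q <= cplx j.+1.
Proof.
case: Q => [|y0 Q'] uQ Qrs; first exact: cplx_ge_gen.
set Q := y0 :: Q' in uQ Qrs *; have [_ [c0 _]] := Qrs _ (mem_head y0 Q').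
have /choice[f fP] y : exists cd : A * A,
    y \in Q -> [/\ cd.1 != cd.2, language (rcons y cd.1) & language (rcons y cd.2)].
  have [/Qrs[_ [c [d cd]]]|yQ] := boolP (y \in Q); first by exists (c, d).
  by exists (c0, c0).
rewrite -(size_map (fun y => rcons y (f y).1)); apply: cplx_ge_gen.
- by rewrite map_inj_uniq// => y z /rcons_inj[].
- by move=> _ /mapP[y yQ ->]; rewrite size_rcons (Qrs y yQ).1; have [] := fP y yQ.
- move=> _ /mapP[y yQ ->]; have [fd _ Lfd] := fP y yQ; exists (rcons y (f y).2).
  rewrite size_rcons (Qrs y yQ).1 -!cats1 !take_size_cat ?(Qrs y yQ).1//; split=> //.
    apply/mapP => -[z _]; rewrite !cats1 => /rcons_inj[<- /esym/eqP].
    by rewrite (negPf fd).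
  by rewrite cats1.
Qed.

Lemma cplxS j : cplx j <= cplx j.+1.
Proof. by rewrite -[X in X <= _]addn0; exact: (@cplx_ge_gen j [::]). Qed.

(** Without right-special words, dropping the last letter is injective on the language. *)
Lemma cplx_det j : (forall s, size s = j -> ~ right_special s) -> cplx j.+1 <= cplx j.
Proof.
move=> nrs; rewrite /cplx.
pose h (w : j.+1.-tuple A) : j.-tuple A := [tuple of belast (thead w) (behead w)].
have hE (w : j.+1.-tuple A) : tval w = rcons (h w) (last (thead w) (behead w)).
  by case/tupleP: w => c w; rewrite /h /= theadE -lastI.
have hI : {in [pred w : j.+1.-tuple A | `[< language w >]] &, injective h}.
  move=> w1 w2; rewrite !inE (hE w1) (hE w2) => L1 + hh; rewrite -hh => L2.
  apply: val_inj => /=; rewrite (hE w1) (hE w2) -hh; congr rcons; apply/eqP; apply: contraT => cd.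
  exfalso; apply: (nrs (h w1)); first by rewrite size_tuple.
  by exists (last (thead w1) (behead w1)), (last (thead w2) (behead w2)).
rewrite -(card_in_image hI); apply/subset_leq_card/fintype.subsetP => _ /fintype.imageP[w + ->].
by rewrite !inE (hE w) -cats1 => /language_catl.
Qed.

Context (cplx_unbounded : forall K, exists j, K < cplx j).

(** Suffixes of right-special words are right-special, so if length [j] has none, no greater length
    has any and the complexity stops growing at [j]. *)
Lemma right_special_exists j : exists s, size s = j /\ right_special s.
Proof.
apply: contrapT => nrs.
have H i : cplx (j + i).+1 <= cplx (j + i).
  apply: cplx_det => s ss rss; apply: nrs; exists (drop i s).
  rewrite size_drop ss addnK; split=> //; exact: right_special_suffix (suffix_drop _ _) rss.
have Hle i : cplx (j + i) <= cplx j.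
  elim: i => [|i]; first by rewrite addn0.
  by rewrite addnS; apply: leq_trans.
have Hle' i : cplx i <= cplx j.
  have [ij|/subnKC <-//] := ltnP i j.
  by elim: j ij {nrs H Hle} => // j IH; rewrite ltnS leq_eqVlt => /orP[/eqP->|/IH/leq_trans->]//; exact: cplxS.
by have [k] := cplx_unbounded (cplx j); rewrite ltnNge Hle'.
Qed.

Lemma cplx_lt j : cplx j < cplx j.+1.
Proof.
have [s [ss rss]] := right_special_exists j; rewrite -addn1 -[1]/(size [:: s]).
by apply: cplx_ge => // y; rewrite inE => /eqP->.
Qed.

Lemma cplx_gt j : j < cplx j.
Proof.
elim: j => [|j IHj]; last exact: leq_ltn_trans IHj (cplx_lt j).
have [j] := cplx_unbounded 0; move=> /card_gt0P[w]; rewrite inE => -[x _].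
by apply/card_gt0P; exists [tuple]; apply/asboolP; exists x.
Qed.

Context (recur : forall s, language s -> exists R, forall x, exists2 n, n <= R & ends s (iter n S x)).

Lemma recur_past s m : language s ->
  exists R, forall x, exists n, [/\ m <= n, n <= R & ends s (iter n U x)].
Proof.
move=> /recur[R HR]; exists (R + m) => x; have [n nR] := HR (iter (R + m) U x).
by rewrite iterSU ?(leq_trans nR) ?leq_addr// => e; exists (R + m - n); split=> //; lia.
Qed.

Lemma ends_pow_word_period u N x k i j : ends (pow_word u N) x -> k <= N ->
  i + j <= (N - k) * size u ->
  past j (iter (i + k * size u) U x) = past j (iter i U x).
Proof.
move=> + kN; rewrite -{1}(subnK kN) => e ij.
have e1 : past ((N - k) * size u) (iter (k * size u) U x) = pow_word u (N - k).
  by apply/eqP; move: e; rewrite pow_wordD => /ends_catl; rewrite /ends !size_pow_word.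
have e2 : past ((N - k) * size u) x = pow_word u (N - k).
  by apply/eqP; move: e; rewrite addnC pow_wordD => /ends_catr; rewrite /ends !size_pow_word.
have P y : past j (iter i U y) = drop (((N - k) * size u) - i - j) (past ((N - k) * size u - i) (iter i U y)).
  by rewrite -past_drop//; lia.
have Q y : past ((N - k) * size u - i) (iter i U y) = take ((N - k) * size u - i) (past ((N - k) * size u) y).
  rewrite -past_take; first by congr (past _ (iter _ U y)); lia.
  lia.
by rewrite iterD P Q e1 P Q e2.
Qed.

(** By recurrence each word of length [size u] occurs within [M] letters of the end of a high power
    of [u], where what is read depends only on the position modulo [size u]. This leaves at most
    [size u] words of that length, against [cplx_gt]. *)
Lemma aperiodic u : 0 < size u -> exists N, ~ language (pow_word u N).
Proof.
move=> u0; apply: contrapT => H.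
have {}H N : language (pow_word u N) by apply: contrapT => ?; apply: H; exists N.
set j := size u.
have /choice[R HR] (t : j.-tuple A) : exists R, language t ->
    forall x, exists2 n, n <= R & ends t (iter n U x).
  have [/(@recur_past _ 0)[R HR]|nt] := pselect (language t); last by exists 0.
  by exists R => _ x; have [n []] := HR x; exists n.
pose M := \max_t R t.
(* The two extra periods hold the residue of the position and the word read from there. *)
have [x ex] := H (M + 2); have := cplx_gt j; rewrite ltnNge => /negP; apply.
have sub : [pred w : j.-tuple A | `[< language w >]] \subset
    [seq Tuple (introT eqP (size_past j (iter (i : 'I_j) U x))) | i : 'I_j].
  apply/fintype.subsetP => t; rewrite inE => Lt; have [n nR tx] := HR t Lt x.
  have nM : n <= M by rewrite (leq_trans nR)// /M; exact: leq_bigmax.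
  have nj : n %% j < j by rewrite ltn_mod.
  apply/fintype.imageP; exists (Ordinal nj) => //; apply: val_inj => /=.
  move: tx; rewrite /ends size_tuple => /eqP <-.
  have kM : n %/ j <= M by rewrite (leq_trans (leq_div _ _)).
  rewrite {1}(divn_eq n j) addnC (ends_pow_word_period ex) //; first lia.
  rewrite -/j; apply: (@leq_trans (2 * j)); first lia.
  by rewrite leq_mul2r; lia.
apply: leq_trans (subset_leq_card sub) _.
by rewrite (leq_trans (leq_image_card _ _))// card_ord.
Qed.

End Words.

Arguments language {A} X s.
Arguments right_special {A} X s.
Arguments cplx {A} X j.

(** * Coding by two return words *)

Definition recurrent (A : finType) (X : coded_system A) := forall s, language X s ->
  exists R, forall x : X, exists2 n, n <= R & ends s (iter n (@ds_next A X) x).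

Section States.
Context (A : finType) (X : coded_system A).
Local Notation S := (@ds_next A X).
Local Notation U := (@ds_prev A X).
Local Notation language := (language X).
Local Notation right_special := (right_special X).
Local Notation cplx := (cplx X).
Implicit Types (s t u v w : seq A) (x y : X) (m n j : nat) (al be : A).

Hypothesis aper : forall u, 0 < size u -> exists N, ~ language (pow_word u N).

Definition follows s x := ends s (iter (size s) S x).

Lemma follows_cat s t x : follows (s ++ t) x = follows s x && follows t (iter (size s) S x).
Proof. by rewrite /follows size_cat addnC iterD ends_cat iterSK. Qed.

Lemma follows_cons c s x : follows (c :: s) x -> ds_letter x = c.
Proof.
rewrite -cat1s follows_cat => /andP[+ _].
by rewrite /follows /ends /= ds_nextK => /eqP[].
Qed.

Lemma ends_follows s t x : ends s x -> follows t x ->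
  ends (s ++ t) (iter (size t) S x).
Proof. exact: ends_catS. Qed.

Lemma ends_catP s t x : ends (s ++ t) x ->
  exists y, [/\ x = iter (size t) S y, ends s y & follows t y].
Proof.
rewrite ends_cat => /andP[sx tx]; exists (iter (size t) U x).
by rewrite /follows iterUK.
Qed.

(* [w] is followed, and preceded, by one of the return words [u] and [v]; [al]
   and [be] are the letters that precede the final [w] of [w u] and of [w v]. *)
Record state w u v al be : Prop := State {
  st_ab : al != be;
  st_hd : exists c d u' v', [/\ c != d, u = c :: u' & v = d :: v'];
  st_fwd : forall x, ends w x -> follows u x \/ follows v x;
  st_bwd : forall x, ends w x -> ends (w ++ u) x \/ ends (w ++ v) x;
  st_u : forall x, ends (w ++ u) x -> ends (al :: w) x;
  st_v : forall x, ends (w ++ v) x -> ends (be :: w) x;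
  st_L : language w }.

Lemma state_sym w u v al be : state w u v al be -> state w v u be al.
Proof.
case=> ab [c [d [u' [v' [cd uE vE]]]]] fwd bwd su sv L; split=> //.
- by rewrite eq_sym.
- by exists d, c, v', u'; rewrite eq_sym.
- by move=> x /fwd[]; [right|left].
- by move=> x /bwd[]; [right|left].
Qed.

Section Runs.
Context w u v al be (st : state w u v al be).

Lemma st_size_u : 0 < size u.
Proof. by have [c [d [u' [v' [_ -> _]]]]] := st_hd st. Qed.

Lemma abs_u x : ends (w ++ u) x -> ends w x.
Proof. by move=> /(st_u st); apply: (@ends_catr _ _ [:: al]). Qed.

Lemma abs_v x : ends (w ++ v) x -> ends w x.
Proof. by move=> /(st_v st); apply: (@ends_catr _ _ [:: be]). Qed.

Lemma abs_pw n x : ends (w ++ pow_word u n) x -> ends w x.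
Proof.
elim: n x => [|n IHn] x; first by rewrite cats0.
by rewrite pow_wordSr catA => /ends_catP[y [-> /IHn wy uy]]; exact: abs_u (ends_follows wy uy).
Qed.

Lemma abs_vpw n x : ends (w ++ v ++ pow_word u n) x -> ends (w ++ pow_word u n) x.
Proof. by rewrite catA => /ends_catP[y [-> /abs_v wy uy]]; exact: ends_follows. Qed.

Lemma fwd_run x : ends w x -> exists i, follows (pow_word u i ++ v) x.
Proof.
move=> wx; apply: contrapT => nrun; have [N] := aper st_size_u; apply.
suff : follows (pow_word u N) x by eexists; eassumption.
elim: N => [|N IHN]; first exact: ends_past 0 x.
rewrite pow_wordSr follows_cat IHN /=.
have /(st_fwd st)[//|vx] := abs_pw (ends_follows wx IHN).
by case: nrun; exists N; rewrite follows_cat IHN.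
Qed.

Lemma bwd_run x : ends w x -> exists i, ends (w ++ v ++ pow_word u i) x.
Proof.
move=> wx; apply: contrapT => nrun; have [N] := aper st_size_u; apply.
suff : ends (w ++ pow_word u N) x by move=> /ends_catr; eexists; eassumption.
elim: N => [|N /ends_catP[y [xE wy uy]]]; first by rewrite cats0.
have [wuy|wvy] := st_bwd st wy; last first.
  by case: nrun; exists N; rewrite catA xE; exact: ends_follows.
by have := ends_follows wuy uy; rewrite -catA -pow_wordS -xE.
Qed.

Lemma language_wv : language (w ++ v).
Proof.
have [x wx] := st_L st; have [k] := fwd_run wx.
rewrite follows_cat => /andP[ui vi]; have wz := abs_pw (ends_follows wx ui).
by eexists; exact: (ends_follows wz vi).
Qed.

(** The case [i = 0] is excluded so that consecutive copies of [v] remain permitted. *)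
Definition single n := forall i, 0 < i -> language (w ++ v ++ pow_word u i ++ v) -> i = n.

Lemma follows_uv x : follows u x -> follows v x -> False.
Proof.
have [c [d [u' [v' [cd -> ->]]]]] := st_hd st.
by move=> /follows_cons xc /follows_cons xd; rewrite -xc -xd eqxx in cd.
Qed.

Lemma single_run n x : single n -> 0 < n -> ends (w ++ v) x -> follows u x ->
  let y := iter (size (pow_word u n)) S x in
  [/\ follows (pow_word u n) x, ends (w ++ u) y & follows v y].
Proof.
move=> sn n0 wvx ux y; have wx := abs_v wvx.
have [k] := fwd_run wx; case: k => [/(follows_uv ux)//|i ri].
have {sn}iE : i.+1 = n.
  by apply: sn => //; eexists; rewrite catA; exact: (ends_follows wvx ri).
move: ri; rewrite iE follows_cat => /andP[un vy]; split=> //.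
have : ends (w ++ pow_word u n) y by exact: ends_follows.
rewrite -iE pow_wordSr catA => /ends_catP[z [-> /abs_pw wz uz]]; exact: ends_follows.
Qed.

(** The letters are exchanged: what precedes the final [w v] is what precedes [w] one coding word
    earlier, namely [be] if that word is [v] and [al] if it is [u]. *)
Lemma step_state n : 0 < n -> single n ->
  state (w ++ v) v (pow_word u n ++ v) be al.
Proof.
move=> n0 sn; split.
- by rewrite eq_sym (st_ab st).
- have [c [d [u' [v' [cd uE vE]]]]] := st_hd st.
  exists d, c, v', (u' ++ pow_word u n.-1 ++ v); rewrite eq_sym; split=> //.
  by rewrite -{1}(prednK n0) pow_wordS -catA {1}uE.
- move=> x wvx; have wx := abs_v wvx.
  have [[|i] ri] := fwd_run wx; first by left.
  by right; rewrite -(sn i.+1)//; eexists; rewrite catA; exact: (ends_follows wvx ri).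
- move=> x wvx; have [y [xE wy vy]] := ends_catP wvx.
  have [[|i]] := bwd_run wy; rewrite ?cats0 => ri.
    by left; rewrite xE; exact: ends_follows.
  right; rewrite -(sn i.+1)//.
    by rewrite -catA 2!catA -[(w ++ v) ++ _]catA xE; exact: ends_follows.
  by exists x; rewrite 2!catA -[(w ++ v) ++ _]catA xE; exact: ends_follows.
- move=> x /ends_catP[y [-> /(st_v st) by_ vy]].
  by rewrite -cat_cons; exact: ends_follows.
- move=> x; rewrite -(prednK n0) pow_wordSr -!catA 2!catA.
  move=> /ends_catP[y [-> + uvy]]; rewrite -catA => /abs_vpw/abs_pw wy.
  move: uvy; rewrite follows_cat => /andP[uy vy].
  rewrite size_cat addnC iterD -cat_cons; apply: ends_follows => //.
  by apply/(st_u st); exact: ends_follows.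
- exact: language_wv.
Qed.

Lemma max_run : exists n, [/\ 0 < n, language (w ++ pow_word u n) &
  forall m, language (w ++ pow_word u m) -> m <= n].
Proof.
have [N nN] := aper st_size_u.
have b m : language (w ++ pow_word u m) -> m <= N.
  move=> /language_catr Lm; rewrite leqNgt; apply/negP => /ltnW/subnK mN; apply: nN.
  by move: Lm; rewrite -mN pow_wordD => /language_catr.
pose P m := `[< language (w ++ pow_word u m) >].
have Pb m : P m -> m <= N by move=> /asboolP/b.
have P0 : exists m, P m by exists 0; apply/asboolP; rewrite cats0; exact: st_L st.
case: (ex_maxnP P0 Pb) => n /asboolP Ln nmax; exists n; split=> //; last first.
  by move=> m /asboolP/nmax.
case: n Ln nmax => // _ nmax; exfalso.
suff : P 1 by move=> /nmax.
apply/asboolP; rewrite pow_word1.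
have [x wx] := st_L st.
(* otherwise [v] repeats forever *)
apply: contrapT => nu; have v0 : 0 < size v.
  by have [c [d [u' [v' [_ _ ->]]]]] := st_hd st.
have [M] := aper v0; apply.
suff : follows (pow_word v M) x /\ ends w (iter (size (pow_word v M)) S x).
  by case=> vM _; eexists; exact: vM.
elim: M => [|M [vM wM]]; first by split=> //; exact: ends_past 0 x.
rewrite pow_wordSr follows_cat vM size_cat addnC iterD.
have [uM|vM'] := st_fwd st wM; first by case: nu; eexists; exact: (ends_follows wM uM).
by split=> //; exact: abs_v (ends_follows wM vM').
Qed.

Section MaxRun.
Context n (n0 : 0 < n) (Ln : language (w ++ pow_word u n))
  (nmax : forall m, language (w ++ pow_word u m) -> m <= n).

(** A longest run cannot be prolonged backwards, so the coding word before it is [v]. *)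
Lemma max_run_v : language (w ++ v ++ pow_word u n).
Proof.
have [x /ends_catP[y [_ wy uy]]] := Ln.
have [i iy] := bwd_run wy.
have := ends_follows iy uy; rewrite -!catA -pow_wordD => e.
have /nmax : language (w ++ pow_word u (i + n)) by eexists; exact: (abs_vpw e).
rewrite -[X in _ <= X]add0n leq_add2r leqn0 => /eqP i0.
by eexists; rewrite i0 add0n in e; exact: e.
Qed.

Lemma max_run_vv : language (w ++ v ++ pow_word u n ++ v).
Proof.
have [x e] := max_run_v.
have wx := abs_pw (abs_vpw e).
have [ux|vx] := st_fwd st wx.
  have := ends_follows (abs_vpw e) ux; rewrite -catA -pow_wordSr => e'.
  by have /nmax : language (w ++ pow_word u n.+1); [eexists; exact: e'|rewrite ltnn].
by have := ends_follows e vx; rewrite -!catA; eexists; eassumption.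
Qed.

(** One more [u] follows at the start of the longest run, and [v] follows at its end. *)
Lemma right_special_pw : right_special (w ++ pow_word u n.-1).
Proof.
have [c [d [u' [v' [cd uE vE]]]]] := st_hd st.
apply: (right_special_cat uE vE cd); rewrite -catA.
  by rewrite -pow_wordSr prednK.
have E : w ++ v ++ pow_word u n ++ v = (w ++ v ++ pow_word u 1) ++ (pow_word u n.-1 ++ v).
  by rewrite -{1}(prednK n0) pow_wordS pow_word1 -!catA.
have [x] := max_run_vv; rewrite E => /ends_catP[y [_ /abs_vpw/abs_pw wy fy]].
by eexists; exact: (ends_follows wy fy).
Qed.

(** A run of another length [i] is shorter than the longest one; after [v u^i] the coding continues
    with [v] there, and with [u] inside a longest run. *)
Lemma single_or_right_special : single n \/ exists k, [/\ 0 < k, k < n & right_special (w ++ v ++ pow_word u k)].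
Proof.
have [|ns] := pselect (single n); [by left|right].
have [i [i0 Li ni]] : exists i, [/\ 0 < i, language (w ++ v ++ pow_word u i ++ v) & i <> n].
  apply: contrapT => H; apply: ns => i i0 Li; apply: contrapT => ni.
  by apply: H; exists i.
have ltin : i < n.
  rewrite ltn_neqAle; apply/andP; split; first exact/eqP.
  have [x] := Li; rewrite 2!catA -[(w ++ v) ++ _]catA => /ends_catl/abs_vpw e.
  by apply: nmax; eexists; exact: e.
have [c [d [u' [v' [cd uE vE]]]]] := st_hd st.
exists i; split=> //; apply: (right_special_cat uE vE cd); rewrite -!catA//.
have := max_run_v; rewrite -(subnK ltin) addnC addSn -addnS pow_wordD pow_wordS !catA.
by move=> /language_catl; rewrite -!catA.
Qed.

End MaxRun.
End Runs.

(** Constant runs of both words would make the coding repeat [u^n v^m] forever. *)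
Lemma not_both_single w u v al be n m : state w u v al be ->
  single w u v n -> single w v u m -> 0 < n -> 0 < m -> False.
Proof.
move=> st sn sm n0 m0; have st' := state_sym st.
have p0 : 0 < size (pow_word u n ++ pow_word v m).
  by rewrite size_cat size_pow_word addn_gt0 muln_gt0 n0 (st_size_u st).
have [N] := aper p0; apply.
suff [x [_ _ e]] : exists x, [/\ ends (w ++ v) x, follows u x & follows (pow_word (pow_word u n ++ pow_word v m) N) x].
  by eexists; exact: e.
have [x [wvx ux]] : exists x, ends (w ++ v) x /\ follows u x.
  have [k [k0 Lk kmax]] := max_run st.
  have [y] := max_run_v st Lk kmax; rewrite -(prednK k0) pow_wordS 2!catA.
  by move=> /ends_catl/ends_catP[z [_ wvz uz]]; exists z.
exists x; split=> //.
elim: N x wvx ux => [|N IHN] x wvx ux; first exact: ends_past 0 x.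
have [un wuy vy] := single_run st sn n0 wvx ux.
have [vm wvz uz] := single_run st' sm m0 wuy vy.
by rewrite pow_wordS follows_cat follows_cat un vm /= size_cat addnC iterD; exact: IHN.
Qed.

End States.

(** * Counting right-special words *)

Section Steps.
Context (A : finType) (X : coded_system A).
Local Notation S := (@ds_next A X).
Local Notation U := (@ds_prev A X).
Local Notation language := (language X).
Local Notation right_special := (right_special X).
Local Notation cplx := (cplx X).
Local Notation state := (state X).
Local Notation single := (single X).
Implicit Types (s t u v w : seq A) (x y : X) (m n j : nat) (al be : A).

Hypothesis aper : forall u, 0 < size u -> exists N, ~ language (pow_word u N).
Hypothesis cplx_lt : forall j, cplx j < cplx j.+1.
Hypothesis cplx_gt : forall j, j < cplx j.
Context (K J0 : nat).
(* [cplx j / j <= 3 / 2 - 1 / K] *)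
Hypothesis cplx_le : forall j, J0 <= j -> 2 * K * cplx j + 2 * j <= 3 * K * j.

Definition suf j s := drop (size s - j) s.

Lemma size_suf j s : j <= size s -> size (suf j s) = j.
Proof. by move=> js; rewrite size_drop subKn. Qed.

Lemma right_special_suf j s : right_special s -> right_special (suf j s).
Proof. exact: right_special_suffix (suffix_drop _ _). Qed.

Lemma suffix_suf j s t : suffix s t -> size s <= j -> j <= size t ->
  suffix s (suf j t).
Proof.
rewrite !suffixE => /eqP st sj jt; rewrite size_suf// drop_drop.
by rewrite addnC addnBA// subnK// st.
Qed.

Lemma language_suffix_of s t :
  language t -> (forall x, ends t x -> ends s x) -> size s <= size t -> suffix s t.
Proof. by move=> [x tx] H; apply: (@ends_sub _ X _ _ x) => //; exact: H. Qed.

(* [E] bounds [cplx j - j] from below once [j >= c]; until then a right-special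
   word that does not end with [w] is waiting. *)
Record good w u v al be (E c : nat) : Prop := Good {
  g_st : state w u v al be;
  g_E : 0 < E;
  g_qE : size w + 1 + E <= size u + size v;
  g_c1 : c <= 2 * E + 2 * size u;
  g_c2 : c <= 2 * E + 2 * size v;
  g_c3 : c <= size w + (size u + size v);
  g_H : forall j, size w < j -> j + E <= cplx j + (c - j);
  g_pend : forall j, size w < j -> j < c ->
    exists t, [/\ size t = j, right_special t & ~~ suffix w t];
  g_big : J0 <= size w }.

Lemma good_sym w u v al be E c : good w u v al be E c -> good w v u be al E c.
Proof.
case=> st E0 qE c1 c2 c3 H pend big; split=> //; first exact: state_sym.
  by rewrite [size v + _]addnC.
by rewrite [size v + _]addnC.
Qed.

(** At each length from [size w + 1] to [size w + ell] the suffixes of [z1] and [z2] are distinct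
    right-special words, so the complexity grows by 2; since [ell] exceeds [size w], its ratio ends
    above 3/2. *)
Lemma two_right_special_contra w al be z1 z2 ell : al != be -> size w < ell -> J0 <= size w ->
  suffix (al :: w) z1 -> suffix (be :: w) z2 -> right_special z1 -> right_special z2 ->
  size w + ell <= size z1 -> size w + ell <= size z2 -> False.
Proof.
move=> ab wl J0w s1 s2 rs1 rs2 l1 l2.
have cplx2 i : i <= ell -> size w + 2 + 2 * i <= cplx (size w + 1 + i).
  elim: i => [|i IHi] il; first by have := cplx_gt (size w + 1 + 0); lia.
  have wz : [/\ (size w).+1 <= size w + 1 + i, size w + 1 + i <= size z1 & size w + 1 + i <= size z2] by split; lia.
  case: wz => w1 w2 w3.
  have := @cplx_ge _ X (size w + 1 + i) [:: suf (size w + 1 + i) z1; suf (size w + 1 + i) z2].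
  rewrite (addnS (size w + 1) i) => H; have := IHi (ltnW il); suff : cplx (size w + 1 + i) + 2 <= cplx (size w + 1 + i).+1 by lia.
  apply: H; last first.
    by move=> y; rewrite !inE => /orP[]/eqP ->; split; rewrite ?size_suf//; exact: right_special_suf.
  rewrite /= andbT inE; apply: contraNneq ab => ss; apply/eqP.
  have t1 := suffix_suf s1 w1 w2; have t2 := suffix_suf s2 w1 w3.
  by move: t1; rewrite ss => t1; have [] := suffix_cancel t1 t2 erefl.
have := cplx2 _ (leqnn _); have := @cplx_le (size w + 1 + ell); nia.
Qed.

Lemma suffix_wv_w w u v al be t : state w u v al be -> language t ->
  suffix (w ++ v) t -> suffix (be :: w) t.
Proof.
move=> st tL s; apply: language_suffix_of => // [x tx|].
  by apply: (st_v st); exact: ends_suffix tx.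
have v0 := st_size_u (state_sym st).
by have := size_suffix s; rewrite size_cat /=; lia.
Qed.

Lemma suffix_consE al w t : suffix (al :: w) t -> suffix w t.
Proof. by move/suffixP => [p ->]; apply/suffixP; exists (rcons p al); rewrite cat_rcons. Qed.

(** [E] and [c] are kept: the bound on the excess is now asked at fewer lengths, and a waiting word
    that does not end with [w] does not end with [w v] either, because [w v] ends with [w]. *)
Lemma step_sturm w u v al be E c : good w u v al be E c -> single w u v 1 ->
  good (w ++ v) v (pow_word u 1 ++ v) be al E c.
Proof.
move=> [st E0 qE c1 c2 c3 H pend big] s1.
have v0 := st_size_u (state_sym st).
split; rewrite ?pow_word1 ?size_cat//; try lia.
- by have := step_state aper st (ltn0Sn 0) s1; rewrite pow_word1.
- by move=> j jq; apply: H; lia.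
- move=> j jq jc; have [|//|t [tj rst nt]] := pend j; first lia.
  exists t; split=> //; apply: contra nt => /(suffix_wv_w st (right_special_inL rst)).
  exact: suffix_consE.
Qed.

(** Next to [z], the word [z0] adds one right-special word per length up to [q + m a], so it raises
    the excess by [m a]. If [c] were at least [c'], the excess [E + m a] at [c] would be too large
    for [c <= 2 E + 2 a]. So the complexity bound can be read at [c']; combined with
    [q + 1 + E <= a + b] it gives the last inequality. *)
Lemma step_strong w u v al be E c n z : good w u v al be E c ->
  single w u v n -> right_special (w ++ pow_word u n.-1) -> 1 < n ->
  suffix (be :: w) z -> right_special z -> size w + (size u + size v) <= size z ->
  (exists c', good (w ++ v) v (pow_word u n ++ v) be al (E + n.-1 * size u) c') /\
  3 * K * E + K * n * size u + 2 * n * size u <= K * size v + 2 * K * size u.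
Proof.
move=> [st E0 qE c1 c2 c3 H pend big] sn rs0 n1 sz rsz lz.
set a := size u in qE c1 c2 c3 lz *; set b := size v in qE c1 c2 c3 lz *.
set q := size w in qE H pend big c3 lz *.
have a0 : 0 < a := st_size_u st; have b0 : 0 < b := st_size_u (state_sym st).
have [m nE m0] : exists2 m, n = m.+1 & 0 < m by exists n.-1; lia.
rewrite nE /= in rs0 *; set z0 := w ++ pow_word u m in rs0.
have lz0 : size z0 = q + m * a by rewrite size_cat size_pow_word.
have s0 : suffix (al :: w) z0.
  apply: (language_suffix_of (right_special_inL rs0)); last by rewrite lz0 /= -/q; nia.
  rewrite /z0 -(prednK m0) pow_wordSr catA => x /ends_catP[y [-> /(abs_pw st) wy uy]].
  exact: (st_u st (ends_follows wy uy)).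
have ab := st_ab st.
(* Otherwise [z0] and [z] would both have the excluded length. This also keeps all lengths below
   [c'] within [z]. *)
have ma : m * a < a + b.
  rewrite ltnNge; apply/negP => le.
  by apply: (@two_right_special_contra w al be z0 z (a + b)); rewrite -/q// ?lz0; lia.
(* The lengths below [c'] are those at which [z0] has a suffix. *)
pose c' := q + 1 + m * a.
(* Up to three right-special words of length [j]: the suffixes of [z0] and [z] differ in the letter
   before [w], and the waiting word does not end with [w]. *)
have inc j : q < j -> cplx j + 1 + (j < c) + (j < c') <= cplx j.+1.
  move=> qj.
  have P0 : j < c' -> [/\ size (suf j z0) = j, right_special (suf j z0) & suffix (al :: w) (suf j z0)].
    move=> jc'; have jz : j <= size z0 by rewrite lz0; lia.
    by split; [rewrite size_suf|exact: right_special_suf|exact: suffix_suf].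
  have P1 : j < c \/ j < c' -> [/\ size (suf j z) = j, right_special (suf j z) & suffix (be :: w) (suf j z)].
    move=> jc'; have jz : j <= size z by lia.
    by split; [rewrite size_suf|exact: right_special_suf|exact: suffix_suf].
  have P01 t1 t2 : suffix (al :: w) t1 -> suffix (be :: w) t2 -> t1 != t2.
    move=> st1 st2; apply: contraNneq ab => tt.
    by move: st1; rewrite tt => st1; have [->] := suffix_cancel st1 st2 erefl.
  have Pw g t1 t2 : suffix (g :: w) t1 -> ~~ suffix w t2 -> t1 != t2.
    by move=> /suffix_consE ?; apply: contraNneq => <-.
  have cg := @cplx_ge _ X j.
  have [jc|jc] := ltnP j c; have [jc'|jc'] := ltnP j c'.
  - have [t [tj rst nt]] := pend j qj jc; have [p1 p2 p3] := P0 jc'.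
    have [q1 q2 q3] := P1 (or_introl jc).
    have := cg [:: suf j z0; suf j z; t]; rewrite -!addnA; apply.
      by rewrite /= !inE !negb_or (P01 _ _ p3 q3) (Pw _ _ _ p3 nt) (Pw _ _ _ q3 nt).
    by move=> y; rewrite !inE => /or3P[]/eqP->.
  - have [t [tj rst nt]] := pend j qj jc.
    have [q1 q2 q3] := P1 (or_introl jc).
    have := cg [:: suf j z; t]; rewrite -!addnA; apply.
      by rewrite /= !inE (Pw _ _ _ q3 nt).
    by move=> y; rewrite !inE => /orP[]/eqP->.
  - have [p1 p2 p3] := P0 jc'; have [q1 q2 q3] := P1 (or_intror jc').
    have := cg [:: suf j z0; suf j z]; rewrite -!addnA; apply.
      by rewrite /= !inE (P01 _ _ p3 q3).
    by move=> y; rewrite !inE => /orP[]/eqP->.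
  - by rewrite !addn0 addn1; exact: cplx_lt.
have G j : q < j -> j + (E + m * a) <= cplx j + (c - j) + (c' - j).
  elim: j => // j IHj; rewrite ltnS leq_eqVlt => /orP[/eqP qj|qj].
    by have := H j.+1; rewrite -qj /c'; lia.
  by have := IHj qj; have := inc j qj; case: (ltnP j c); case: (ltnP j c'); lia.
have aP : a <= m * a by rewrite leq_pmull.
have K0 : 0 < K.
  by have := @cplx_le (J0 + 1) (leq_addr _ _); case: (posnP K) => // ->; lia.
(* The complexity bound read as a bound on the excess: [k <= i / 2 - i / K]. *)
have cplxK i k : J0 <= i -> i + k <= cplx i -> 2 * K * k + 2 * i <= K * i.
  move=> /cplx_le h /(leq_mul (leqnn (2 * K))); rewrite mulnDr; move: h; lia.
have cc' : c < c'.
  rewrite ltnNge; apply/negP => c'c.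
  have qc : q < c by apply: leq_trans c'c; rewrite /c'; lia.
  have := @cplxK c (E + m * a) (leq_trans big (ltnW qc)).
  have := G c qc; rewrite subnn (eqP c'c) !addn0 => -> /(_ isT).
  have : K * c <= K * (2 * E + 2 * (m * a)) by rewrite leq_mul2l; lia.
  by lia.
have qc' : q < c' by rewrite /c'; lia.
have key : 2 * K * (E + m * a) + 2 * c' <= K * c'.
  apply: cplxK; first exact: leq_trans big (ltnW qc').
  by have := G c' qc'; lia.
have key2 : 2 * (E + m * a) <= c'.
  rewrite -(leq_pmul2l K0); lia.
have cb : c <= q + b + 1 by rewrite /c' in key2; lia.
have qK : K * (q + 1 + E) <= K * (a + b) by rewrite leq_mul2l; lia.
have qa : a <= q + 1 by rewrite /c' in key2; lia.
split; last by rewrite /c' in key; move: key qK; rewrite !mulnDr !mulnS; lia.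
exists c'; split; rewrite ?size_cat ?size_pow_word -/q -/a -/b; try (rewrite /c' ?mulSn; lia).
- by have := step_state aper st (ltnW n1) sn; rewrite nE.
- by move=> j jq; have := G j (leq_ltn_trans (leq_addr _ _) jq); lia.
(* The suffixes of [z0] are the words waiting for the next state: they have [al] before [w], whereas
   [w v] forces [be]. *)
- move=> j jq jc; have jz : j <= size z0 by rewrite lz0; rewrite /c' in jc; lia.
  exists (suf j z0); split; [by rewrite size_suf|exact: right_special_suf|].
  apply/negP => /(suffix_wv_w st (right_special_inL (right_special_suf _ rs0))) h1.
  have h0 : suffix (al :: w) (suf j z0) by apply: suffix_suf => //=; rewrite -/q; lia.
  by have [e] := suffix_cancel h0 h1 erefl; rewrite e eqxx in ab.
Qed.

(** This is [K] times [3 E + (n - 2 + n delta) a <= b] for [delta = 2 / K], with the subtraction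
    moved to the other side. *)
Definition strong_cond n E a b :=
  3 * K * E + K * n * a + 2 * n * a <= K * b + 2 * K * a.

(** If neither word had constant runs, [w v u^k] and [w u v^l] would be right-special with different
    letters before their final [w], and both too long. So exactly one has constant runs, and the
    right-special word produced by the other serves as [z]. *)
Lemma step_good w u v al be E c : good w u v al be E c ->
  (exists n c', [/\ 0 < n, good (w ++ v) v (pow_word u n ++ v) be al (E + n.-1 * size u) c'
     & n = 1 \/ 1 < n /\ strong_cond n E (size u) (size v)]) \/
  (exists n c', [/\ 0 < n, good (w ++ u) u (pow_word v n ++ u) al be (E + n.-1 * size v) c'
     & n = 1 \/ 1 < n /\ strong_cond n E (size v) (size u)]).
Proof.
move=> g; have g' := good_sym g; have st := g_st g; have st' := g_st g'.
have sz := g_qE g; have big := g_big g; have E0 := g_E g.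
have v0 := st_size_u st'; have u0 := st_size_u st.
have [n [n0 Ln nmax]] := max_run aper st; have [m [m0 Lm mmax]] := max_run aper st'.
have rsn := right_special_pw aper st n0 Ln nmax; have rsm := right_special_pw aper st' m0 Lm mmax.
have suf_rs u1 v1 al1 be1 k : state w u1 v1 al1 be1 -> 0 < k ->
    right_special (w ++ v1 ++ pow_word u1 k) ->
    suffix (al1 :: w) (w ++ v1 ++ pow_word u1 k) /\ size w + (size u1 + size v1) <= size (w ++ v1 ++ pow_word u1 k).
  move=> st1 k0 rs1; split; last first.
    by rewrite !size_cat size_pow_word leq_add2l [X in _ <= X]addnC leq_add2r leq_pmull.
  apply: (language_suffix_of (right_special_inL rs1)); last first.
    by have := st_size_u (state_sym st1); rewrite !size_cat /=; lia.
  move=> x /(abs_vpw st1); rewrite -(prednK k0) pow_wordSr catA.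
  move=> /ends_catP[y [-> /(abs_pw st1) wy uy]]; exact: (st_u st1 (ends_follows wy uy)).
have [sn|[k [k0 kn rsk]]] := single_or_right_special aper st Ln nmax;
  have [sm|[l [l0 lm rsl]]] := single_or_right_special aper st' Lm mmax.
- by case: (not_both_single aper st sn sm n0 m0).
- left; have [s2 l2] := suf_rs _ _ _ _ _ st' l0 rsl; rewrite [size v + _]addnC in l2.
  have [n1|n1] := leqP n 1.
    have {}n1 : n = 1 by lia.
    exists 1, c; rewrite mul0n addn0; split; [by []| |by left].
    by apply: step_sturm => //; rewrite -n1.
  have [[c' gc'] sc] := step_strong g sn rsn n1 s2 rsl l2.
  by exists n, c'; split=> //; right.
- right; have [s2 l2] := suf_rs _ _ _ _ _ st k0 rsk.
  have [m1|m1] := leqP m 1.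
    have {}m1 : m = 1 by lia.
    exists 1, c; rewrite mul0n addn0; split; [by []| |by left].
    by apply: step_sturm => //; rewrite -m1.
  rewrite [size u + _]addnC in l2.
  have [[c' gc'] sc] := step_strong g' sm rsm m1 s2 rsk l2.
  by exists m, c'; split=> //; right.
- have [s1 l1] := suf_rs _ _ _ _ _ st k0 rsk; have [s2 l2] := suf_rs _ _ _ _ _ st' l0 rsl.
  rewrite [size v + _]addnC in l2.
  by case: (two_right_special_contra (st_ab st) _ big s1 s2 rsk rsl l1 l2); lia.
Qed.

End Steps.

(** * The first pair of return words *)

Section Initial.
Context (A : finType) (X : coded_system A).
Local Notation S := (@ds_next A X).
Local Notation U := (@ds_prev A X).
Local Notation language := (language X).
Local Notation right_special := (right_special X).
Local Notation cplx := (cplx X).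
Local Notation state := (state X).
Implicit Types (s t u v w : seq A) (x y : X) (m n j : nat) (al be c d e : A).

Hypothesis aper : forall u, 0 < size u -> exists N, ~ language (pow_word u N).

Lemma language_wvu w u v al be : state w u v al be -> language (w ++ v ++ u).
Proof.
move=> st; have [n [n0 Ln nmax]] := max_run aper st.
have := max_run_v aper st Ln nmax; rewrite -(prednK n0) pow_wordS !catA.
exact: language_catl.
Qed.

(** Both [v u] and [u v] are read just before points that end with [w]. A longer [w] would make
    their last [size u + size v - 1] letters agree; being rearrangements of each other, they would
    then share their first letter too, against [st_hd]. *)
Lemma state_size w u v al be : state w u v al be ->
  size w + 2 <= size u + size v.
Proof.
move=> st; have st' := state_sym st; rewrite leqNgt; apply/negP => lt.
have [x xvu] := language_wvu st; have [y yuv] := language_wvu st'.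
have wx : ends w x.
  move: xvu; rewrite catA => /ends_catP[z [-> /(abs_v st) wz uz]].
  exact: (abs_u st (ends_follows wz uz)).
have wy : ends w y.
  move: yuv; rewrite catA => /ends_catP[z [-> /(abs_v st') wz uz]].
  exact: (abs_u st' (ends_follows wz uz)).
have [c [d [u' [v' [cd uE vE]]]]] := st_hd st.
pose m := (size u + size v).-1; have mw : m <= size w by rewrite /m; lia.
have xE : past m x = v' ++ u.
  have := ends_catr xvu; rewrite vE cat_cons -cat1s => /ends_catr/eqP <-.
  by congr past; rewrite /m size_cat vE /=; lia.
have yE : past m y = u' ++ v.
  have := ends_catr yuv; rewrite uE cat_cons -cat1s => /ends_catr/eqP <-.
  by congr past; rewrite /m size_cat uE /=; lia.
have E : v' ++ u = u' ++ v.
  by rewrite -xE -yE !(past_drop _ mw) (eqP wx) (eqP wy).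
have e1 : u ++ v = c :: u' ++ v by rewrite {1}uE.
have e2 : v ++ u = d :: v' ++ u by rewrite {1}vE.
have : perm_eq (u ++ v) (v ++ u) by rewrite perm_catC.
rewrite e1 e2 E =>  /permP/(_ (pred1 c)) /= /addIn; rewrite eqxx eq_sym.
by case: eqP cd.
Qed.

(* A state except that [w] may still extend uniquely to the left. *)
Record prestate w u v : Prop := Prestate {
  pre_hd : exists c d u' v', [/\ c != d, u = c :: u' & v = d :: v'];
  pre_fwd : forall x, ends w x -> follows u x \/ follows v x;
  pre_bwd : forall x, ends w x -> ends (w ++ u) x \/ ends (w ++ v) x;
  pre_u : forall x, ends (w ++ u) x -> ends w x;
  pre_v : forall x, ends (w ++ v) x -> ends w x;
  pre_Lu : language (w ++ u);
  pre_Lv : language (w ++ v) }.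

(** The letter before the final [w] still lies inside [w u], so the word determines it. *)
Lemma letter_before w u : language (w ++ u) -> 0 < size u ->
  (forall x, ends (w ++ u) x -> ends w x) ->
  exists al, forall x, ends (w ++ u) x -> ends (al :: w) x.
Proof.
move=> [x xwu] u0 H; exists (ds_letter (iter (size w).+1 U x)) => y ywu.
have sz : (size w).+1 <= size (w ++ u) by rewrite size_cat; lia.
have : past (size w).+1 y = past (size w).+1 x.
  by rewrite !(past_drop _ sz) (eqP xwu) (eqP ywu).
have <- : past (size w).+1 x = ds_letter (iter (size w).+1 U x) :: w.
  by rewrite -add1n pastD (eqP (H _ xwu)).
by move=> <-; exact: ends_past.
Qed.

(** While [al = be], every [w] is preceded by that letter, which can be absorbed into [w]. This
    stops: [w] is a suffix of [w u], so once it has length [N |u|] it would end with [u^N]. *)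
Lemma prestate_state k w u v N : prestate w u v -> ~ language (pow_word u N) ->
  N * size u <= size w + k ->
  exists w' al be, size w <= size w' /\ state w' u v al be.
Proof.
elim: k w => [|k IHk] w [hd fwd bwd pu pv Lu Lv] nN le.
  exfalso; apply: nN; suff : suffix (pow_word u N) w by move=> /language_suffix; apply; exact: language_catl Lu.
  move: le; rewrite addn0; elim: N => [|N IHN le]; first by rewrite suffix0s.
  have {}IHN := IHN (leq_trans (leq_mul (leqnSn N) (leqnn _)) le).
  have [x xwu] := Lu; apply: (@ends_sub _ X _ _ x); last by rewrite size_pow_word.
    have [y [-> wy uy]] := ends_catP xwu.
    by rewrite pow_wordSr; apply: ends_follows uy; exact: ends_suffix wy.
  exact: pu.
have [c [d [u' [v' [cd uE vE]]]]] := hd.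
have [al alP] : exists al, forall x, ends (w ++ u) x -> ends (al :: w) x.
  by apply: letter_before => //; rewrite uE.
have [be beP] : exists be, forall x, ends (w ++ v) x -> ends (be :: w) x.
  by apply: letter_before => //; rewrite vE.
have [ab|/negPf ab] := eqVneq al be; last first.
  exists w, al, be; split=> //; split=> //; first by rewrite ab.
  exact: language_catl Lu.
have W x : ends w x -> ends (al :: w) x by move=> /bwd[/alP//|/beP]; rewrite ab.
have W' s x : ends (w ++ s) x -> ends ((al :: w) ++ s) x.
  by move=> /ends_catP[y [-> /W wy sy]]; exact: ends_follows.
have W1 s x : ends ((al :: w) ++ s) x -> ends (w ++ s) x.
  by rewrite cat_cons -cat1s; exact: ends_catr.
have P : prestate (al :: w) u v.
  split=> // [x /(@ends_catr _ _ [:: al])|x /(@ends_catr _ _ [:: al])|x|x||].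
  - exact: fwd.
  - by move=> /bwd[/W'|/W']; [left|right].
  - by move=> /W1/pu/W.
  - by move=> /W1/pv/W.
  - by have [x /W'] := Lu; exists x.
  - by have [x /W'] := Lv; exists x.
have [|w' [al' [be' [sw st]]]] := IHk _ P nN; first by rewrite /= addSn -addnS.
by exists w', al', be'; split=> //; exact: ltnW sw.
Qed.

Hypothesis recX : recurrent X.

Section FirstReturn.
Context (r : seq A) (rP : right_special r)
  (one_more : cplx (size r).+1 <= cplx (size r) + 1).

Lemma right_special_uniq t : right_special t -> size t = size r -> t = r.
Proof.
move=> rst tr; apply/eqP; apply: contraT => nt; exfalso.
have := @cplx_ge _ X (size r) [:: t; r]; rewrite /= inE nt /= => H.
suff : cplx (size r) + 2 <= cplx (size r).+1 by move: one_more; lia.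
by apply: H => // y; rewrite !inE => /orP[]/eqP ->.
Qed.

Lemma two_ext c d e : c != d -> language (rcons r c) -> language (rcons r d) ->
  language (rcons r e) -> e = c \/ e = d.
Proof.
move=> cd Lc Ld Le; have [->|ec] := eqVneq e c; first by left.
have [->|ed] := eqVneq e d; first by right.
exfalso; have := @cplx_ge_gen _ X (size r) [:: rcons r c; rcons r d] => H.
suff : cplx (size r) + 2 <= cplx (size r).+1 by move: one_more; lia.
have inj f g : f != g -> rcons r f != rcons r g.
  by apply: contraNneq => /rcons_inj[->].
apply: H; first by rewrite /= inE inj.
  by move=> y; rewrite !inE => /orP[]/eqP ->; rewrite size_rcons.
move=> y yQ; exists (rcons r e); rewrite !inE negb_or !inj// size_rcons; split=> //.
by move: yQ; rewrite !inE => /orP[]/eqP ->; rewrite -!cats1 !take_size_cat.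
Qed.

Lemma ends_letter s x : ends s x -> ends (rcons s (ds_letter x)) (S x).
Proof. by move=> sx; rewrite -cats1 ends_cat /= ds_nextK sx /ends /= ds_nextK. Qed.

Lemma det_letter s x y : ends s x -> ends s y -> size s = size r -> s != r ->
  ds_letter x = ds_letter y.
Proof.
move=> sx sy sr; apply: contra_neq_eq => xy; apply: right_special_uniq => //.
exists (ds_letter x), (ds_letter y); split=> //; eexists; exact: ends_letter.
Qed.

Lemma pastSS n x : past n.+1 (S x) = rcons (past n x) (ds_letter x).
Proof. by rewrite /= ds_nextK. Qed.

(** Between two visits to [r] the words of length [size r] are not right-special, so the letter
    after [r] forces all letters up to the return. *)
Lemma first_return c : language (rcons r c) ->
  exists u', let u := c :: u' in forall y, ends r y -> ds_letter y = c ->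
   [/\ follows u y, ends r (iter (size u) S y) &
       forall i, 0 < i -> i < size u -> ~~ ends r (iter i S y)].
Proof.
move=> [z]; rewrite -cats1 => /ends_catP[x [_ rx cx]].
have {z}cx : ds_letter x = c := follows_cons cx.
have exP : exists n, (0 < n) && ends r (iter n S x).
  have [R HR] := recX (right_special_inL rP); have [n _ e] := HR (S x).
  by exists n.+1; rewrite iterSr.
case: (ex_minnP exP) => n /andP[n0 rn] nmin.
have nret i : 0 < i -> i < n -> ~~ ends r (iter i S x).
  move=> i0 iln; apply/negP => ri; have := nmin i.
  by rewrite i0 ri => /(_ isT); rewrite leqNgt iln.
have same y : ends r y -> ds_letter y = c -> forall i, i <= n ->
    past (size r + i) (iter i S y) = past (size r + i) (iter i S x).
  move=> ry cy; elim=> [_|i IHi iln].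
    by rewrite addn0 (eqP rx); exact/eqP.
  rewrite addnS ![iter _.+1 _ _]/= !pastSS (IHi (ltnW iln)); congr rcons.
  case: i IHi iln => [|i] IHi iln; first by rewrite /= cx.
  apply: (@det_letter (past (size r) (iter i.+1 S x))).
  - rewrite /ends size_past; apply/eqP.
    by rewrite !(past_drop _ (leq_addr i.+1 (size r))) IHi// ltnW.
  - exact: ends_past.
  - exact: size_past.
  - by apply: contraNneq (nret i.+1 isT iln) => e; rewrite /ends e.
have uE : past n (iter n S x) = c :: behead (past n (iter n S x)).
  have first : past 1 (iter (n - 1) U (iter n S x)) = [:: c].
    rewrite (_ : iter (n - 1) U _ = S x) /= ?ds_nextK ?cx//.
    by rewrite -{2}(prednK n0) iterSr subn1 iterSK.
  have := past_take (iter n S x) n0; rewrite first.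
  by case: (past n (iter n S x)) => [|? ? [<-]] //; rewrite take0.
exists (behead (past n (iter n S x))) => u; rewrite /u -uE size_past => y ry cy.
have rn_le : n <= size r + n by rewrite leq_addl.
have sub i y' : i <= n -> past (size r) (iter i S y) = past (size r) (iter i S x).
  by move=> /(same y ry cy) e; rewrite !(past_drop _ (leq_addr i (size r))) e.
split.
- rewrite /follows size_past /ends size_past.
  by rewrite !(past_drop _ rn_le) same.
- by rewrite /ends (sub n y)// ; exact: rn.
- by move=> i i0 iln; rewrite /ends (sub i y (ltnW iln)); exact: nret.
Qed.

Lemma prestate_r : exists u v, prestate r u v.
Proof.
have [c [d [cd Lc Ld]]] := rP.
have [u' uP] := first_return Lc; have [v' vP] := first_return Ld.
set u := c :: u' in uP; set v := d :: v' in vP.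
have cdP x : ends r x -> ds_letter x = c \/ ds_letter x = d.
  by move=> rx; apply: (two_ext cd) => //; eexists; exact: ends_letter rx.
have Lx e : language (rcons r e) -> exists2 x : X, ends r x & ds_letter x = e.
  by move=> [z]; rewrite -cats1 => /ends_catP[x [_ rx /follows_cons ex]]; exists x.
exists u, v; split.
- by exists c, d, u', v'.
- by move=> x rx; have [cx|dx] := cdP x rx; [left; have [] := uP x rx cx|right; have [] := vP x rx dx].
(* Start at an earlier visit to [r] and advance by complete returns; none of them can jump over [x],
   which is a visit itself. *)
- move=> x rx; have [R HR] := @recur_past _ X recX r 1 (right_special_inL rP).
  have [n [n1 _ rn]] := HR x.
  elim/ltn_ind: n n1 rn => n IHn n1 rn.
  have go e s : (forall y, ends r y -> ds_letter y = e -> [/\ follows (e :: s) y, ends r (iter (size (e :: s)) S y) &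
       forall i, 0 < i -> i < size (e :: s) -> ~~ ends r (iter i S y)]) ->
      ds_letter (iter n U x) = e -> ends (r ++ e :: s) x \/ ends (r ++ u) x \/ ends (r ++ v) x.
    move=> /(_ _ rn) H /H[f1 f2 f3].
    have [lt|gt|nE] := ltngtP (size (e :: s)) n.
    - right; apply: (IHn (n - size (e :: s))); rewrite ?subn_gt0//.
        by rewrite ltn_subrL /=; lia.
      by rewrite -iterSU// ltnW.
    - by have := f3 n n1 gt; rewrite iterUK rx.
    - by left; have := ends_follows rn f1; rewrite nE iterUK.
  have [ex|ex] := cdP _ rn.
    by have [?|//] := go _ _ uP ex; left.
  by have [?|//] := go _ _ vP ex; right.
- by move=> x /ends_catP[y [-> ry uy]]; have [] := uP y ry (follows_cons uy).
- by move=> x /ends_catP[y [-> ry vy]]; have [] := vP y ry (follows_cons vy).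
- have [x rx ex] := Lx c Lc; have [f _ _] := uP x rx ex.
  by eexists; exact: (ends_follows rx f).
- have [x rx ex] := Lx d Ld; have [f _ _] := vP x rx ex.
  by eexists; exact: (ends_follows rx f).
Qed.

End FirstReturn.

Hypothesis rsX : forall j, exists s, size s = j /\ right_special s.
Hypothesis cplx_gt : forall j, j < cplx j.

(** The excess bound 1 is [cplx_gt], valid at all lengths, so no word has to wait and [c = 0]. *)
Lemma good_exists J0 j : J0 <= j -> cplx j.+1 <= cplx j + 1 ->
  exists w u v al be, j <= size w /\ good X J0 w u v al be 1 0.
Proof.
move=> +; have [r [<- rsr]] := rsX j => Jj /(prestate_r rsr)[u [v pre]].
have [c [d [u' [v' [cd uE vE]]]]] := pre_hd pre.
have [N nN] : exists N, ~ language (pow_word u N) by apply: aper; rewrite uE.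
have [|w [al [be [rw st]]]] := @prestate_state (N * size u) r u v N pre nN.
  exact: leq_addl.
exists w, u, v, al, be; split=> //.
have sz := state_size st; split=> //.
- by lia.
- by move=> i _; rewrite sub0n addn0 addn1; exact: cplx_gt.
- exact: (leq_trans Jj rw).
Qed.

End Initial.

(** * Discrepancy *)

Local Open Scope ring_scope.

Section Birkhoff.
Context (A : finType) (X : coded_system A) (R : realFieldType).
Local Notation S := (@ds_next A X).
Local Notation language := (language X).
Implicit Types (s t u v w : seq A) (x y z : X) (m n i j : nat) (al be : A) (ga : R).

Context (f : X -> int).

Definition bsum n x : int := \sum_(i < n) f (iter i S x).

Lemma bsumD m n x : bsum (m + n) x = bsum m x + bsum n (iter m S x).
Proof.
rewrite /bsum big_split_ord /=; congr (_ + _); apply: eq_bigr => i _.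
by rewrite addnC iterD.
Qed.

Definition disc ga n x : R := (bsum n x)%:~R - n%:R * ga.

Lemma disc0 ga x : disc ga 0 x = 0.
Proof. by rewrite /disc /bsum big_ord0 mul0r subrr. Qed.

Lemma discD ga m n x : disc ga (m + n) x = disc ga m x + disc ga n (iter m S x).
Proof. by rewrite /disc bsumD intrD natrD; ring. Qed.

Context (M : nat) (f_local : forall x y, past M x = past M y -> f x = f y).

Lemma bsum_word w u : (M <= size w)%N ->
  exists fu, forall y, ends w y -> follows u y -> bsum (size u) y = fu.
Proof.
move=> Mw; have [[z wu]|nwu] := pselect (language (w ++ u)); last first.
  by exists 0 => y wy uy; case: nwu; eexists; exact: (ends_follows wy uy).
have [y0 [_ wy0 uy0]] := ends_catP wu.
exists (bsum (size u) y0) => y wy uy; apply: eq_bigr => i _; apply: f_local.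
have P x : ends w x -> follows u x ->
    past (size w + i) (iter i S x) = take (size w + i) (w ++ u).
  move=> wx ux; have := ends_follows wx ux; rewrite /ends size_cat => /eqP <-.
  rewrite -past_take ?leq_add2l 1?ltnW// subnDl iterUS_ge ?leq_subr//.
  by rewrite subKn// ltnW.
have le : (M <= size w + i)%N by rewrite (leq_trans Mw)// leq_addr.
by rewrite !(past_drop _ le) !P.
Qed.

Context (K J0 : nat).

Record config := Config {
  cw : seq A; cu : seq A; cv : seq A; cal : A; cbe : A;
  cE : nat; cc : nat; cfu : int; cfv : int;
  cgood : good X J0 cw cu cv cal cbe cE cc;
  csu : forall y, ends cw y -> follows cu y -> bsum (size cu) y = cfu;
  csv : forall y, ends cw y -> follows cv y -> bsum (size cv) y = cfv }.

Implicit Types C : config.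

Definition config_sym C : config := Config (good_sym (cgood C)) (@csv C) (@csu C).

Local Notation la C := ((size (cu C))%:R : R).
Local Notation lb C := ((size (cv C))%:R : R).

Definition du C ga : R := (cfu C)%:~R - la C * ga.
Definition dv C ga : R := (cfv C)%:~R - lb C * ga.

(** It means that [ga] lies between the averages of [f] over the two words. *)
Definition slope_ok C ga := du C ga * dv C ga <= 0.

Definition cD C : R := `|(cfu C)%:~R * lb C - (cfv C)%:~R * la C|.

Lemma la_gt0 C : 0 < la C.
Proof. by rewrite ltr0n; have := st_size_u (g_st (cgood C)). Qed.

Lemma lb_gt0 C : 0 < lb C.
Proof. exact: (la_gt0 (config_sym C)). Qed.

(** The determinant is [du * |v| - dv * |u|], and with [du] and [dv] of opposite signs its two terms
    do not cancel. *)
Lemma du_le C ga : slope_ok C ga -> `|du C ga| * lb C <= cD C.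
Proof.
move=> ok; have a0 := la_gt0 C; have b0 := lb_gt0 C.
have -> : cD C = `|du C ga * lb C - dv C ga * la C|.
  by rewrite /cD /du /dv; congr `|_|; ring.
rewrite -{1}(gtr0_norm b0) -normrM; move: ok; rewrite /slope_ok.
set p := du C ga; set q := dv C ga => ok.
rewrite -ler_sqr ?nnegrE// !real_normK ?num_real//.
have h : 0 <= - (p * q) * (la C * lb C) by rewrite mulr_ge0 ?oppr_ge0// mulr_ge0// ltW.
rewrite -subr_ge0 (_ : _ - _ = 2 * (- (p * q) * (la C * lb C)) + (q * la C) ^+ 2); last by ring.
by rewrite addr_ge0 ?sqr_ge0// mulr_ge0.
Qed.

Lemma disc_u C ga y : ends (cw C) y -> follows (cu C) y ->
  disc ga (size (cu C)) y = du C ga.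
Proof. by move=> wy uy; rewrite /disc (csu wy uy). Qed.

Lemma disc_pw C ga n y : ends (cw C) y -> follows (pow_word (cu C) n) y ->
  disc ga (size (pow_word (cu C) n)) y = n%:R * du C ga.
Proof.
elim: n y => [|n IHn] y wy; first by rewrite disc0 mul0r.
rewrite pow_wordS follows_cat => /andP[uy ny]; rewrite size_cat discD (disc_u _ wy uy).
rewrite IHn//; first by rewrite -natr1; ring.
exact: (abs_u (g_st (cgood C)) (ends_follows wy uy)).
Qed.

Lemma disc_prefix C ga n y j : ends (cw C) y -> follows (pow_word (cu C) n.+1) y ->
  (j <= size (pow_word (cu C) n.+1))%N -> exists i r z,
  [/\ (i <= n)%N, (r <= size (cu C))%N, ends (cw C) z, follows (cu C) z &
      disc ga j y = i%:R * du C ga + disc ga r z].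
Proof.
elim: n y j => [|n IHn] y j wy; rewrite pow_wordS follows_cat => /andP[uy ny].
  rewrite size_cat addn0 => ju; exists 0%N, j, y; split=> //.
  by rewrite mul0r add0r.
have [ju _|uj] := leqP j (size (cu C)).
  by exists 0%N, j, y; split=> //; rewrite mul0r add0r.
rewrite size_cat => jle.
have [||i [r [z [i_n ru wz uz E]]]] := IHn (iter (size (cu C)) S y) (j - size (cu C))%N _ ny.
- exact: (abs_u (g_st (cgood C)) (ends_follows wy uy)).
- by rewrite leq_subLR.
exists i.+1, r, z; split=> //.

by rewrite -(subnKC (ltnW uj)) discD (disc_u _ wy uy) E -natr1; ring.
Qed.

Context (de : R).
Hypothesis de01 : 0 < de <= 1.

(* [th > 1] makes the potential [W] drop by the factor [1 - de / 5] at each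
   step with [n > 1]. *)
Let th := 1 + de / 2.
Let ka := 25 / de.

(** The weights 3 and 1 let the drop of [psi] in a step from [(a, b)] to [(b, a + b)] cover the cost
    [D / b] of crossing [u]: the third inequality of [sturm_ineq] amounts to
    [(a + b)^2 >= 3 a b]. *)
Definition psi (D a b : R) := D * (3 / a + 1 / b).

(** [M] bounds the discrepancy inside a word together with all that later steps may add: [psi] is
    the reserve for steps with [n = 1], [ka * W] the one for steps with [n > 1]. *)
Definition budget C ga M := exists2 W : R,
  [/\ 0 <= W, th * cD C <= W * la C, th * cD C <= W * lb C & cD C <= W * (cE C)%:R] &
  forall y j, ends (cw C) y ->
   (follows (cu C) y -> (j <= size (cu C))%N ->
      `|disc ga j y| + psi (cD C) (la C) (lb C) + ka * W <= M) /\
   (follows (cv C) y -> (j <= size (cv C))%N ->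
      `|disc ga j y| + psi (cD C) (lb C) (la C) + ka * W <= M).

(** Slopes pass from the later pair back to the earlier one and budgets pass forward, so a slope
    chosen for the last pair can be used from the start. *)
Definition leads C C' := forall ga, slope_ok C' ga ->
  slope_ok C ga /\ forall M, budget C ga M -> budget C' ga M.

Lemma leads_trans C1 C2 C3 : leads C1 C2 -> leads C2 C3 -> leads C1 C3.
Proof.
move=> h12 h23 ga /h23[/h12[ok1 inv12] inv23].
by split=> // M' /inv12/inv23.
Qed.

Lemma leads_sym C : leads C (config_sym C).
Proof.
move=> ga; rewrite /slope_ok /= => ok; split; first by rewrite mulrC.
have DE : cD (config_sym C) = cD C by rewrite /cD distrC.
move=> M' [W [W0 Wa Wb We] H]; exists W; rewrite DE// => y j wy.
by have [H1 H2] := H y j wy; split.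
Qed.

Lemma sturm_ineq (D a b : R) : 0 <= D -> 0 < a -> 0 < b ->
  [/\ psi D b (a + b) <= psi D b a,
     psi D (a + b) b <= psi D a b &
     psi D (a + b) b + D / b <= psi D b a].
Proof.
move=> D0 a0 b0; have ab0 : 0 < a + b by rewrite addr_gt0.
have i1 : (a + b)^-1 <= a^-1 by rewrite lef_pV2 ?posrE// lerDl ltW.
rewrite /psi; split.
- by apply: ler_wpM2l => //; rewrite !div1r lerD2l.
- by apply: ler_wpM2l => //; rewrite lerD2r ler_pM2l.
- rewrite -mulrDr; apply: ler_wpM2l => //.
  rewrite -subr_ge0.
  have -> : 3 / b + 1 / a - (3 / (a + b) + 1 / b + b^-1) =
      (a ^+ 2 - a * b + b ^+ 2) / (a * b * (a + b)).
    by field; rewrite !gt_eqF.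
  apply: divr_ge0; last by rewrite ltW// !mulr_gt0.
  have -> : a ^+ 2 - a * b + b ^+ 2 = (a - b / 2) ^+ 2 + 3 / 4 * b ^+ 2 by field.
  by rewrite addr_ge0 ?sqr_ge0// mulr_ge0 ?sqr_ge0//; lra.
Qed.

(** From [W E] and [W a], [key] collects [3 D + (n - 2 + n de) D >= (1 + de) n D]. The drop
    [de W / 5] is worth [5 W] after multiplication by [ka]: one [W] for the cost [n D / b], and four
    for the new [psi], which is at most [4 n D / b]. *)
Lemma strong_ineq (D a b E W n : R) : 0 <= D -> 0 < a -> 0 < b -> 2 <= n ->
  0 < E -> 0 <= W -> th * D <= W * a -> th * D <= W * b -> D <= W * E ->
  3 * E + (n - 2 + n * de) * a <= b ->
  let W' := (1 - de / 5) * W in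
  [/\ th * (n * D) <= W' * b, th * (n * D) <= W' * (n * a + b),
      n * D <= W' * (E + (n - 1) * a) &
      [/\ psi (n * D) b (n * a + b) + n * (D / b) + ka * W' <= ka * W,
          psi (n * D) (n * a + b) b + n * (D / b) + ka * W' <= ka * W & 0 <= W']].
Proof.
move=> D0 a0 b0 n2 E0 W0 Wa Wb We bE W'; have /andP[d0 d1] := de01.
have th1 : 1 <= th by rewrite /th; lra.
have DWa : D <= W * a by apply: le_trans Wa; rewrite ler_peMl.
have W'0 : 0 <= W' by rewrite /W' mulr_ge0//; lra.
have nD0 : 0 <= n * D by rewrite mulr_ge0//; lra.
have key : (1 + de) * (n * D) <= W * b.
  apply: le_trans (ler_wpM2l W0 bE).
  have -> : W * (3 * E + (n - 2 + n * de) * a) = 3 * (W * E) + (n - 2 + n * de) * (W * a) by ring.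
  have c0 : 0 <= n - 2 + n * de by rewrite addr_ge0 ?mulr_ge0//; lra.
  have := ler_wpM2l c0 DWa; nra.
have Wb' : th * (n * D) <= W' * b.
  have : th <= (1 - de / 5) * (1 + de) by rewrite /th; nra.
  move=> /(ler_wpM2r nD0)/le_trans; apply.
  by rewrite /W' -!mulrA ler_wpM2l//; lra.
have na0 : 0 <= n * a by rewrite mulr_ge0 ?ltW//; lra.
(* The weight [th] on the lengths acts here: with weight 1 the bracket would be [D + (n - 1) D],
   leaving no room for the factor [1 - de / 5]. *)
have We' : n * D <= W' * (E + (n - 1) * a).
  have h1 : n * D <= (1 - de / 5) * (D + (n - 1) * (th * D)).
    have -> : (1 - de / 5) * (D + (n - 1) * (th * D)) =
      ((1 - de / 5) * (1 + (n - 1) * th)) * D by ring.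
    apply: ler_wpM2r => //; rewrite -subr_ge0 /th.
    have -> : (1 - de / 5) * (1 + (n - 1) * (1 + de / 2)) - n =
      de * (n - 2) / 5 + de * (n - 1) * (1 - de) / 10 by field.
    by rewrite addr_ge0// divr_ge0// !mulr_ge0//; lra.
  apply: le_trans h1 _; rewrite /W' -!mulrA ler_wpM2l//; first by lra.
  have n1 : 0 <= n - 1 by lra.
  rewrite mulrDr; apply: lerD => //.
  by rewrite [leRHS]mulrCA ler_wpM2l.
have yW : n * (D / b) <= W.
  rewrite mulrA ler_pdivrMr//; apply: le_trans key.
  by rewrite ler_peMl//; lra.
have kaW : ka * W' + 5 * W = ka * W by rewrite /ka /W'; field; rewrite gt_eqF.
have D' : n * D / b = n * (D / b) by rewrite mulrA.
have p1 : n * D * (1 / b) = n * (D / b) by rewrite div1r mulrA.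
have i1 : (n * a + b)^-1 <= b^-1 by rewrite lef_pV2 ?posrE ?ltr_wpDl// lerDr.
have q1 : n * D * (n * a + b)^-1 <= n * (D / b).
  by rewrite -D'; apply: ler_wpM2l.
split=> //.
  by apply: le_trans Wb' _; rewrite ler_wpM2l// lerDr.
by split=> //; rewrite /psi mulrDr -kaW; lra.
Qed.

(** A prefix of [u^n v] consists of full copies of [u], each of discrepancy at most [D / |v|],
    followed by a prefix of [u] or [v] that the old budget covers. *)
Lemma leads_step C n c' (n0 : (0 < n)%N)
   (g' : good X J0 (cw C ++ cv C) (cv C) (pow_word (cu C) n ++ cv C) (cbe C) (cal C)
     (cE C + n.-1 * size (cu C)) c') :
  n = 1%N \/ (1 < n)%N /\
    3 * (cE C)%:R + (n%:R - 2 + n%:R * de) * la C <= lb C ->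
  exists C', [/\ leads C C', cw C' = cw C ++ cv C, cu C' = cv C &
     cv C' = pow_word (cu C) n ++ cv C].
Proof.
move=> cond; have st := g_st (cgood C); have st' := state_sym st.
have absv y : ends (cw C ++ cv C) y -> ends (cw C) y := abs_v st (x := y).
have s1 y : ends (cw C ++ cv C) y -> follows (cv C) y ->
    bsum (size (cv C)) y = cfv C.
  by move=> /absv wy vy; exact: csv.
have s2 y : ends (cw C ++ cv C) y -> follows (pow_word (cu C) n ++ cv C) y ->
    bsum (size (pow_word (cu C) n ++ cv C)) y = cfu C *+ n + cfv C.
  move=> /absv; rewrite follows_cat => wy /andP[uy vy]; rewrite size_cat bsumD.
  rewrite (csv _ vy); last exact: (abs_pw st (ends_follows wy uy)).
  congr (_ + _); elim: (n) y wy uy {vy} => [|k IHk] y wy.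
    by rewrite mulr0n /bsum big_ord0.
  rewrite pow_wordS follows_cat => /andP[uy ky]; rewrite size_cat bsumD (csu wy uy) IHk//.
    by rewrite mulrS.
  exact: (abs_u st (ends_follows wy uy)).
exists (Config g' s1 s2); split=> // ga.
set C' := Config g' s1 s2.
have laE : la C' = lb C by [].
have lbE : lb C' = n%:R * la C + lb C.
  by rewrite /= size_cat size_pow_word natrD natrM.
have vE : (cfv C')%:~R = n%:R * (cfu C)%:~R + (cfv C)%:~R :> R.
  by rewrite /= intrD -[cfu C *+ n]mulr_natl intrM natz -pmulrn.
have duE : du C' ga = dv C ga by [].
have dvE : dv C' ga = n%:R * du C ga + dv C ga.
  by rewrite /dv lbE vE /du; ring.
have a0 := la_gt0 C; have b0 := lb_gt0 C.
have DE : cD C' = n%:R * cD C.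
  rewrite /cD laE lbE vE.
  by rewrite -{3}(normr_nat R n) -normrM distrC; congr `|_|; ring.
rewrite /slope_ok duE dvE => ok.
have n0' : 0 < n%:R :> R by rewrite ltr0n.
have okC : slope_ok C ga.
  rewrite /slope_ok -(pmulr_rle0 _ n0').
  by have := sqr_ge0 (dv C ga); move: ok; nra.
split=> // M' [W [W0 Wa Wb We] H].
have D0 : 0 <= cD C by exact: normr_ge0.
have E0 : 0 < (cE C)%:R :> R by rewrite ltr0n (g_E (cgood C)).
have dub : `|du C ga| <= cD C / lb C by rewrite ler_pdivlMr// du_le.
have pre y j : ends (cw C) y -> follows (pow_word (cu C) n ++ cv C) y ->
   (j <= size (pow_word (cu C) n ++ cv C))%N ->
   `|disc ga j y| <= n.-1%:R * (cD C / lb C) + (M' - psi (cD C) (la C) (lb C) - ka * W)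
   \/ `|disc ga j y| <= n%:R * (cD C / lb C) + (M' - psi (cD C) (lb C) (la C) - ka * W).
  move=> wy; rewrite follows_cat => /andP[uy vy].
  have [ju _|uj] := leqP j (size (pow_word (cu C) n)).
    left; rewrite -[in follows _ _](prednK n0) in uy; rewrite -[in size _](prednK n0) in ju.
    have [i [r [z [i_n ru wz uz ->]]]] := disc_prefix ga wy uy ju.
    apply: le_trans (ler_normD _ _) _; apply: lerD.
      rewrite normrM normr_nat; apply: ler_pM => //; by rewrite ler_nat.
    by have [/(_ uz ru) + _] := H z r wz; lra.
  rewrite size_cat => jle; right.
  rewrite -(subnKC (ltnW uj)) discD (disc_pw _ wy uy).
  apply: le_trans (ler_normD _ _) _; apply: lerD.
    by rewrite normrM normr_nat ler_wpM2l.
  have wz := abs_pw st (ends_follows wy uy).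
  have [_ /(_ vy)] := H _ (j - size (pow_word (cu C) n))%N wz.
  by rewrite leq_subLR => /(_ jle); lra.
case: cond => [n1|[n1 bE]].
  have nR : n%:R = 1 :> R by rewrite n1.
  have EE : cE C' = cE C by rewrite /= n1 mul0n addn0.
  exists W; rewrite DE lbE ?laE nR ?EE !mul1r.
    by split=> //; rewrite mulrDr (le_trans Wb)// lerDr mulr_ge0// ltW.
  have [i1 i2 i3] := sturm_ineq D0 a0 b0.
  move=> y j /absv wy; split=> [vy jv|uvy juv].
    by have [_ /(_ vy jv)] := H y j wy; lra.
  by case: (pre y j wy uvy juv); rewrite ?nR ?n1 /= ?mul0r ?mul1r; lra.
have n2 : 2 <= n%:R :> R by rewrite ler_nat.
have [w1 w2 w3 [w4 w5 w6]] := strong_ineq D0 a0 b0 n2 E0 W0 Wa Wb We bE.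
exists ((1 - de / 5) * W); rewrite DE lbE ?laE.
  split=> //; rewrite natrD natrM; apply: le_trans w3 _.
  by rewrite -subn1 natrB// ltnW.
have p0 : 0 <= cD C / lb C by rewrite divr_ge0// ltW.
have psi0 a b : 0 < a -> 0 < b -> 0 <= psi (cD C) a b.
  by move=> a1 b1; rewrite /psi mulr_ge0// addr_ge0// divr_ge0// ltW.
have np : n.-1%:R * (cD C / lb C) <= n%:R * (cD C / lb C).
  by rewrite ler_wpM2r// ler_nat leq_pred.
have p1 := psi0 _ _ a0 b0; have p2 := psi0 _ _ b0 a0.
move=> y j /absv wy; split=> [vy jv|uvy juv].
  have [_ /(_ vy jv)] := H y j wy.
  have : 0 <= n%:R * (cD C / lb C) by rewrite mulr_ge0.
  by lra.
by case: (pre y j wy uvy juv); lra.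
Qed.

End Birkhoff.

(** * Bounded discrepancy along the sequence of pairs *)

Section Balanced.
Context (A : finType) (X : coded_system A) (R : realFieldType).
Local Notation S := (@ds_next A X).
Local Notation U := (@ds_prev A X).
Local Notation language := (language X).
Local Notation cplx := (cplx X).
Implicit Types (s t u v w : seq A) (x y z : X) (m n i j : nat) (ga : R).

Hypothesis recX : recurrent X.
Hypothesis cplx_unbounded : forall k, exists j, (k < cplx j)%N.
Context (K J0 : nat).
Hypothesis cplx_le : forall j, (J0 <= j)%N ->
  (2 * K * cplx j + 2 * j <= 3 * K * j)%N.

Let aper := aperiodic cplx_unbounded recX.
Let cplxX_lt := cplx_lt cplx_unbounded.
Let cplxX_gt := cplx_gt cplx_unbounded.

Lemma K_gt1 : (1 < K)%N.
Proof.
have := cplx_le (leq_addr 1 J0); have := cplxX_gt (J0 + 1).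
by case: K => [|[|k]] //; lia.
Qed.

(** Otherwise the complexity would eventually grow by at least 2 per letter, which the bound below
    3/2 excludes. *)
Lemma one_more_exists J : exists2 j, (J <= j)%N & (cplx j.+1 <= cplx j + 1)%N.
Proof.
apply: contrapT => H.
have {}H i : (J0 + J <= i)%N -> (cplx i + 2 <= cplx i.+1)%N.
  move=> Ji; rewrite leqNgt; apply/negP => lt; apply: H; exists i; last by lia.
  by rewrite (leq_trans _ Ji)// leq_addl.
have G i : (2 * i <= cplx (J0 + J + i))%N.
  elim: i => // i IHi; rewrite addnS mulnS.
  by have := H (J0 + J + i)%N (leq_addr _ _); lia.
have := G (3 * (J0 + J) + 1)%N.
have := @cplx_le (J0 + J + (3 * (J0 + J) + 1)) _.
rewrite -addnA leq_addr => /(_ isT); have := K_gt1; move: (cplx _) => p K1 h1 h2.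
have : (2 * K * (2 * (3 * (J0 + J) + 1)) <= 2 * K * p)%N by rewrite leq_mul2l h2 orbT.
lia.
Qed.

Let de : R := 2 / K%:R.

Lemma de01 : 0 < de <= 1.
Proof.
have K0 : 0 < K%:R :> R by rewrite ltr0n; have := K_gt1; lia.
by rewrite /de divr_gt0//= ler_pdivrMr// mul1r ler_nat K_gt1.
Qed.

Context (f : X -> int).
Local Notation bsum := (bsum f).
Local Notation disc := (disc f).
Local Notation config := (config f J0).
Local Notation leads := (@leads _ _ R f J0 de).
Local Notation budget := (@budget _ _ R f J0 de).
Implicit Types C : config.

Lemma config_step C : exists C', leads C C' /\
  ([/\ cw C' = cw C ++ cv C, cu C' = cv C & exists n, (0 < n)%N /\ cv C' = pow_word (cu C) n ++ cv C] \/
   [/\ cw C' = cw C ++ cu C, cu C' = cu C & exists n, (0 < n)%N /\ cv C' = pow_word (cv C) n ++ cu C]).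
Proof.
have cond n E a b : n = 1%N \/ (1 < n)%N /\ strong_cond K n E a b ->
    n = 1%N \/ (1 < n)%N /\ 3 * E%:R + (n%:R - 2 + n%:R * de) * a%:R <= b%:R :> R.
  case=> [->|[n1 sc]]; [by left|right; split=> //].
  have K0 : 0 < K%:R :> R by rewrite ltr0n; have := K_gt1; lia.
  have : (3 * K * E + K * n * a + 2 * n * a)%:R <= (K * b + 2 * K * a)%:R :> R by rewrite ler_nat.
  rewrite !natrD !natrM => h; rewrite -(ler_pM2l K0) -subr_ge0.
  rewrite -subr_ge0 in h; apply: le_trans h _; rewrite le_eqVlt; apply/orP; left.
  by apply/eqP; rewrite /de; field; rewrite gt_eqF.
have [[n [c' [n0 g' /cond sc]]]|[n [c' [n0 g' /cond sc]]]] :=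
  step_good aper cplxX_lt cplxX_gt cplx_le (cgood C).
  have [C' [ld wE uE vE]] := leads_step de01 n0 g' sc.
  by exists C'; split=> //; left; split=> //; exists n.
have [C' [ld wE uE vE]] := @leads_step _ _ _ _ _ _ de01 (config_sym C) n c' n0 g' sc.
exists C'; split; first by apply: leads_trans ld; exact: leads_sym.
by right; split=> //; exists n.
Qed.

(** A step that keeps [u] appends [u] to [w], so aperiodicity bounds the number of such steps; the
    next one makes the other word the new first word. *)
Lemma config_switch k C N j : ~ language (pow_word (cu C) N) ->
  (forall x, ends (cw C) x -> ends (pow_word (cu C) j) x) -> (N <= j + k)%N ->
  exists C', [/\ leads C C', (size (cv C) <= size (cu C'))%N &
    (size (cu C) + size (cu C') <= size (cv C'))%N].
Proof.
elim: k C j => [|k IHk] C j nN wj Nj.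
  case: nN; have [x wx] := st_L (g_st (cgood C)).
  have := wj x wx; rewrite addn0 in Nj; rewrite -(subnK Nj) pow_wordD => /ends_catr.
  by exists x.
have [C1 [ld [[wE uE [n [n0 vE]]]|[wE uE [n [n0 vE]]]]]] := config_step C.
  exists C1; split=> //; rewrite uE // vE size_cat size_pow_word leq_add2r.
  by rewrite leq_pmull.
have [|||C2 [ld2 s1 s2]] := IHk C1 j.+1.
- by rewrite uE.
- move=> x; rewrite wE uE => /ends_catP[y [-> /wj jy uy]].
  by rewrite pow_wordSr; exact: ends_follows.
- by rewrite addSn -addnS.
- exists C2; split; first exact: leads_trans ld2.
    by apply: leq_trans s1; rewrite vE size_cat size_pow_word (leq_trans (leq_pmull _ n0)) ?leq_addr.
  by rewrite -uE.
Qed.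

Lemma config_grow C : exists C', [/\ leads C C',
  (size (cu C) + size (cv C) <= size (cu C'))%N &
  (size (cu C) + size (cv C) <= size (cv C'))%N].
Proof.
have sw C1 : exists C', [/\ leads C1 C', (size (cv C1) <= size (cu C'))%N &
    (size (cu C1) + size (cu C') <= size (cv C'))%N].
  have [N nN] := aper (st_size_u (g_st (cgood C1))).
  by apply: (@config_switch N C1 N 0).
have [C1 [l1 a1 b1]] := sw C; have [C2 [l2 a2 b2]] := sw C1.
exists C2; split; [exact: leads_trans l1 l2|lia|lia].
Qed.

Lemma config_large N C : exists C',
  [/\ leads C C', (N <= size (cu C'))%N & (N <= size (cv C'))%N].
Proof.
elim: N => [|N [C1 [l1 a1 b1]]].
  by exists C; split=> // ga ok; split.
have [C2 [l2 a2 b2]] := config_grow C1; exists C2.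
have := st_size_u (g_st (cgood C1)); have := st_size_u (state_sym (g_st (cgood C1))).
by split; [exact: leads_trans l1 l2|lia|lia].
Qed.

(** Counted from the last visit [y] to [w] up to [x], time [m] falls in the first coding word and
    time [m + N] in the first two; this gives the bounds [M] and [2 M]. *)
Lemma budget_disc C ga M N x : budget C ga M -> (N <= size (cu C))%N ->
  (N <= size (cv C))%N -> `|disc ga N x| <= 3 * M.
Proof.
move=> [W [W0 _ _ _] H] Nu Nv; have st := g_st (cgood C).
have u0 := st_size_u st; have v0 := st_size_u (state_sym st).
have exP : exists m, ends (cw C) (iter m U x).
  by have [B HB] := recur_past recX 0 (st_L st); have [m [_ _ wm]] := HB x; exists m.
case: (ex_minnP exP) => m wm mmin; set y := iter m U x in wm.
have rest (r p : R) : 0 <= p -> r + p + 25 / de * W <= M -> r <= M.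
  move=> p0; have : 0 <= 25 / de * W.
    by have /andP[d0 _] := de01; rewrite mulr_ge0// divr_ge0// ltW.
  lra.
have psi0 (a b : nat) : (0 < a)%N -> (0 < b)%N -> 0 <= psi (cD R C) a%:R b%:R.
  move=> a0 b0; rewrite /psi mulr_ge0 ?normr_ge0// addr_ge0// divr_ge0 ?ler0n//.
have bu z j : ends (cw C) z -> follows (cu C) z -> (j <= size (cu C))%N -> `|disc ga j z| <= M.
  by move=> wz uz ju; have [/(_ uz ju) + _] := H z j wz; apply: rest; exact: psi0.
have bv z j : ends (cw C) z -> follows (cv C) z -> (j <= size (cv C))%N -> `|disc ga j z| <= M.
  by move=> wz vz jv; have [_ /(_ vz jv)] := H z j wz; apply: rest; exact: psi0.
have bN z j : ends (cw C) z -> (j <= N)%N -> `|disc ga j z| <= M.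
  move=> wz jN; have [uz|vz] := st_fwd st wz.
    by apply: bu => //; exact: leq_trans jN Nu.
  by apply: bv => //; exact: leq_trans jN Nv.
have xE : iter m S y = x by rewrite iterUK.
have -> : disc ga N x = disc ga (m + N) y - disc ga m y.
  by rewrite discD xE addrC addKr.
have [l [ml wl bl]] : exists l, [/\ (m < l)%N, ends (cw C) (iter l S y) &
    forall j, (j <= l)%N -> `|disc ga j y| <= M].
  have lt l : (0 < l)%N -> ends (cw C) (iter l S y) -> (m < l)%N.
    move=> l0 wl; rewrite ltnNge; apply/negP => lm.
    by move: wl; rewrite iterSU// => /mmin; lia.
  have [uy|vy] := st_fwd st wm.
    have wl := abs_u st (ends_follows wm uy).
    by exists (size (cu C)); split=> //; [exact: lt|move=> j; exact: bu].
  have wl := abs_v st (ends_follows wm vy).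
  by exists (size (cv C)); split=> //; [exact: lt|move=> j; exact: bv].
have b1 := bl m (ltnW ml).
have b2 : `|disc ga (m + N) y| <= 2 * M.
  have [le|gt] := leqP (m + N) l.
    have := bl _ le; have := normr_ge0 (disc ga m y); lra.
  rewrite -(subnKC (ltnW gt)) discD; apply: le_trans (ler_normD _ _) _.
  have rN : (m + N - l <= N)%N by lia.
  have := bl l (leqnn _); have := bN _ _ wl rN; lra.
by apply: le_trans (ler_normB _ _) _; lra.
Qed.

Context (M : nat) (f_local : forall x y, past M x = past M y -> f x = f y).
Context (F : nat) (f_bounded : forall x, `|f x| <= F%:Z).

Lemma bsum_le n x : `|(bsum n x)%:~R| <= n%:R * F%:R :> R.
Proof.
rewrite -intr_norm -natrM pmulrn ler_int /bsum.
apply: le_trans (ler_norm_sum _ _ _) _.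
apply: (@le_trans _ _ (\sum_(i < n) F%:Z)); first exact: ler_sum.
by rewrite sumr_const card_ord -mulr_natr PoszM natz mulrC.
Qed.

Lemma disc_le ga n x : `|ga| <= F%:R -> `|disc ga n x| <= n%:R * (2 * F%:R).
Proof.
move=> gaF; apply: le_trans (ler_normB _ _) _.
have := bsum_le n x; rewrite normrM normr_nat.
have := ler_wpM2l (ler0n R n) gaF; lra.
Qed.

Theorem balanced : exists B : R, forall N x y,
  `|(bsum N x)%:~R - (bsum N y)%:~R| <= B.
Proof.
have [q0 Jq0 om] := one_more_exists (J0 + M).
have [w [u [v [al [be [q0w g]]]]]] := good_exists aper recX (right_special_exists cplx_unbounded)
  cplxX_gt (leq_trans (leq_addr M J0) Jq0) om.
have Mw : (M <= size w)%N by apply: leq_trans q0w; apply: leq_trans Jq0; exact: leq_addl.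
have [fu fuP] := bsum_word f_local u Mw; have [fv fvP] := bsum_word f_local v Mw.
pose C0 := Config g fuP fvP.
have u0 : 1 <= (size u)%:R :> R by rewrite ler1n (st_size_u (g_st g)).
have v0 : 1 <= (size v)%:R :> R by rewrite ler1n (st_size_u (state_sym (g_st g))).
(* The two lengths and [E = 1] are at least 1, so [W0] dominates all three weighted quotients. *)
pose W0 : R := (1 + de / 2) * cD R C0.
have D0 : 0 <= cD R C0 by exact: normr_ge0.
have /andP[d0 d1] := de01.
have W00 : 0 <= W0 by rewrite mulr_ge0//; lra.
pose B0 : R := ((size u)%:R + (size v)%:R) * (2 * F%:R) +
  psi (cD R C0) (size u)%:R (size v)%:R + psi (cD R C0) (size v)%:R (size u)%:R + 25 / de * W0.
have psi0 (a b : R) : 1 <= a -> 1 <= b -> 0 <= psi (cD R C0) a b.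
  by move=> a0 b0; rewrite /psi mulr_ge0// addr_ge0// divr_ge0//; lra.
have p1 := psi0 _ _ u0 v0; have p2 := psi0 _ _ v0 u0.
(* The first budget must hold uniformly in the slope, which will depend on [N]. *)
have inv0 ga : `|ga| <= F%:R -> budget C0 ga B0.
  move=> gaF; exists W0.
    split=> //=; rewrite -/W0; [exact: ler_peMr|exact: ler_peMr|].
    by rewrite mulr1 /W0 ler_peMl//; lra.
  move=> y j wy; have F0 : 0 <= 2 * F%:R :> R by rewrite mulr_ge0 ?ler0n.
  have le_jF : (j <= size u + size v)%N ->
      `|disc ga j y| <= ((size u)%:R + (size v)%:R) * (2 * F%:R).
    move=> jle; apply: le_trans (disc_le j y gaF) _.
    by apply: ler_wpM2r => //; rewrite -natrD ler_nat.
  rewrite /B0 /=; clear -le_jF p1 p2 W00.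
  set P := psi _ _ _ in p1 *; set Q := psi _ _ _ in p2 *; set L := _ * _ in le_jF *.
  by split=> _ jle; have := le_jF ltac:(lia); clear -p1 p2 W00; lra.
exists (6 * B0) => N x y.
have [C [ld Nu Nv]] := config_large N C0.
(* This slope makes [du] vanish at the last pair, and as an average of [f] it is bounded by [F]. *)
pose ga : R := (cfu C)%:~R / (size (cu C))%:R.
have su0 : 0 < (size (cu C))%:R :> R by exact: la_gt0.
have ok : slope_ok C ga.
  have d0' : du C ga = 0 by rewrite /du /ga mulrCA divff ?gt_eqF// mulr1 subrr.
  by rewrite /slope_ok d0' mul0r.
have gaF : `|ga| <= F%:R.
  have [z wz] := language_wv aper (state_sym (g_st (cgood C))).
  have [z' [_ wz' uz']] := ends_catP wz.
  rewrite /ga -(csu wz' uz') normrM normfV normr_nat ler_pdivrMr// mulrC.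
  exact: bsum_le.
have I := (ld ga ok).2 _ (inv0 ga gaF).
have hx := budget_disc x I Nu Nv; have hy := budget_disc y I Nu Nv.
have -> : (bsum N x)%:~R - (bsum N y)%:~R = disc ga N x - disc ga N y.
  by rewrite /disc; ring.
by apply: le_trans (ler_normB _ _) _; lra.
Qed.

End Balanced.

(** * Low-complexity subshifts are balanced *)

Local Open Scope classical_set_scope.
Local Open Scope ring_scope.

Section Subshift.
Context (A : finType) (X : minimal_subshift A).
Local Notation space := (Defs.space X).
Local Notation sigma := (@Defs.sigma A X).
Local Notation tau := (@Defs.tau A X).
Implicit Types (x y : space) (m n : nat).

Definition coord x (k : int) : A := \val x k.

Lemma coord_inj x y : (forall k, coord x k = coord y k) -> x = y.
Proof. by move=> xy; apply/val_inj/funext. Qed.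

Lemma coord_sigma x k : coord (sigma x) k = coord x (k + 1).
Proof. by []. Qed.

Lemma coord_tau x k : coord (tau x) k = coord x (k - 1).
Proof. by []. Qed.

Definition subshift_system : coded_system A :=
  CodedSystem (fun x : space => coord x 0) (@sigmaK A X) (@tauK A X).

Local Notation past := (@past A subshift_system).
Local Notation ends := (@ends A subshift_system).

Lemma coord_iter_sigma n x (k : int) :
  coord (iter n sigma x) k = coord x (k + n%:Z).
Proof.
elim: n k => [|n IHn] k; first by rewrite addr0.
by rewrite iterS coord_sigma IHn intS addrA.
Qed.

Lemma past_coord n x y : past n x = past n y <->
  forall k : nat, (k < n)%N -> coord x (- k.+1%:Z) = coord y (- k.+1%:Z).
Proof.
elim: n x y => [|n IHn] x y; first by split.
have e (k : nat) : - k.+1%:Z - 1 = - k.+2%:Z :> int by lia.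
split=> [/= /rcons_inj[/IHn pxy xy] [_|k kn]|xy /=].
- by move: xy; rewrite !coord_tau sub0r.
- by have := pxy k kn; rewrite !coord_tau e.
- congr rcons; last by have := xy 0%N isT; rewrite !coord_tau sub0r.
  by apply/IHn => k kn; rewrite !coord_tau e xy.
Qed.

Lemma past_nth c n x i : (i < n)%N -> nth c (past n x) i = coord x (i%:Z - n%:Z).
Proof.
elim: n x => // n IHn x; rewrite ltnS leq_eqVlt /= nth_rcons size_past.
case: ltngtP => //= [lt _|-> _]; first by rewrite IHn// coord_tau; congr coord; lia.
by rewrite coord_tau; congr coord; lia.
Qed.

(** These are the letters of [x] at the positions from [-n] to [n - 1]. *)
Definition win n x := past (n + n) (iter n sigma x).

Lemma win_val n x y : win n x = win n y <->
  forall k : int, - n%:Z <= k < n%:Z -> coord x k = coord y k.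
Proof.
rewrite /win past_coord; split=> [H k /andP[k1 k2]|H k kn].
  pose j := absz (n%:Z - 1 - k)%R.
  have := H j; rewrite !coord_iter_sigma.
  have -> : - j.+1%:Z + n%:Z = k by rewrite /j; lia.
  by apply; rewrite /j; lia.
by rewrite !coord_iter_sigma; apply: H; lia.
Qed.

Lemma win_le m n x y : (m <= n)%N -> win n x = win n y -> win m x = win m y.
Proof. by move=> mn /win_val H; apply/win_val => k km; apply: H; lia. Qed.

Lemma near_letter x (k : int) : \forall y \near x, coord y k = coord x k.
Proof.
have cv : continuous (\val : space -> full_shift A).
  exact: (@initial_continuous _ (full_shift A) (\val : points X -> full_shift A)).
have cp := @proj_continuous int (fun=> discrete_topology A) k (\val x).
exact: (cv x _ (cp _ (@discrete_set1 (discrete_topology A) (\val x k)))).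
Qed.

Lemma iter_sigma_continuous n : continuous (iter n sigma).
Proof.
elim: n => [x|n IHn x]; first exact: cvg_id.
by apply: (@continuous_comp _ _ _ (iter n sigma) sigma); [exact: IHn|exact: sigma_continuous].
Qed.

Lemma near_past n x : \forall y \near x, past n y = past n x.
Proof.
elim: n x => [|n IHn] x; first exact: filterE.
have h : \forall y \near x, past n (tau y) = past n (tau x) := tau_continuous (IHn (tau x)).
have h2 := near_letter x (-1).
by apply: filterS2 h h2 => y /= -> e; rewrite !coord_tau sub0r e.
Qed.

Lemma near_win n x : \forall y \near x, win n y = win n x.
Proof. exact: (@iter_sigma_continuous n x _ (near_past (n + n) (iter n sigma x))). Qed.

(** The sets that contain a cylinder around [x] form a filter [G], and [G] converges to [x] because
    it does so in each coordinate. *)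
Lemma nbhs_win x (V : set space) : nbhs x V ->
  exists n, forall y, win n y = win n x -> V y.
Proof.
move=> [W' [[W oW <-] Wx] WV].
pose G : set_system (full_shift A) := [set B | exists n : nat, forall z : full_shift A,
  (forall k : int, - n%:Z <= k < n%:Z -> z k = coord x k) -> B z].
have FG : Filter G.
  apply: Build_Filter => [|P Q [m Pm] [n Qn]|P Q PQ [n Pn]].
  - by exists 0%N.
  - exists (maxn m n) => z zk; split; [apply: Pm|apply: Qn] => k kn; apply: zk; lia.
  - by exists n => z /Pn/PQ.
have Gx : G --> (\val x : full_shift A).
  apply/cvg_sup => i B [_ [[W1 oW1 <-] W1x] sB].
  exists (absz i).+1 => z zx; apply: sB; rewrite /= zx//; lia.
have [n Wn] : G W by apply: Gx; exact: open_nbhs_nbhs.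
exists n => y /win_val yx; apply: WV; exact: Wn.
Qed.

(* Compactness: a neighbourhood assignment is witnessed by windows of a
   uniform size. *)
Lemma uniform_win (Q : space -> space -> Prop) :
  (forall z, \forall y \near z, Q z y) ->
  exists n, forall x y, win n x = win n y -> exists z, Q z x /\ Q z y.
Proof.
move=> nQ.
have /choice[m mP] z : exists n, forall y, win n y = win n z -> Q z y.
  by have [n] := nbhs_win (nQ z); exists n.
have := @space_compact A X; rewrite compact_cover.
move=> /(_ space setT (fun z => [set y | win (m z) y = win (m z) z])) [z _|z _|D _ sD].
- rewrite openE => y /= yz; have := near_win (m z) y.
  by apply: filterS => y' /= ->.
- by exists z.
exists (\max_(z <- finmap.enum_fset D) m z)%N => x y xy.
have [z /= zD xz] := sD x I; exists z; split; apply: mP => //.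
rewrite -xz; apply/esym; apply: win_le xy.
by rewrite (big_rem z zD) leq_maxl.
Qed.

Lemma CZ_win (f : CZ X) : exists n, forall x y, win n x = win n y -> f x = f y.
Proof.
have [z|n nP] := @uniform_win (fun z y => f y = f z).
  exact: ((CZ_predP f).1 (CZ_in f)).
by exists n => x y /nP[z [-> ->]].
Qed.

Lemma near_ends s x : \forall y \near x, ends s y = ends s x.
Proof. by have := near_past (size s) x; apply: filterS => y; rewrite /ends => ->. Qed.

(** The points that never read [s] from now on form a closed forward-invariant set, empty by
    minimality; compactness then bounds the waiting time. *)
Lemma subshift_recurrent : recurrent subshift_system.
Proof.
move=> s [x0 sx0].
have nearn n x : \forall y \near x, ends s (iter n sigma y) = ends s (iter n sigma x).
  exact: (@iter_sigma_continuous n x _ (near_ends s (iter n sigma x))).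
pose Z : set space := [set x | forall n, ~~ ends s (iter n sigma x)].
have hit x : exists n, ends s (iter n sigma x).
  apply: contrapT => nx; have ZT : Z = setT.
    apply: space_minimal_forward.
    - rewrite -[Z]setCK; apply: open_closedC; rewrite openE => y.
      move=> /existsNP[n /negP]; rewrite negbK => e.
      by have := nearn n y; apply: filterS => z zy /(_ n); rewrite zy e.
    - by move=> y Zy n; rewrite -iterSr; exact: Zy.
    - by exists x => n; apply/negP => e; apply: nx; exists n.
  have : Z x0 by rewrite ZT.
  by move=> /(_ 0%N); rewrite /= sx0.
have := @space_compact A X; rewrite compact_cover.
move=> /(_ nat setT (fun n => [set y | ends s (iter n sigma y)])) [n _|x _|D _ sD].
- rewrite openE => y /= ey; have := nearn n y.
  by apply: filterS => z /= ->.
- by have [n] := hit x; exists n.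
exists (\max_(n <- finmap.enum_fset D) n)%N => x.
have [n /= nD nx] := sD x I; exists n => //.
by rewrite (big_rem n nD) leq_maxl.
Qed.

Lemma cplx_complexity n : (cplx subshift_system n <= complexity (points X) n)%N.
Proof.
apply/subset_leq_card/fintype.subsetP => w; rewrite inE => -[x wx].
rewrite inE; exists (\val x); first exact: set_valP.
exists (- n%:Z) => i; rewrite (tnth_nth (tnth w i)) -(eqP wx) size_tuple.
by rewrite past_nth// addrC.
Qed.

Lemma sep_win (s : seq space) : uniq s ->
  exists n, forall m, (n <= m)%N -> uniq [seq win m x | x <- s].
Proof.
elim: s => [|x s IHs] /=; first by exists 0%N.
move=> /andP[xs /IHs[n nP]].
have [k kP] : exists k, forall m, (k <= m)%N -> win m x \notin [seq win m y | y <- s].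
  elim: s xs {IHs nP} => [|y s IHs]; first by exists 0%N.
  rewrite inE negb_or => /andP[xy /IHs[k kP]].
  have [j xj] : exists j : int, coord x j <> coord y j.
    apply/existsNP => H; move/eqP: xy; apply; exact: coord_inj.
  exists (maxn k (absz j).+1) => m km; rewrite /= inE negb_or kP; last by lia.
  rewrite andbT; apply/eqP => /win_val e; apply: xj; apply: e; lia.
exists (maxn n k) => m nkm; rewrite kP ?nP//; lia.
Qed.

Lemma subshift_unbounded : infinite_set (points X) ->
  forall k, exists j, (k < cplx subshift_system j)%N.
Proof.
move=> infX k; have [D DX kD] := infinite_set_fset k.+1 infX.
pose s : seq space := [seq insubd (point : space) z | z <- finmap.enum_fset D].
have us : uniq s.
  rewrite map_inj_in_uniq ?finmap.fset_uniq// => z1 z2 /DX z1X /DX z2X.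
  by move=> /(congr1 val); rewrite !insubdK//; exact/mem_set.
have [n /(_ n (leqnn n)) un] := sep_win us.
exists (n + n)%N; apply: leq_trans kD _; rewrite -(size_map (insubd (point : space))).
rewrite -/s -(size_map (win n)); apply: size_le_cplx => // _ /mapP[x _ ->].
by rewrite size_past; split=> //; exact: language_past.
Qed.

End Subshift.

(** Some tail has supremum at most [r < 3 / 2], and [K] is chosen so that [1 / K] fits into the
    gap. *)
Lemma limn_esup_lt_ratio (R : realType) (p : nat -> nat) :
  (limn_esup (fun q : nat => ((p q)%:R / q%:R : R)%:E) < (3 / 2 : R)%:E)%E ->
  exists K J, forall j, (J <= j)%N -> (2 * K * p j + 2 * j <= 3 * K * j)%N.
Proof.
move=> /ereal_inf_lt[_ [V [N _ NV] <-]] Vlt.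
have supV j : (N <= j)%N -> (((p j)%:R / j%:R : R)%:E <= ereal_sup [set ((p q)%:R / q%:R : R)%:E | q in V])%E.
  by move=> Nj; apply: ereal_sup_ubound; exists j => //; exact: NV.
have [r [rlt rub]] : exists r : R, r < 3 / 2 /\ forall j, (N <= j)%N -> (p j)%:R / j%:R <= r.
  move: Vlt supV; case: (ereal_sup _) => [r| |] // rlt rub.
    by exists r; split; [rewrite -lte_fin|move=> j /rub; rewrite lee_fin].
  by have := rub N (leqnn N); rewrite leeNy_eq.
have e0 : 0 < 3 / 2 - r by rewrite subr_gt0.
pose K := Num.bound (3 / 2 - r)^-1.
have K1 : K%:R * (3 / 2 - r) >= 1.
  rewrite -ler_pdivrMr// div1r ltW//; apply: archi_boundP.
  by rewrite invr_ge0 ltW.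
exists K, N.+1 => j Nj; have j0 : 0 < j%:R :> R by rewrite ltr0n; lia.
have := rub j (ltnW Nj); rewrite ler_pdivrMr// => pj.
rewrite -(ler_nat R) [leLHS]natrD !natrM.
have h1 : K%:R * (p j)%:R <= K%:R * (r * j%:R) by rewrite ler_wpM2l.
have h2 : j%:R <= K%:R * (3 / 2 - r) * j%:R by rewrite ler_peMl// ltW.
lra.
Qed.

(** * Birkhoff sums, means and transfer functions *)

Section Mean.
Context (R : realType) (A : finType) (X : minimal_subshift A).
Local Notation space := (Defs.space X).
Local Notation sigma := (@Defs.sigma A X).
Local Notation tau := (@Defs.tau A X).
Local Notation CZ := (CZ X).
Implicit Types (x y z : space) (m n N : nat) (f g : CZ) (ga : R).

Definition birkhoff f n x : int := \sum_(i < n) f (iter i sigma x).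

Lemma birkhoffD f m n x : birkhoff f (m + n) x = birkhoff f m x + birkhoff f n (iter m sigma x).
Proof.
rewrite /birkhoff big_split_ord /=; congr (_ + _); apply: eq_bigr => i _.
by rewrite addnC iterD.
Qed.

Lemma birkhoff1 f x : birkhoff f 1 x = f x.
Proof. by rewrite /birkhoff big_ord1. Qed.

Lemma near_birkhoff f n x : \forall y \near x, birkhoff f n y = birkhoff f n x.
Proof.
elim: n => [|n IHn]; first by apply: filterE => y; rewrite /birkhoff !big_ord0.
have h : \forall y \near x, f (iter n sigma y) = f (iter n sigma x).
  exact: (@iter_sigma_continuous _ _ n x _ ((CZ_predP f).1 (CZ_in f) _)).
apply: filterS2 IHn h => y e1 e2.
by rewrite -addn1 !birkhoffD e1 !birkhoff1 e2.
Qed.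

Definition balanced_fun f := exists B : R, forall N x y,
  `|(birkhoff f N x)%:~R - (birkhoff f N y)%:~R| <= B.

Theorem low_complexity_balanced f : infinite_set (points X) ->
  (limn_esup (fun q : nat => ((complexity (points X) q)%:R / q%:R : R)%:E)
      < (3 / 2 : R)%:E)%E ->
  balanced_fun f.
Proof.
move=> infX /limn_esup_lt_ratio[K [J KJ]].
have cplx_le j : (J <= j)%N ->
    (2 * K * cplx (subshift_system X) j + 2 * j <= 3 * K * j)%N.
  move=> /KJ; apply: leq_trans; rewrite leq_add2r leq_mul2l cplx_complexity.
  by rewrite orbT.
have [n nP] := CZ_win f; have [F fF] := CZ_bounded (asboolP _ (CZ_in f)).
(* After composition with [tau^n] the window that [f] reads lies entirely in the past. *)
pose f' (x : subshift_system X) : int := f (iter n tau x).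
have f'_local (x y : subshift_system X) : past (n + n) x = past (n + n) y -> f' x = f' y.
  move=> xy; apply: nP; rewrite /win.
  by rewrite !(iterUK (X := subshift_system X) n).
have [B HB] := @balanced _ _ R (@subshift_recurrent _ X)
  (subshift_unbounded infX) _ _ cplx_le f' _ f'_local F (fun x => fF _).
exists B => N x y; have := HB N (iter n sigma x) (iter n sigma y).
have E z : bsum f' N (iter n sigma z : subshift_system X) = birkhoff f N z.
  apply: eq_bigr => i _; rewrite /f' /=; congr (f _).
  rewrite -iterD addnC iterD.
  exact: (iterSK (X := subshift_system X) n).
by rewrite !E.
Qed.

Definition is_mean f ga := exists B : R, forall N x,
  `|(birkhoff f N x)%:~R - N%:R * ga| <= B.

(** Cutting [N * M] steps into blocks of either length gives [(s N - B) / N <= (s M + B) / M], so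
    the supremum of the left-hand sides separates the two families. *)
Lemma mean_exists f : balanced_fun f -> exists ga, is_mean f ga.
Proof.
move=> [B HB]; have x0 : space := point.
have B0 : 0 <= B by apply: le_trans (HB 0%N x0 x0).
pose s N : R := (birkhoff f N x0)%:~R.
have blocks k N x : `|(birkhoff f (k * N) x)%:~R - k%:R * s N| <= k%:R * B.
  elim: k x => [|k IHk] x; first by rewrite /birkhoff big_ord0 !mul0r subrr normr0.
  rewrite mulSn birkhoffD intrD -natr1.
  have := IHk (iter N sigma x); have := HB N x x0; rewrite -/(s N).
  rewrite !ler_norml => /andP[h1 h2] /andP[h3 h4]; apply/andP; split; lra.
have cmp N M : (0 < N)%N -> (0 < M)%N -> (s N - B) / N%:R <= (s M + B) / M%:R.
  move=> N0 M0; have rN : 0 < N%:R :> R by rewrite ltr0n.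
  have rM : 0 < M%:R :> R by rewrite ltr0n.
  rewrite ler_pdivrMr// mulrAC ler_pdivlMr//.
  have := blocks M N x0; have := blocks N M x0; rewrite mulnC.
  rewrite !ler_norml => /andP[h1 h2] /andP[h3 h4]; lra.
pose E := [set (s N - B) / N%:R | N in [set N | (0 < N)%N]].
have E0 : E !=set0 by exists ((s 1%N - B) / 1); exists 1%N.
have ubE M : (0 < M)%N -> ubound E ((s M + B) / M%:R).
  by move=> M0 _ [N /= N0 <-]; exact: cmp.
have supE : has_sup E by split=> //; exists ((s 1%N + B) / 1); exact: ubE.
exists (sup E), (2 * B) => N x.
have [->|N0] := posnP N.
  by rewrite /birkhoff big_ord0 mul0r subrr normr0 mulr_ge0.
have rN : 0 < N%:R :> R by rewrite ltr0n.
have lo : (s N - B) / N%:R <= sup E by apply: sup_upper_bound => //; exists N.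
have hi : sup E <= (s N + B) / N%:R by apply: ge_sup => //; exact: ubE.
rewrite ler_pdivrMr// in lo; rewrite ler_pdivlMr// in hi.
have := HB N x x0; rewrite -/(s N).
rewrite !ler_norml => /andP[h1 h2]; apply/andP; split; lra.
Qed.

Lemma is_mean_uniq f ga1 ga2 : is_mean f ga1 -> is_mean f ga2 -> ga1 = ga2.
Proof.
move=> [B1 H1] [B2 H2]; apply/eqP; rewrite -subr_eq0 -normr_le0 leNgt; apply/negP => d0.
set d := `|ga1 - ga2| in d0.
pose N := Num.bound ((B1 + B2) / d).
have x0 : space := point.
have B0 : 0 <= B1 + B2.
  by rewrite addr_ge0//; [apply: le_trans (H1 0%N x0)|apply: le_trans (H2 0%N x0)].
have : (B1 + B2) / d < N%:R by apply: archi_boundP; rewrite divr_ge0// ltW.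
rewrite ltr_pdivrMr//; apply/negP; rewrite -leNgt.
rewrite -(normr_nat R) -normrM.
have := H1 N x0; have := H2 N x0.
rewrite !ler_norml => /andP[h1 h2] /andP[h3 h4]; apply/andP; split; lra.
Qed.

Lemma is_meanB f g ga1 ga2 : is_mean f ga1 -> is_mean g ga2 ->
  is_mean (f - g) (ga1 - ga2).
Proof.
move=> [B1 H1] [B2 H2]; exists (B1 + B2) => N x.
have -> : birkhoff (f - g) N x = birkhoff f N x - birkhoff g N x.
  by rewrite /birkhoff -sumrB; apply: eq_bigr => i _.
have -> : (birkhoff f N x - birkhoff g N x)%:~R - N%:R * (ga1 - ga2) =
   ((birkhoff f N x)%:~R - N%:R * ga1) - ((birkhoff g N x)%:~R - N%:R * ga2) by rewrite intrB; ring.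
by apply: le_trans (ler_normB _ _) _; exact: lerD.
Qed.

Lemma is_mean_coboundary g : is_mean (g - CZ_sigma g) 0.
Proof.
have [F gF] := CZ_bounded (asboolP _ (CZ_in g)); exists (2 * F%:R) => N x.
have -> : birkhoff (g - CZ_sigma g) N x = g x - g (iter N sigma x).
  elim: N => [|N IHN]; first by rewrite /birkhoff big_ord0 subrr.
  by rewrite -addn1 birkhoffD IHN birkhoff1 CZB /= addrA subrK addn1.
rewrite mulr0 subr0 intrB; apply: le_trans (ler_normB _ _) _.
by have := gF x; have := gF (iter N sigma x); rewrite -2!(ler_int R) !intr_norm; lra.
Qed.

Lemma is_mean_cst (k : int) : is_mean (CZ_cst X k) k%:~R.
Proof.
exists 0 => N x; have -> : birkhoff (CZ_cst X k) N x = k * N%:Z.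
  by rewrite /birkhoff (eq_bigr (fun=> k))// sumr_const card_ord -mulr_natr natz.
by rewrite intrM -pmulrn mulrC subrr normr0.
Qed.

Lemma is_mean_ge0 f ga : (forall x, 0 <= f x) -> is_mean f ga -> 0 <= ga.
Proof.
move=> f0 [B HB]; rewrite leNgt; apply/negP => g0; have x0 : space := point.
have ng : 0 < - ga by rewrite oppr_gt0.
have B0 : 0 <= B by apply: le_trans (HB 0%N x0).
have : B / - ga < (Num.bound (B / - ga))%:R by apply: archi_boundP; rewrite divr_ge0// ltW.
set N := Num.bound _; rewrite ltr_pdivrMr//; apply/negP; rewrite -leNgt.
have : 0 <= birkhoff f N x0 by apply: sumr_ge0 => i _.
rewrite -(ler_int R); have := HB N x0; rewrite ler_norml => /andP[h1 h2]; lra.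
Qed.

(* Gottschalk-Hedlund: the supremum and the infimum of the cocycle over a whole
   orbit differ by an invariant lower semicontinuous function, hence by a
   constant, so that both are continuous. *)
Section GottschalkHedlund.
Context f ga (mf : is_mean f ga).

Let phi n x : R := (birkhoff f n x)%:~R - n%:R * ga.

Let phiD m n x : phi (m + n) x = phi m x + phi n (iter m sigma x).
Proof. by rewrite /phi birkhoffD intrD natrD; ring. Qed.

Let phi0 x : phi 0 x = 0.
Proof. by rewrite /phi /birkhoff big_ord0 mul0r subrr. Qed.

(** The signed sum of [f - ga] from [x] to the point of its orbit with index [n - m]; a pair of
    naturals encodes the integer. *)
Let cocycle m n x : R := phi n (iter m tau x) - phi m (iter m tau x).

Let orb x : set R := [set cocycle mn.1 mn.2 x | mn in [set: nat * nat]].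

Let orb0 x : orb x !=set0.
Proof. by exists (cocycle 0 0 x), (0, 0)%N. Qed.

Let near_cocycle m n x : \forall y \near x, cocycle m n y = cocycle m n x.
Proof.
have h k : \forall y \near x, birkhoff f k (iter m tau y) = birkhoff f k (iter m tau x).
  exact: (@iter_tau_continuous _ _ m x _ (near_birkhoff f k _)).
by apply: filterS2 (h n) (h m) => y e1 e2; rewrite /cocycle /phi e1 e2.
Qed.

Let orb_sigma x a : orb x a <-> orb (sigma x) (a - phi 1 x).
Proof.
have e m n : cocycle m.+1 n (sigma x) = cocycle m n x - phi 1 x.
  rewrite /cocycle iterSr sigmaK -[in phi m.+1]addn1 phiD.
  by rewrite (iterUK (X := subshift_system X)); ring.
split=> [[[m n] _ /= <-]|[[[|m] n] _ /= en]].
- by exists (m.+1, n) => //=; rewrite e.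
- exists (0, n.+1)%N => //=; move: en; rewrite /cocycle /= !phi0 -[n.+1]add1n phiD /=; lra.
- by exists (m, n) => //=; move: en; rewrite e; lra.
Qed.

Let orb_bounded : exists B : R, forall x a, orb x a -> `|a| <= B.
Proof.
have [B HB] := mf; exists (B + B) => x a [[m n] _ /= <-].
by apply: le_trans (ler_normB _ _) _; exact: (lerD (HB n _) (HB m _)).
Qed.

Let orb_sup x : has_sup (orb x).
Proof.
have [B HB] := orb_bounded; split=> //.
by exists B => a /HB; exact: le_trans (ler_norm _).
Qed.

Let orb_inf x : has_inf (orb x).
Proof.
have [B HB] := orb_bounded; split=> //.
by exists (- B) => a /HB; rewrite ler_norml => /andP[].
Qed.

Let hi x := sup (orb x).
Let lo x := inf (orb x).

Let hi_sigma x : hi x - hi (sigma x) = phi 1 x.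
Proof.
apply/le_anti/andP; split.
  rewrite lerBlDr; apply: ge_sup => // a /orb_sigma oa.
  by rewrite -lerBlDl; exact: sup_upper_bound.
rewrite lerBrDl -lerBrDr; apply: ge_sup => // a oa.
rewrite lerBrDr; apply: sup_upper_bound => //.
by apply/orb_sigma; rewrite addrK.
Qed.

Let lo_sigma x : lo x - lo (sigma x) = phi 1 x.
Proof.
apply/le_anti/andP; split; last first.
  rewrite lerBrDl; apply: lb_le_inf => // a /orb_sigma oa.
  by rewrite -lerBrDr; exact: (ge_inf (orb_inf _).2 oa).
rewrite lerBlDl -lerBlDr; apply: lb_le_inf => // a oa.
rewrite lerBlDr; apply: ge_inf; first exact: (orb_inf x).2.
by apply/orb_sigma; rewrite addrK.
Qed.

(** A supremum of locally constant functions is lower semicontinuous. *)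
Let near_hi x e : 0 < e -> \forall y \near x, hi x - e < hi y.
Proof.
move=> e0; have [_ [[m n] _ <-] lt] := sup_adherent e0 (orb_sup x).
have := near_cocycle m n x; apply: filterS => y ey.
apply: lt_le_trans lt _; apply: sup_upper_bound => //.
by exists (m, n).
Qed.

Let near_lo x e : 0 < e -> \forall y \near x, lo y < lo x + e.
Proof.
move=> e0; have [_ [[m n] _ <-] lt] := inf_adherent e0 (orb_inf x).
have := near_cocycle m n x; apply: filterS => y ey.
apply: le_lt_trans lt; apply: ge_inf; first exact: (orb_inf y).2.
by exists (m, n).
Qed.

Let gap_const x0 x : hi x - lo x = hi x0 - lo x0.
Proof.
suff H z0 z : hi z - lo z <= hi z0 - lo z0 by apply/le_anti; rewrite !H.
suff : [set y | hi y - lo y <= hi z0 - lo z0] = setT by move=> E; have : [set: space] z by []; rewrite -E.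
apply: space_minimal_forward; last by exists z0 => /=.
- rewrite -[X in closed X]setCK; apply: open_closedC; rewrite openE => y /=.
  move=> /negP; rewrite -ltNge => lt.
  pose e := (hi y - lo y - (hi z0 - lo z0)) / 2.
  have e0 : 0 < e by rewrite divr_gt0// subr_gt0.
  apply: filterS2 (near_hi y e0) (near_lo y e0) => t h1 h2 /= h3.
  by move: h1 h2 h3; rewrite /e; lra.
- move=> y /=; have := hi_sigma y; have := lo_sigma y; lra.
Qed.

Lemma gottschalk_hedlund : exists th : space -> R,
  (forall x, th (sigma x) = th x + ga - (f x)%:~R) /\
  (forall x e, 0 < e -> \forall y \near x, `|th y - th x| < e).
Proof.
exists hi; split=> [x|x e e0].
  by have := hi_sigma x; rewrite /phi birkhoff1 mul1r; lra.
apply: filterS2 (near_hi x e0) (near_lo x e0) => y h1 h2.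
rewrite ltr_norml; have := gap_const x y; move=> h3; apply/andP; split; lra.
Qed.

End GottschalkHedlund.
End Mean.

(** * Means and continuous eigenvalues *)

Section Complex.
Context (R : realType).
Local Notation normc := (@Normc.normc R).

Lemma cvg_complexP (T : topologicalType) (F : T -> R[i]^o) x :
  F @ x --> F x <-> forall e : R, 0 < e -> \forall y \near x, normc (F x - F y) < e.
Proof.
split=> [/cvgrPdist_lt H e e0|H].
  have e0' : 0 < e%:C%C by rewrite (ltcR 0 e).
  by apply: filterS (H _ e0') => y; rewrite -ltcR.
apply/cvgrPdist_lt => e e0; have eE : e = (complex.Re e)%:C%C.
  by move: e0; case: e => a b; rewrite ltcE /= => /andP[/eqP -> _].
have e0' : 0 < complex.Re e by move: e0; rewrite ltcE /= => /andP[].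
by apply: filterS (H _ e0') => y; rewrite eE -ltcR.
Qed.

Lemma expi_int (n : int) : expi (2 * pi * n%:~R : R) = 1.
Proof.
have N (k : nat) : expi (2 * pi * k%:R : R) = 1.
  elim: k => [|k IHk]; first by rewrite mulr0 expi0.
  have -> : 2 * pi * k.+1%:R = 2 * pi * k%:R + 2 * pi :> R by rewrite -natr1; ring.
  by rewrite expiD IHk expi2pi; exact: mulr1.
case: n => k; first exact: N.
rewrite NegzE mulrNz mulrN; apply: (mulIf (expi_neq0 (2 * pi * k.+1%:R))).
by rewrite -expiD addNr expi0 N mulr1.
Qed.

(** For a fractional part [0 < t < 1], [cos (2 pi t) = 1 - 2 sin^2 (pi t)] is below 1. *)
Lemma expi_eq1 (r : R) : expi (2 * pi * r) = 1 -> exists n : int, r = n%:~R.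
Proof.
move=> e1; exists (Num.floor r); apply/eqP; rewrite -subr_eq0; set t := r - _.
have : expi (2 * pi * t) = 1.
  by rewrite /t mulrBr -(mulr1 (expi _)) -[X in _ * X](expi_int (Num.floor r)) -expiD subrK.
have t0 : 0 <= t by rewrite subr_ge0 floor_le.
have t1 : t < 1 by have /andP[_] := floor_itv r; rewrite intrD /t; lra.
apply: contra_eqT => tn0; rewrite eq_complex /= negb_and; apply/orP; left.
have p0 := pi_gt0 R.
have s0 : 0 < sin (pi * t).
  have {}t0 : 0 < t by rewrite lt_def tn0.
  apply: sin_gt0_pi; rewrite mulr_gt0//=.
  by rewrite -[X in _ < X]mulr1 ltr_pM2l.
rewrite -mulrA mulr_natl cos_mulr2n; apply/negP => /eqP h.
have := cos2Dsin2 (pi * t); move: h s0; set c := cos _; set s := sin _ => h s0.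
have : 0 < s ^+ 2 by rewrite exprn_gt0.
lra.
Qed.

Lemma circle_param (c s : R) : c ^+ 2 + s ^+ 2 = 1 -> exists t : R,
  [/\ c = cos (2 * pi * t), s = sin (2 * pi * t), `|t| <= 1 / 2 &
      0 < c -> `|t| < 1 / 4].
Proof.
move=> cs; have p0 := pi_gt0 R.
have c1 : -1 <= c <= 1.
  by have := sqr_ge0 s; move=> s2; apply/andP; split; nra.
pose a := acos c / (2 * pi).
have aE : 2 * pi * a = acos c by rewrite /a mulrC divfK// gt_eqF// mulr_gt0.
have ca : cos (2 * pi * a) = c by rewrite aE acosK// in_itv.
have sa : sin (2 * pi * a) = `|s|.
  rewrite aE sin_acos// -sqrtr_sqr; congr Num.sqrt; lra.
have a0 : 0 <= a by rewrite divr_ge0 ?acos_ge0// mulr_ge0// ltW.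
have a1 : a <= 1 / 2.
  by rewrite ler_pdivrMr ?mulr_gt0// mulrA divfK//; have := acos_lepi c1; lra.
have ha : 0 < c -> a < 1 / 4.
  move=> c0; rewrite ltr_pdivrMr ?mulr_gt0//.
  have -> : 1 / 4 * (2 * pi) = pi / 2 :> R by field.
  rewrite ltNge; apply/negP => le; move: c0; rewrite -(acosK (x := c)) ?in_itv//.
  move: le; rewrite le_eqVlt => /orP[/eqP <-|lt]; first by rewrite cos_pihalf ltxx.
  rewrite -[acos c](subrK pi) cosDpi oppr_gt0; apply/negP; rewrite -leNgt ltW//.
  by apply: cos_gt0_pihalf; have := acos_lepi c1; move=> h; apply/andP; split; lra.
exists (if 0 <= s then a else - a); case: ifP => [s0|/negbT s0]; last first.
  have sE : s = - `|s| by rewrite ltr0_norm ?opprK// ltNge.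
  by rewrite mulrN cosN sinN ca sa normrN [`|a|]ger0_norm.
by rewrite ca sa !ger0_norm.
Qed.

Lemma normc_gt0 (z : R[i]) : z != 0 -> 0 < normc z.
Proof.
move=> z0; rewrite lt_def; apply/andP; split; last by case: z {z0} => a b; exact: sqrtr_ge0.
by apply: contra z0 => /eqP/Normc.eq0_normc ->.
Qed.

Lemma normc_expi (t : R) : normc (expi t) = 1.
Proof. by rewrite /expi /Normc.normc cos2Dsin2 sqrtr1. Qed.

Lemma Re_le_normc (z : R[i]) : `|complex.Re z| <= normc z.
Proof.
case: z => a b; rewrite /Normc.normc /= -sqrtr_sqr ler_wsqrtr//.
by rewrite lerDl sqr_ge0.
Qed.

Lemma normc_le (a b : R) : normc (a +i* b)%C <= `|a| + `|b|.
Proof.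
rewrite /Normc.normc -[leRHS]ger0_norm ?addr_ge0// -sqrtr_sqr ler_wsqrtr//.
rewrite sqrrD !real_normK ?num_real// -addrA lerD2l lerDr mulrn_wge0// mulr_ge0//.
Qed.

Lemma normc_triangle (x y z : R[i]) : normc (x - y) <= normc (z - x) + normc (z - y).
Proof.
rewrite -lecR rmorphD /=.
rewrite -[(normc (x - y))%:C%C]/(`|x - y|) -[(normc (z - x))%:C%C]/(`|z - x|).
rewrite -[(normc (z - y))%:C%C]/(`|z - y|) -(distrC x z).
by apply: le_trans (ler_normD _ _); rewrite addrA subrK.
Qed.

Lemma polar (z : R[i]) : z != 0 -> exists t : R,
  [/\ z = (normc z)%:C%C * expi (2 * pi * t), `|t| <= 1 / 2 &
      0 < complex.Re z -> `|t| < 1 / 4].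
Proof.
move=> /normc_gt0; set n := normc z => n0.
have nn : complex.Re z ^+ 2 + complex.Im z ^+ 2 = n ^+ 2.
  by rewrite /n; case: (z) => a b /=; rewrite sqr_sqrtr// addr_ge0 ?sqr_ge0.
have [|t [ct st t1 t2]] := @circle_param (complex.Re z / n) (complex.Im z / n).
  by rewrite !exprMn -mulrDl nn -exprMn divff ?expr1n// gt_eqF.
exists t; split=> //; last by move=> z0; apply: t2; rewrite divr_gt0.
rewrite /expi -ct -st; apply/eqP; rewrite eq_complex /= !mul0r subr0 addr0.
by rewrite !(mulrC n) !divfK ?eqxx ?gt_eqF.
Qed.

Lemma expi_cvg (T : topologicalType) (th : T -> R) x :
  (forall e, 0 < e -> \forall y \near x, `|th y - th x| < e) ->
  (fun y => expi (2 * pi * th y) : R[i]^o) @ x --> (expi (2 * pi * th x) : R[i]^o).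
Proof.
move=> cth; apply/(cvg_complexP (fun y => expi (2 * pi * th y))) => e e0.
have thx : th @ x --> th x.
  by apply/cvgrPdist_lt => d d0; apply: filterS (cth d d0) => y; rewrite distrC.
have thx2 : (fun y => 2 * pi * th y) @ x --> 2 * pi * th x by apply: cvgMr.
have cc : (fun y => cos (2 * pi * th y)) @ x --> cos (2 * pi * th x).
  exact: (cvg_comp _ _ thx2 (@continuous_cos R _)).
have cs : (fun y => sin (2 * pi * th y)) @ x --> sin (2 * pi * th x).
  exact: (cvg_comp _ _ thx2 (@continuous_sin R _)).
have e20 : 0 < e / 2 by rewrite divr_gt0.
move/cvgrPdist_lt/(_ _ e20) : cc => cc; move/cvgrPdist_lt/(_ _ e20) : cs => cs.
apply: filterS2 cc cs => y h1 h2; apply: le_lt_trans (normc_le _ _) _.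
by move: h1 h2; lra.
Qed.

End Complex.

(** * Rounding transfer functions and lifting eigenfunctions *)

Section MeanGroup.
Context (R : realType) (A : finType) (X : minimal_subshift A).
Local Notation space := (Defs.space X).
Local Notation sigma := (@Defs.sigma A X).
Local Notation tau := (@Defs.tau A X).
Local Notation CZ := (CZ X).
Local Notation normc := (@Normc.normc R).
Local Notation is_mean := (@is_mean R A X).
Implicit Types (x y z : space) (m n N : nat) (f g : CZ) (ga : R).

(** Points with the same window share a representative, so [rep] is locally constant; evaluating at
    [rep x] rounds a function to a locally constant one. *)
Lemma rep_exists (Q : space -> space -> Prop) :
  (forall z, \forall y \near z, Q z y) -> exists rep : space -> space,
  (forall x, \forall y \near x, rep y = rep x) /\
  (forall x, exists z, Q z x /\ Q z (rep x)).
Proof.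
move=> /uniform_win[n nP].
exists (fun x => xget point [set y | win n y = win n x]); split=> [x|x].
  have := near_win n x; apply: filterS => y yx; congr xget.
  by apply/seteqP; split=> t /= ->.
apply: nP; apply/esym.
by have /= := @xgetPex _ point [set y | win n y = win n x]; apply; exists x.
Qed.

Definition cts (th : space -> R) :=
  forall x e, 0 < e -> \forall y \near x, `|th y - th x| < e.

Lemma rep_real th e : cts th -> 0 < e -> exists rep : space -> space,
  (forall x, \forall y \near x, rep y = rep x) /\
  (forall x, `|th x - th (rep x)| < e).
Proof.
move=> cth e0; have e20 : 0 < e / 2 by rewrite divr_gt0.
have [z|rep [nrep repP]] := @rep_exists (fun z y => `|th y - th z| < e / 2).
  exact: cth.
exists rep; split=> // x; have [z [h1 h2]] := repP x.
move: h1 h2; rewrite !ltr_norml => /andP[? ?] /andP[? ?]; apply/andP; split; lra.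
Qed.

Lemma sigma_near (T : Type) (h : space -> T) : (forall x, \forall y \near x, h y = h x) ->
  forall x, \forall y \near x, h (sigma y) = h (sigma x).
Proof. by move=> nh x; exact: (sigma_continuous (nh (sigma x))). Qed.

(** The new function is [ga] plus the increment of [h - th] along [sigma], and [th - h] lies between
    [- ga / 4] and [1 + ga / 4]. So it exceeds [ga / 2 - 1 > -1], and it is integer-valued. *)
Lemma mean_cohomologous f ga : is_mean f ga -> 0 < ga ->
  exists2 f' : CZ, (forall x, 0 <= f' x) & K0_class f = K0_class f'.
Proof.
move=> mf ga0; have [th [thS cth]] := gottschalk_hedlund mf.
have e0 : 0 < ga / 4 by rewrite divr_gt0.
have [rep [nrep repP]] := rep_real cth e0.
pose h x : int := Num.floor (th (rep x)).
have nh x : \forall y \near x, h y = h x.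
  by have := nrep x; apply: filterS => y; rewrite /h => ->.
have h_in : h \in @CZ_pred A X by apply/CZ_predP.
pose hf := MkCZ h_in; exists (f - (hf - CZ_sigma hf)); last first.
  by apply/K0_class_eq; rewrite opprB addrC subrK; apply/asboolP; exists hf.
move=> x; rewrite !CZB /= -[_ - _]/(f x - (h x - h (sigma x))).
suff : -1 < f x - (h x - h (sigma x)) by lia.
rewrite -(ltr_int R) !intrB.
have := thS x; have := repP x; have := repP (sigma x).
have /andP[] := floor_itv (th (rep x)); have /andP[] := floor_itv (th (rep (sigma x))).
rewrite -/(h x) -/(h (sigma x)) !intrD !ltr_norml.
by move=> ? ? ? ? /andP[? ?] /andP[? ?] ?; lra.
Qed.

(** For mean 0 the transfer function is invariant modulo integers, hence constant modulo integers by
    minimality; subtracting its value at one point makes it integer-valued. *)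
Lemma mean0_coboundary f : is_mean f 0 -> f \in @coboundary A X.
Proof.
move=> mf; have [th [thS cth]] := gottschalk_hedlund mf.
pose x0 : space := point; pose d x := th x - th x0.
have dint : [set x | exists n : int, d x = n%:~R] = setT.
  apply: space_minimal_forward.
  - rewrite -[X in closed X]setCK; apply: open_closedC; rewrite openE => y /= ny.
    set k := Num.floor (d y); have /andP[k1 k2] := floor_itv (d y); rewrite -/k in k1 k2.
    have {}k1 : k%:~R < d y.
      by rewrite lt_neqAle k1 andbT; apply/eqP => e; apply: ny; exists k.
    pose e := Num.min (d y - k%:~R) ((k + 1)%:~R - d y).
    have e0 : 0 < e by rewrite lt_min !subr_gt0 k1.
    apply: filterS (cth y e e0) => t td [n dn].
    have : k%:~R < d t < (k + 1)%:~R.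
      move: td; rewrite lt_min !ltr_norml => /andP[/andP[? ?] /andP[? ?]].
      have -> : d t = d y + (th t - th y) by rewrite /d; ring.
      by apply/andP; split; lra.
    by rewrite dn !ltr_int; lia.
  - move=> y /= [n dn]; exists (n - f y); rewrite intrB -dn /d thS; lra.
  - by exists x0; exists 0; rewrite /d subrr.
have /choice[h hP] x : exists n : int, d x = n%:~R.
  by have : [set: space] x by []; rewrite -dint.
have h_in : h \in @CZ_pred A X.
  apply/CZ_predP => x; apply: filterS (cth x 1 ltr01) => y.
  have -> : th y - th x = d y - d x by rewrite /d; ring.
  by rewrite !hP -intrB -intr_norm -[1]/(1%:~R) ltr_int; lia.
apply/asboolP; exists (MkCZ h_in); apply: CZP => x.
rewrite CZB /=; apply/eqP; rewrite -(eqr_int R) intrB -!hP /d thS; apply/eqP; ring.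
Qed.

Lemma mean_eigenvalue f ga : is_mean f ga -> ga \in @Defs.eigenvalue R A X.
Proof.
move=> mf; have [th [thS cth]] := gottschalk_hedlund mf; apply/asboolP.
exists (fun x => expi (2 * pi * th x)); split.
- by move=> x; exact: expi_cvg (cth x).
- by move=> /(congr1 (fun h => h point)) /= /eqP; exact/negP/expi_neq0.
- move=> x; rewrite thS mulrDr mulrDr expiD expiD mulrN -mulrN -rmorphN expi_int.
  by rewrite mulr1 mulrC.
Qed.

(** The argument [t] of [F] is chosen freely at representatives ([r0]) and changes by less than a
    quarter turn from [rep x] to [x] ([s]). Where [rep] is constant at [x] and at [sigma x], only
    four terms [s] vary in the integer [h], by less than 1 in all, so [h] is locally constant. *)
Lemma eigenvalue_mean ga : ga \in @Defs.eigenvalue R A X -> exists f, is_mean f ga.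
Proof.
move=> /asboolP[F [cF F0 FS]]; have Fn0 := eigenfunction_neq0 cF F0 FS.
have nF0 x : 0 < normc (F x) by exact: normc_gt0.
have /choice[r0 r0P] x : exists t : R,
    [/\ F x = (normc (F x))%:C%C * expi (2 * pi * t), `|t| <= 1 / 2 &
        0 < complex.Re (F x) -> `|t| < 1 / 4].
  exact/polar.
have [z|rep [nrep repP]] := @rep_exists (fun z y => normc (F z - F y) < normc (F z) / 4).
  by apply: (cvg_complexP F z).1; [exact: cF|rewrite divr_gt0].
have /choice[s sP] x : exists s : R,
    F x / F (rep x) = (normc (F x / F (rep x)))%:C%C * expi (2 * pi * s) /\ `|s| < 1 / 4.
  have Fr0 : F (rep x) != 0 by [].
  have [|s [s1 _ s2]] := @polar R (F x / F (rep x)); first by rewrite mulf_neq0 ?invr_neq0.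
  exists s; split=> //; apply: s2.
  have [z [/= h1 h2]] := repP x; have nz := nF0 z.
  have h3 := normc_triangle (F x) (F (rep x)) (F z).
  have h4 : normc (F z) <= normc (F z - F (rep x)) + normc (F (rep x)).
    have := normc_triangle (F z) 0 (F (rep x)); rewrite !subr0.
    have -> // : normc (F (rep x) - F z) = normc (F z - F (rep x)).
    by rewrite -opprB; exact: normcN.
  (* Both values are within [|F z| / 4] of [F z]: their distance is below [|F z| / 2], and
     [|F (rep x)|] is above [3 |F z| / 4]. *)
  have h5 : normc (F x / F (rep x) - 1) < 1.
    rewrite -(divff Fr0) -mulrBl Normc.normcM Normc.normcV ltr_pdivrMr// mul1r.
    lra.
  have := Re_le_normc (F x / F (rep x) - 1); rewrite ler_norml => /andP[+ _].
  have -> : complex.Re (F x / F (rep x) - 1) = complex.Re (F x / F (rep x)) - 1.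
    by case: (F x / F (rep x)).
  lra.
pose t x := r0 (rep x) + s x.
have Ft x : F x = (normc (F x))%:C%C * expi (2 * pi * t x).
  have [e1 _ _] := r0P (rep x); have [e2 _] := sP x.
  have nE : (normc (F x))%:C%C = (normc (F x / F (rep x)))%:C%C * (normc (F (rep x)))%:C%C.
    by rewrite -rmorphM -Normc.normcM divfK.
  rewrite nE /t (mulrDr (2 * pi)) expiD -[LHS](divfK (Fn0 (rep x))).
  by rewrite [X in X * _ = _]e2 [X in _ * X = _]e1; ring.
have nS x : normc (F (sigma x)) = normc (F x).
  by rewrite FS Normc.normcM normc_expi mul1r.
have /choice[h hP] x : exists n : int, ga + t x - t (sigma x) = n%:~R.
  apply: expi_eq1; apply: (mulIf (expi_neq0 (2 * pi * t (sigma x)))).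
  rewrite -expiD mul1r -mulrDr subrK.
  have nC : (normc (F x))%:C%C != 0 :> R[i].
    by rewrite eq_complex /= negb_and gt_eqF.
  apply: (mulfI nC); rewrite -{2}nS -Ft FS {2}(Ft x) mulrDr expiD.
  by rewrite mulrCA.
have h_in : h \in @CZ_pred A X.
  apply/CZ_predP => x; apply: filterS2 (nrep x) (sigma_near nrep x) => y e1 e2.
  have := hP x; have := hP y; rewrite /t e1 e2.
  have [_] := sP x; have [_] := sP y; have [_] := sP (sigma x); have [_] := sP (sigma y).
  rewrite !ltr_norml => /andP[? ?] /andP[? ?] /andP[? ?] /andP[? ?] hy hx.
  have d1 : -1 < h y - h x by rewrite -(ltr_int R) intrB; lra.
  have d2 : h y - h x < 1 by rewrite -(ltr_int R) intrB; lra.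
  lia.
exists (MkCZ h_in), 2 => N x.
have -> : (birkhoff (MkCZ h_in) N x)%:~R - N%:R * ga = t x - t (iter N sigma x).
  elim: N => [|N IHN]; first by rewrite /birkhoff big_ord0 mul0r !subrr.
  have -> : birkhoff (MkCZ h_in) N.+1 x = birkhoff (MkCZ h_in) N x + h (iter N sigma x).
    by rewrite -addn1 birkhoffD birkhoff1.
  by rewrite iterS intrD -natr1 -hP; move: IHN; lra.
have tb z : `|t z| <= 3 / 4.
  have [_ h1 _] := r0P (rep z); have [_ h2] := sP z.
  by apply: le_trans (ler_normD _ _) _; lra.
by apply: le_trans (ler_normB _ _) _; have := tb x; have := tb (iter N sigma x); lra.
Qed.

End MeanGroup.

(** * The isomorphisms *)

Section Isomorphism.
Context (R : realType) (A : finType) (X : minimal_subshift A).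
Context (bal : forall f : CZ X, balanced_fun R f).
Implicit Types (f g : CZ X) (k : K0 X).

Definition mean f : R := sval (cid (mean_exists (bal f))).

Lemma meanP f : is_mean f (mean f).
Proof. exact: svalP (cid (mean_exists (bal f))). Qed.

Lemma mean_unique f ga : is_mean f ga -> mean f = ga.
Proof. exact: is_mean_uniq (meanP f). Qed.

Lemma meanB f g : mean (f - g) = mean f - mean g.
Proof. by apply: mean_unique; apply: is_meanB; exact: meanP. Qed.

Lemma mean_coboundary f : f \in @coboundary A X -> mean f = 0.
Proof. by move=> /asboolP[g ->]; apply: mean_unique; exact: is_mean_coboundary. Qed.

Lemma mean_class f g : K0_class f = K0_class g -> mean f = mean g.
Proof. by move=> /K0_class_eq/mean_coboundary; rewrite meanB => /eqP; rewrite subr_eq0 => /eqP. Qed.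

Definition K0_mean k : EX R X := MkEX (mean_eigenvalue (meanP (repr k))).

Lemma K0_mean_class f : EX_val (K0_mean (K0_class f)) = mean f.
Proof. by apply: mean_class; rewrite /K0_class reprK. Qed.

Lemma K0_mean_is_zmod_morphism : zmod_morphism K0_mean.
Proof.
move=> k l; have [f ->] := K0_classP k; have [g ->] := K0_classP l.
apply: val_inj; rewrite -K0_classB.
by rewrite [LHS]K0_mean_class meanB -!K0_mean_class.
Qed.

HB.instance Definition _ := GRing.isZmodMorphism.Build (K0 X) (EX R X) K0_mean
  K0_mean_is_zmod_morphism.

Lemma K0_mean_eq0 k : K0_mean k = 0 -> k = 0.
Proof.
have [f ->] := K0_classP k => /(congr1 (@EX_val R A X)); rewrite K0_mean_class => m0.
have -> : 0 = K0_class (0 : CZ X) by rewrite /K0_class raddf0.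
by apply/K0_class_eq; rewrite subr0; apply: (@mean0_coboundary R); rewrite -[0]/(EX_val (0 : EX R X)) -m0; exact: meanP.
Qed.

Lemma K0_mean_inj : injective K0_mean.
Proof.
move=> k l kl; apply/eqP; rewrite -subr_eq0; apply/eqP/K0_mean_eq0.
by rewrite raddfB /= kl subrr.
Qed.

Lemma K0_mean_surj (e : EX R X) : exists k, K0_mean k = e.
Proof.
have [f mf] := eigenvalue_mean (EX_in e); exists (K0_class f).
by apply: val_inj; rewrite [LHS]K0_mean_class; exact: mean_unique.
Qed.

Lemma K0_mean_bij : bijective K0_mean.
Proof.
have /choice[g gP] := K0_mean_surj.
by exists g => // k; apply: K0_mean_inj; rewrite gP.
Qed.

Lemma K0_mean_pos k : K0_pos k <-> 0 <= EX_val (K0_mean k).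
Proof.
split=> [[f f0 ->]|]; first by rewrite K0_mean_class; exact: is_mean_ge0 f0 (meanP f).
have [f ->] := K0_classP k; rewrite K0_mean_class le_eqVlt => /orP[/eqP m0|m0].
  have -> : K0_class f = 0 by by apply: K0_mean_eq0; apply: val_inj; rewrite [LHS]K0_mean_class -m0.
  exact: K0_pos0.
by have [f' f'0 e] := mean_cohomologous (meanP f) m0; exists f'.
Qed.

Lemma K0_mean_unit : K0_mean (K0_unit X) = EX_unit R X.
Proof.
apply: val_inj; rewrite [LHS]K0_mean_class; apply: mean_unique.
exact: (is_mean_cst R X 1).
Qed.

Lemma dimension_group_iso : uog_isomorphic (dimension_group X) (eigenvalue_group R X).
Proof.
exists (K0_mean : {additive K0 X -> EX R X}); split.
- exact: K0_mean_bij.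
- apply/seteqP; split=> [_ [k kpos <-]|e epos]; first exact/K0_mean_pos.
  have [k ke] := K0_mean_surj e; exists k => //.
  by apply/K0_mean_pos; rewrite ke.
- exact: K0_mean_unit.
Qed.

Hypothesis inf0 : forall k, k \in @infinitesimal R A X -> k = 0.

Definition rK0_mean (l : rK0 R X) : EX R X := K0_mean (repr l).

Lemma rK0_mean_class k : rK0_mean (rK0_class R k) = K0_mean k.
Proof.
congr K0_mean; apply/eqP; rewrite -subr_eq0; apply/eqP/inf0/rK0_class_eq0.
by rewrite /rK0_class raddfB /= reprK subrr.
Qed.

Lemma rK0_classP (l : rK0 R X) : exists k, l = rK0_class R k.
Proof. by exists (repr l); rewrite /rK0_class reprK. Qed.

Lemma rK0_mean_is_zmod_morphism : zmod_morphism rK0_mean.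
Proof.
move=> l m; have [k ->] := rK0_classP l; have [k' ->] := rK0_classP m.
have -> : rK0_class R k - rK0_class R k' = rK0_class R (k - k').
  by rewrite /rK0_class raddfB.
by rewrite !rK0_mean_class raddfB.
Qed.

HB.instance Definition _ := GRing.isZmodMorphism.Build (rK0 R X) (EX R X) rK0_mean
  rK0_mean_is_zmod_morphism.

Lemma reduced_dimension_group_iso :
  uog_isomorphic (reduced_dimension_group R X) (eigenvalue_group R X).
Proof.
have surj (e : EX R X) : exists l, rK0_mean l = e.
  by have [k ke] := K0_mean_surj e; exists (rK0_class R k); rewrite rK0_mean_class.
exists (rK0_mean : {additive rK0 R X -> EX R X}); split.
- have /choice[g gP] := surj.
  exists g => // l; move: (gP (rK0_mean l)).
  have [k ->] := rK0_classP l; have [k' ->] := rK0_classP (g (rK0_mean (rK0_class R k))).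
  by rewrite !rK0_mean_class => /K0_mean_inj ->.
- apply/seteqP; split=> [_ [_ [k kpos ->] <-]|e epos].
    by rewrite /= rK0_mean_class; exact/K0_mean_pos.
  have [k ke] := K0_mean_surj e; exists (rK0_class R k); last by rewrite /= rK0_mean_class.
  by exists k => //; apply/K0_mean_pos; rewrite ke.
- by rewrite /= rK0_mean_class K0_mean_unit.
Qed.

End Isomorphism.

(** * An invariant measure *)

Section InvariantMeasure.
Context (R : realType) (A : finType) (X : minimal_subshift A).
Context (bal : forall f : CZ X, balanced_fun R f).
Local Notation space := (Defs.space X).
Local Notation sigma := (@Defs.sigma A X).
Local Notation tau := (@Defs.tau A X).
Local Notation mean := (mean bal).
Implicit Types (f g : CZ X) (B : set space).

Definition locally_constant (B : set space) : Prop := forall x, \forall y \near x, B y = B x.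

Lemma locally_constant0 : locally_constant set0.
Proof. by move=> x; exact: filterE. Qed.

Lemma locally_constantU : setU_closed locally_constant.
Proof.
move=> B C lB lC x; apply: filterS2 (lB x) (lC x) => y e1 e2.
by rewrite /setU /mkset e1 e2.
Qed.

Lemma locally_constantC : setC_closed locally_constant.
Proof. by move=> B lB x; apply: filterS (lB x) => y e1; rewrite /setC /mkset e1. Qed.

Lemma locally_constant_open B : locally_constant B -> open B.
Proof. by move=> lB; rewrite openE => x Bx; apply: filterS (lB x) => y ->. Qed.

(** A copy of the space that carries the algebra of clopen sets, kept apart from the Borel structure
    on [borel]. *)
Definition clopen_type : Type := space.

HB.instance Definition _ := Pointed.on clopen_type.
HB.instance Definition _ := isAlgebraOfSets.Build default_measure_display
  clopen_type locally_constant0 locally_constantU locally_constantC.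

Lemma indic_in B : locally_constant B -> (fun x => (`[< B x >] : nat)%:Z) \in @CZ_pred A X.
Proof. by move=> lB; apply/CZ_predP => x; apply: filterS (lB x) => y ->. Qed.

Definition indicCZ B : CZ X :=
  if pselect (locally_constant B) is left lB then MkCZ (indic_in lB) else 0.

Lemma indicCZE B x : locally_constant B -> indicCZ B x = (`[< B x >] : nat)%:Z.
Proof. by rewrite /indicCZ; case: pselect. Qed.

Definition clopen_content (B : set clopen_type) : \bar R := (mean (indicCZ B))%:E.

Lemma mean0 : mean 0 = 0.
Proof. by rewrite -(subrr (0 : CZ X)) meanB subrr. Qed.

Lemma meanD f g : mean (f + g) = mean f + mean g.
Proof.
have -> : f + g = f - (0 - g) by rewrite sub0r opprK.
by rewrite !meanB mean0 sub0r opprK.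
Qed.

Lemma mean_sum n (F : nat -> CZ X) : mean (\sum_(0 <= i < n) F i) = \sum_(0 <= i < n) mean (F i).
Proof.
by elim: n => [|n IHn]; rewrite ?big_nil ?mean0// !big_nat_recr//= meanD IHn.
Qed.

Lemma clopen_content0 : clopen_content set0 = 0%E.
Proof.
rewrite /clopen_content (_ : indicCZ set0 = 0) ?mean0//.
by apply: CZP => x; rewrite indicCZE; [case: asboolP|exact: locally_constant0].
Qed.

Lemma clopen_content_ge0 B : (0 <= clopen_content B)%E.
Proof.
rewrite lee_fin; apply: (is_mean_ge0 _ (meanP bal _)) => x.
by rewrite /indicCZ; case: pselect.
Qed.

(* A clopen set is compact, so it is the union of countably many disjoint
   clopen sets only if almost all of them are empty. *)
Lemma clopen_content_sigma_additive : semi_sigma_additive clopen_content.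
Proof.
move=> F mF tF mUF.
have lF i : locally_constant (F i) := mF i.
have lU : locally_constant (\bigcup_n F n) := mUF.
have [N NP] : exists N, forall n, (N <= n)%N -> F n = set0.
  have := @space_compact A X; rewrite compact_cover.
  move=> /(_ nat setT (fun n => F n `|` ~` \bigcup_n F n)) [n _|x _|D _ sD].
  - by apply/locally_constant_open/locally_constantU => //; exact: locally_constantC.
  - have [[n _ Fn]|nF] := pselect ((\bigcup_n F n) x); first by exists n => //; left.
    by exists 0%N => //; right.
  exists (\max_(n <- finmap.enum_fset D) n).+1 => n Nn; apply/seteqP; split=> // x Fx.
  have [m /= mD [Fm|]] := sD x I; last by case; exists n.
  have mn : m = n by apply: tF => //; exists x.
  by move: Nn; rewrite -mn (big_rem m mD) /= ltnNge leq_maxl.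
apply: (@cvg_near_cst _ _ _ _ _) => //; exists N => // n /= Nn.
rewrite /clopen_content sumEFin -mean_sum; congr (_%:E); congr mean.
apply: CZP => x; rewrite indicCZE//.
have sumE : (\sum_(0 <= i < n) indicCZ (F i)) x = \sum_(0 <= i < n) (`[< F i x >] : nat)%:Z :> int.
  elim: (n) => [|k IHk]; first by rewrite !big_nil.
  by rewrite !big_nat_recr// CZD IHk indicCZE.
rewrite sumE; case: asboolP => [[k _ Fk]|nF] /=.
  have kn : (k < n)%N.
    by rewrite ltnNge; apply/negP => nk; move: Fk; rewrite NP// (leq_trans Nn).
  rewrite (bigD1_seq k) ?mem_index_iota ?iota_uniq//= asboolT//.
  rewrite big1 ?addr0// => i ik; case: asboolP => // Fi.
  by move: ik; rewrite (tF i k) ?eqxx//; exists x.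
by rewrite big1// => i _; case: asboolP => // Fi; case: nF; exists i.
Qed.

HB.instance Definition _ := isMeasure.Build default_measure_display clopen_type R
  clopen_content clopen_content0 clopen_content_ge0 clopen_content_sigma_additive.

Definition clopen_measure : {measure set clopen_type -> \bar R} := clopen_content.

Local Notation borel := (borel X).

(** Carathéodory's outer measure of the clopen content, a measure on Borel sets by [borel_sub]. *)
Definition borel_mean (B : set borel) : \bar R := mu_ext clopen_measure B.

(** An open set is the countable union, over [n], of the clopen sets of points whose cylinder of
    size [n] it contains. *)
Lemma borel_sub (B : set borel) : measurable B ->
  measurable (B : set (g_sigma_algebraType (@measurable _ clopen_type))).
Proof.
move: B; apply: smallest_sub; first exact: smallest_sigma_algebra.
move=> B oB; rewrite (_ : B = \bigcup_n [set x | forall y, win n y = win n x -> B y]).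
  apply: sigma_algebra_bigcup => n; apply: sub_sigma_algebra.
  have lB : locally_constant [set x | forall y, win n y = win n x -> B y].
    by move=> x; apply: filterS (near_win n x) => y yx; rewrite /mkset yx.
  exact: lB.
apply/seteqP; split=> [x Bx|x [n _]]; last exact.
by have [n nP] := nbhs_win (open_nbhs_nbhs (conj oB Bx)); exists n.
Qed.

Lemma borel_mean0 : borel_mean set0 = 0%E.
Proof. exact: mu_ext0. Qed.

Lemma borel_mean_ge0 B : (0 <= borel_mean B)%E.
Proof. exact: mu_ext_ge0. Qed.

Lemma borel_mean_sigma_additive : semi_sigma_additive borel_mean.
Proof.
move=> F mF tF mUF.
apply: (measure_semi_sigma_additive (s := measure_extension clopen_measure)) => //.
  by move=> i; exact: borel_sub.
exact: borel_sub.
Qed.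

HB.instance Definition _ := isMeasure.Build _ borel R
  borel_mean borel_mean0 borel_mean_ge0 borel_mean_sigma_additive.

Lemma borel_mean_setT : borel_mean setT = 1%E.
Proof.
rewrite /borel_mean measurable_mu_extE; last exact: measurableT.
rewrite /= /clopen_content (_ : indicCZ setT = CZ_cst X 1).
  by rewrite (mean_unique bal (is_mean_cst R X 1)).
by apply: CZP => x; rewrite indicCZE; [rewrite asboolT|move=> y; exact: filterE].
Qed.

HB.instance Definition _ := Measure_isProbability.Build _ borel R borel_mean borel_mean_setT.

Lemma mean_CZ_sigma f : mean (CZ_sigma f) = mean f.
Proof.
have cob : f - CZ_sigma f \in @coboundary A X by apply/asboolP; exists f.
by have /eqP := mean_coboundary bal cob; rewrite meanB subr_eq0 => /eqP.
Qed.

Lemma locally_constant_sigma B : locally_constant B -> locally_constant (sigma @^-1` B).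
Proof. by move=> lB x; exact: (sigma_continuous (lB (sigma x))). Qed.

Lemma locally_constant_tau B : locally_constant B -> locally_constant (tau @^-1` B).
Proof. by move=> lB x; exact: (tau_continuous (lB (tau x))). Qed.

Lemma clopen_content_sigma B : locally_constant B -> clopen_content (sigma @^-1` B) = clopen_content B.
Proof.
move=> lB; rewrite /clopen_content -(mean_CZ_sigma (indicCZ B)); congr (mean _)%:E.
by apply: CZP => x; rewrite /= !indicCZE//; exact: locally_constant_sigma.
Qed.

(** A clopen cover of [B] pulls back to a clopen cover of its preimage with the same total content.
    Using this for [sigma] and for [tau] gives invariance. *)
Lemma mu_ext_preimage (h : space -> space) (B : set space) :
  (forall C, locally_constant C -> locally_constant (h @^-1` C)) ->
  (forall C, locally_constant C -> clopen_content (h @^-1` C) = clopen_content C) ->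
  (borel_mean (h @^-1` B) <= borel_mean B)%E.
Proof.
move=> lh ch; apply: ereal_inf_le_tmp => _ [F [mF BF] <-].
exists (fun k => h @^-1` (F k)).
  by split=> [i|x /BF[k _ Fk]]; [exact: lh (mF i)|exists k].
by apply: eq_eseriesr => k _; exact: ch (mF k).
Qed.

Lemma borel_mean_invariant : Defs.invariant (borel_mean : probability borel R).
Proof.
move=> B _; apply/le_anti/andP; split.
  exact: (mu_ext_preimage _ locally_constant_sigma clopen_content_sigma).
have -> : B = tau @^-1` (sigma @^-1` B) :> set space.
  by apply/seteqP; split=> x /=; rewrite tauK.
rewrite [in X in (_ <= X)%E](_ : sigma @^-1` (tau @^-1` (sigma @^-1` B)) = sigma @^-1` B); last first.
  by apply/seteqP; split=> x /=; rewrite sigmaK.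
apply: (mu_ext_preimage _ locally_constant_tau) => C lC.
rewrite -(clopen_content_sigma (locally_constant_tau lC)); congr clopen_content.
by apply/seteqP; split=> x /=; rewrite sigmaK.
Qed.

Lemma integralCZ_class mu f g : Defs.invariant mu -> K0_class f = K0_class g ->
  integralCZ (R := R) mu f = integralCZ mu g.
Proof.
move=> imu fg; have : K0_class (f - g) \in @infinitesimal R A X.
  by rewrite K0_classB fg subrr rpred0.
move=> /infinitesimalP/(_ _ imu); rewrite integralCZB => /eqP.
by rewrite sube_eq ?fin_num_adde_defl ?integralCZ_fin_num// add0e => /eqP.
Qed.

(** If [mean f > 0], some multiple of [f] minus 1 has positive mean, so it is cohomologous to a
    nonnegative function, whose integral would be [0 - 1]. This bypasses the computation of the
    integral of [f] as a mean. *)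
Lemma infinitesimal_mean f : K0_class f \in @infinitesimal R A X -> mean f <= 0.
Proof.
move=> finf; rewrite leNgt; apply/negP => m0.
pose N := Num.bound (mean f)^-1.
have Nm : 1 < N%:R * mean f.
  by rewrite -ltr_pdivrMr// div1r; apply: archi_boundP; rewrite invr_ge0 ltW.
pose mu : probability borel R := borel_mean.
have imu : Defs.invariant mu := borel_mean_invariant.
have meanN : mean (f *+ N - CZ_cst X 1) = N%:R * mean f - 1.
  rewrite meanB (mean_unique bal (is_mean_cst R X 1)); congr (_ - _).
  elim: (N) => [|k IHk]; first by rewrite mulr0n mean0 mul0r.
  by rewrite mulrS meanD IHk -natr1 mulrDl mul1r addrC.
have m1 : 0 < mean (f *+ N - CZ_cst X 1) by rewrite meanN subr_gt0.
have [f' f'0 ff'] := mean_cohomologous (meanP bal _) m1.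
have := integralCZ_ge0 mu f'0; rewrite -(integralCZ_class imu ff') integralCZB.
have -> : integralCZ mu (f *+ N) = 0%E.
  have finfN : K0_class (f *+ N) \in @infinitesimal R A X.
    by rewrite /K0_class raddfMn; exact: rpredMn.
  by move/infinitesimalP: finfN; exact.
have -> : integralCZ mu (CZ_cst X 1) = 1%E.
  by rewrite /integralCZ /= integral_cst//= probability_setT mule1.
by rewrite sub0e leeNr oppe0 lee_fin ler10.
Qed.

Lemma infinitesimal0 k : k \in @infinitesimal R A X -> k = 0.
Proof.
have [f ->] := K0_classP k => finf; apply: (K0_mean_eq0 (bal := bal)); apply: val_inj.
rewrite [LHS]K0_mean_class; apply/le_anti; rewrite infinitesimal_mean//=.
have mN : mean (- f) = - mean f by rewrite -[- f]sub0r meanB mean0 sub0r.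
by rewrite -oppr_le0 -mN infinitesimal_mean// K0_classN rpredN.
Qed.

End InvariantMeasure.

Theorem theorem7p2 (R : realType) (A : finType) (X : minimal_subshift A)
  (X_infinite : infinite_set (points X))
  (X_complexity :
    (limn_esup (fun q : nat => ((complexity (points X) q)%:R / q%:R : R)%:E)
      < (3 / 2 : R)%:E)%E) :
  uog_isomorphic (dimension_group X) (eigenvalue_group R X) /\
  uog_isomorphic (reduced_dimension_group R X) (eigenvalue_group R X).
Proof.
have bal f := low_complexity_balanced f X_infinite X_complexity.
split; first exact: dimension_group_iso bal.
exact: reduced_dimension_group_iso bal (infinitesimal0 bal).
Qed.
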